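(* Let $s\in(\frac12,1)$ and suppose that $u\in L_s(\mathbb{R})$ solves $$(-\Delta)^s u = e^u \ \text{ in } \mathbb{R} \quad\text{with}\quad \int_{\mathbb{R}} e^u\,dx < +\infty .$$ Then the linearized operator $\mathcal{L}_u=(-\Delta)^s-e^u$ acting on $W_s$ is nondegenerate, i.e., $$\ker\mathcal{L}_u=\{\psi\in W_s : \mathcal{L}_u\psi=0\}=\mathrm{span}\{T_u,R_u\},\qquad T_u:=\partial_xu,\quad R_u:=x\,\partial_xu+2s .$$
   Context: For $s\in(0,1)$ and $\varphi\in C_c^\infty(\mathbb{R})$, $(-\Delta)^s\varphi(x) = C_s\,\mathrm{PV}\int_{\mathbb{R}}\frac{\varphi(x)-\varphi(y)}{|x-y|^{1+2s}}\,dy$ with $C_s = \frac{4^s}{\sqrt{\pi}}\frac{\Gamma(\frac12+s)}{|\Gamma(-s)|}$. The space $L_s(\mathbb{R})$ consists of all real-valued $u\in L^1_{\mathrm{loc}}(\mathbb{R})$ with $\int_{\mathbb{R}}\frac{|u(x)|}{1+|x|^{1+2s}}\,dx<+\infty$. A function $u\in L_s(\mathbb{R})$ with $e^u\in L^1_{\mathrm{loc}}(\mathbb{R})$ is a solution of $(-\Delta)^s u = e^u$ if $\int_{\mathbb{R}} u\,(-\Delta)^s\varphi\,dx = \int_{\mathbb{R}} e^u\varphi\,dx$ for all $\varphi\in C_c^\infty(\mathbb{R})$. Solutions with $e^u\in L^1(\mathbb{R})$ are smooth and bounded from above (after choosing the continuous representative), so $\partial_xu$ is the classical derivative. Define the linear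 space $$W_s:=\{\psi\in L_s(\mathbb{R}) : \psi(x)=O(|x|^{2s-1})\text{ as }|x|\to+\infty\}.$$ For $\psi\in W_s$, the equation $\mathcal{L}_u\psi=0$ means $(-\Delta)^s\psi=e^u\psi$ in the distributional sense, i.e. $\int_{\mathbb{R}}\psi(-\Delta)^s\varphi\,dx=\int_{\mathbb{R}}e^u\psi\varphi\,dx$ for all $\varphi\in C_c^\infty(\mathbb{R})$. *)

(* Defs.v *)
From mathcomp Require Import all_boot all_order all_algebra.
From mathcomp Require Import all_classical all_reals all_analysis.

Set Implicit Arguments.
Unset Strict Implicit.
Unset Printing Implicit Defensive.

Import Order.TTheory GRing.Theory Num.Theory.
Import numFieldNormedType.Exports.

Local Open Scope classical_set_scope.
Local Open Scope ring_scope.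

(* Elements of L^1_loc, L_s and W_s are represented by Borel measurable
   functions R -> R; L_space, W_space, ker_lin and ae_span2 are closed under
   almost-everywhere equality of measurable functions. *)

Definition gamma_int {R : realType} (x : R) : R :=
  \int[lebesgue_measure]_(t in `]0, +oo[) (t `^ (x - 1) * expR (- t)).

(* Extension to nonpositive x by Gamma(x + n) = x (x+1) ... (x+n-1) Gamma(x),
   where n = - floor x; the values at the poles 0, -1, -2, ... are junk. *)
Definition Gamma {R : realType} (x : R) : R :=
  if 0 < x then gamma_int x
  else gamma_int (x + `|Num.floor x|%N%:R) /
       \prod_(k < `|Num.floor x|%N) (x + k%:R).

Definition frac_const {R : realType} (s : R) : R :=
  4 `^ s / Num.sqrt pi * (Gamma (2^-1 + s) / `|Gamma (- s)|).

Definition test_function {R : realType} (phi : R -> R) : Prop :=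
  (forall (n : nat) (x : R), derivable (derive1n n phi) x 1) /\
  compact (closure [set x | phi x != 0]).

Definition frac_lap {R : realType} (s : R) (phi : R -> R) (x : R) : R :=
  frac_const s *
  lim ((\int[lebesgue_measure]_(y in [set y | e < `|x - y|])
          ((phi x - phi y) / `|x - y| `^ (1 + 2 * s))) @[e --> 0^'+]).

Definition L_space {R : realType} (s : R) : set (R -> R) :=
  [set u | locally_integrable [set: R] u /\
    (\int[lebesgue_measure]_x (`|u x| / (1 + `|x| `^ (1 + 2 * s)))%:E < +oo)%E].

(* (-Delta)^s f = g in the distributional sense *)
Definition frac_lap_weak {R : realType} (s : R) (f g : R -> R) : Prop :=
  forall phi : R -> R, test_function phi ->
    (\int[lebesgue_measure]_x (f x * frac_lap s phi x)%:E =
     \int[lebesgue_measure]_x (g x * phi x)%:E)%E.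

Definition liouville_solution {R : realType} (s : R) (u : R -> R) : Prop :=
  [/\ L_space s u,
      locally_integrable [set: R] (fun x => expR (u x)) &
      frac_lap_weak s u (fun x => expR (u x))].

(* The growth condition is meant almost everywhere, as psi is only defined up
   to null sets. *)
Definition W_space {R : realType} (s : R) : set (R -> R) :=
  [set psi | L_space s psi /\
    exists C M : R, {ae lebesgue_measure, forall x : R,
      M < `|x| -> `|psi x| <= C * `|x| `^ (2 * s - 1)}].

Definition ker_lin {R : realType} (s : R) (u : R -> R) : set (R -> R) :=
  [set psi | W_space s psi /\
    frac_lap_weak s psi (fun x => expR (u x) * psi x)].

(* The (unique) continuous function almost everywhere equal to u if there is
   one, and u itself otherwise. *)
Definition cont_rep {R : realType} (u : R -> R) : R -> R :=
  xget u [set v : R -> R | continuous v /\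
    {ae lebesgue_measure, forall x : R, v x = u x}].

Definition T_fun {R : realType} (u : R -> R) : R -> R :=
  derive1 (cont_rep u).

Definition R_fun {R : realType} (s : R) (u : R -> R) : R -> R :=
  fun x => x * derive1 (cont_rep u) x + 2 * s.

(* span {f, g} in the space of measurable functions modulo a.e. equality *)
Definition ae_span2 {R : realType} (f g : R -> R) : set (R -> R) :=
  [set psi | measurable_fun [set: R] psi /\
    exists a b : R, {ae lebesgue_measure, forall x : R,
      psi x = a * f x + b * g x}].

(* Main.v *)
(** Put [p = 2 s - 1], so that [0 < p < 1]. Up to a negative constant, [|x|^p] is a fundamental
    solution of [(-Delta)^s], and a function of [L_s] annihilated by [(-Delta)^s] is affine.
    Hence [u] coincides almost everywhere with [a - C w_V], where [V = e^u] and
    [w_h(x) = \int (|x-y|^p - |y|^p) h(y) dy]; the linear part vanishes since [V] is integrable,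
    and [V] then decays faster than any power. In the same way the elements of the kernel are
    the functions [psi = c - C w_{V psi}], and integration by parts shows that [T = u'] and
    [R = x u' + 2 s] are of this form.

    For the converse, subtract a multiple of [R] to get [\int V psi = 0] (this is possible since
    [\int V R = p \int V > 0]), let [m] be the decaying antiderivative of [- V psi], [eta = m / V]
    and [q = V eta']. Differentiating [V psi] and using that the kernel [sgn(t) |t|^(p-1)] is odd,
      [V psi (z) = C p \iint_{y < z < x} (x-y)^(p-1) (V psi (x) V(y) + V(x) V psi (y))],
    and similarly [V(z) = C p \iint_{y < z < x} (x-y)^(p-1) V(x) V(y)]. Applied to the kernel
    element [psi + eta(z) T], and after an integration by parts, the first identity gives
      [|q(z)| <= C p (1-p) \iint_{y < z < x} (x-y)^(p-2) V(x) V(y) \int_y^x |eta'|].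
    Integrating in [z] and using the second identity, [\int |q| <= (1-p) \int |q|]; so [q = 0],
    [eta] is constant, and [psi] is a multiple of [T]. *)

Require Import Defs.
From mathcomp Require Import all_boot all_order all_algebra.
From mathcomp Require Import all_classical all_reals all_analysis.
From mathcomp Require Import measurable_realfun lebesgue_integral_under.
From mathcomp Require Import ring lra.
Import Order.TTheory GRing.Theory Num.Theory.
Import numFieldNormedType.Exports.
Local Open Scope classical_set_scope.
Local Open Scope ring_scope.
Set Implicit Arguments.
Unset Strict Implicit.
Unset Printing Implicit Defensive.

(** The fundamental solution and the Liouville theorem rest on explicit real-variable constructions.
    The second difference of [|x|^p] at [0] is too large for the kernel, so the fundamental solution
    is read off from the odd antiderivative of [|x|^p]. For the Liouville theorem, [|x|^p] is cut
    off by a regular [H_r] equal to it for [|x| >= r]; convolving the compactly supported difference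
    with a test function gives an admissible test function, and only the contribution of [H_r] has
    to be small in the weight [(1+|x|)^(-2-p)] of [L_s]. Four derivatives put on [H_r] leave
    [(r+|x|)^(p-4)], which is at most that weight times [r^(2p-2)], small for every [p < 1]; three
    would do only for [p < 1/2]. The price is that one merely learns that a fourth derivative
    vanishes, and integrability against the weight then reduces a cubic to an affine function. In
    the last step, [1 - p] is the exponent brought down from [(x-y)^(p-1)] by the integration by
    parts; the power of [x - y] lost there is recovered exactly when [z] runs through an interval of
    length [x - y]. *)

Definition itg {R : realType} (f : R -> R) : Prop :=
  (@lebesgue_measure R).-integrable [set: R] (EFin \o f).

(** * Integrals of real functions on the line *)

Section integration_toolkit.
Context {R : realType}.
Notation mu := (@lebesgue_measure R).
Implicit Types f g : R -> R.

Lemma ae_mono (P Q : R -> Prop) : (forall x, P x -> Q x) ->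
  {ae mu, forall x, P x} -> {ae mu, forall x, Q x}.
Proof. by move=> h; apply: (@filterS _ _ (ae_filter_ringOfSetsType mu)). Qed.

Lemma ae_and (P Q : R -> Prop) : {ae mu, forall x, P x} ->
  {ae mu, forall x, Q x} -> {ae mu, forall x, P x /\ Q x}.
Proof. by move=> hP hQ; apply: (@filterI _ _ (ae_filter_ringOfSetsType mu)). Qed.

Lemma ae_all (P : R -> Prop) : (forall x, P x) -> {ae mu, forall x, P x}.
Proof. by move=> h; apply: (aeW mu); move=> x; exact: h. Qed.

Lemma itg_meas f : itg f -> measurable_fun [set: R] f.
Proof. by move/integrableP => [/measurable_EFinP]. Qed.

Lemma itg_fin f : itg f -> (\int[mu]_x `|(f x)%:E| < +oo)%E.
Proof. by move/integrableP => []. Qed.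

Lemma itgI f : measurable_fun [set: R] f ->
  (\int[mu]_x `|f x|%:E < +oo)%E -> itg f.
Proof. by move=> mf h; apply/integrableP; split; first exact/measurable_EFinP. Qed.

Lemma itg_le f g : measurable_fun [set: R] f -> itg g ->
  (forall x, `|f x| <= g x) -> itg f.
Proof.
move=> mf ig fg; apply: le_integrable ig => //; first exact/measurable_EFinP.
by move=> x _ /=; rewrite lee_fin (le_trans (fg x))// ler_norm.
Qed.

Lemma eq_itg f g : f =1 g -> itg f -> itg g.
Proof. by move=> /funext ->. Qed.

Lemma itg0 : itg (fun _ : R => 0 : R).
Proof. exact: integrable0. Qed.

Lemma itgD f g : itg f -> itg g -> itg (fun x => f x + g x).
Proof.
move=> hf hg.
by have := integrableD measurableT hf hg; apply: eq_integrable.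
Qed.

Lemma itgN f : itg f -> itg (fun x => - f x).
Proof. by move=> hf; have := integrableN hf; apply: eq_integrable. Qed.

Lemma itgB f g : itg f -> itg g -> itg (fun x => f x - g x).
Proof. by move=> hf /itgN; exact: itgD. Qed.

Lemma itgZ k f : itg f -> itg (fun x => k * f x).
Proof. by move=> hf; have := integrableZl measurableT k hf; apply: eq_integrable. Qed.

Lemma itg_norm f : itg f -> itg (fun x => `|f x|).
Proof. by move=> /integrable_norm; exact. Qed.

Lemma itgMl (h : R -> R) f C : measurable_fun [set: R] h -> (forall x, `|h x| <= C) ->
  itg f -> itg (fun x => h x * f x).
Proof.
move=> mh hC hf; apply: (@itg_le _ (fun x => C * `|f x|)).
- by apply: measurable_funM => //; exact: itg_meas.
- exact/itgZ/itg_norm.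
- by move=> x; rewrite normrM ler_wpM2r.
Qed.

Lemma intE f : itg f -> (\int[mu]_x (f x)%:E = (\int[mu]_x f x)%:E)%E.
Proof. by move=> hf; rewrite /Rintegral fineK//; exact: integrable_fin_num. Qed.

Lemma intD f g : itg f -> itg g ->
  \int[mu]_x (f x + g x) = \int[mu]_x f x + \int[mu]_x g x.
Proof. by move=> hf hg; rewrite RintegralD. Qed.

Lemma intN f : itg f -> \int[mu]_x (- f x) = - \int[mu]_x f x.
Proof.
move=> hf; under eq_Rintegral do rewrite -mulN1r.
by rewrite RintegralZl// mulN1r.
Qed.

Lemma intB f g : itg f -> itg g ->
  \int[mu]_x (f x - g x) = \int[mu]_x f x - \int[mu]_x g x.
Proof. by move=> hf hg; rewrite RintegralB. Qed.

Lemma intZ k f : itg f -> \int[mu]_x (k * f x) = k * \int[mu]_x f x.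
Proof. by move=> hf; rewrite RintegralZl. Qed.

Lemma int0 : \int[mu]_x (0 : R) = 0.
Proof. by rewrite /Rintegral integral0. Qed.

Lemma int_ge0 f : (forall x, 0 <= f x) -> 0 <= \int[mu]_x f x.
Proof. by move=> f0; apply: Rintegral_ge0. Qed.

Lemma int_le f g : itg f -> itg g -> (forall x, f x <= g x) ->
  \int[mu]_x f x <= \int[mu]_x g x.
Proof. by move=> hf hg fg; apply: le_Rintegral. Qed.

Lemma eq_int f g : f =1 g -> \int[mu]_x f x = \int[mu]_x g x.
Proof. by move=> /funext ->. Qed.

Lemma int_norm f : itg f -> `|\int[mu]_x f x| <= \int[mu]_x `|f x|.
Proof. by move=> hf; apply: le_normr_Rintegral. Qed.

Lemma int_norm_le f g : itg f -> itg g -> (forall x, `|f x| <= g x) ->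
  `|\int[mu]_x f x| <= \int[mu]_x g x.
Proof.
move=> hf hg fg; apply: le_trans (int_norm hf) _.
by apply: int_le => //; exact: itg_norm.
Qed.

Lemma itg_ae f g : measurable_fun [set: R] g -> {ae mu, forall x, f x = g x} ->
  itg f -> itg g.
Proof.
move=> mg fg hf; apply: itgI => //.
rewrite (_ : (\int[mu]_x _)%E = \int[mu]_x `|(f x)%:E|)%E; first exact: itg_fin.
apply: ae_eq_integral => //.
- by apply/measurable_EFinP; apply: measurableT_comp.
- by apply: measurableT_comp => //; apply/measurable_EFinP; exact: itg_meas hf.
- by apply: ae_mono fg => x /= ->.
Qed.

Lemma int_ae f g : measurable_fun [set: R] f -> measurable_fun [set: R] g ->
  {ae mu, forall x, f x = g x} -> \int[mu]_x f x = \int[mu]_x g x.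
Proof.
move=> mf mg fg; rewrite /Rintegral; congr fine.
apply: ae_eq_integral => //; try exact/measurable_EFinP.
by apply: ae_mono fg => x /= ->.
Qed.

(** By uniqueness of Lebesgue measure: [|k|] times the image of [mu] under the affine map agrees
    with length on half-open intervals. For [k < 0] the preimage is closed at the other end, which
    leaves its length unchanged. *)
Lemma lebesgue_affine (k a : R) : k != 0 ->
  forall A : set (measurableTypeR R), measurable A ->
  mu ((fun x : R => k * x + a) @^-1` A) = ((`|k|^-1)%:E * mu A)%E.
Proof.
move=> k0 A mA.
have k0' : 0 < `|k| by rewrite normr_gt0.
have mphi : measurable_fun [set: measurableTypeR R]
    (fun x : measurableTypeR R => k * x + a : measurableTypeR R).
  by apply: (@measurable_funD _ _ R) => //; exact: mulrl_measurable.
pose kn : {nonneg R} := NngNum (ltW k0').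
pose phi := fun x : measurableTypeR R => k * x + a : measurableTypeR R.
have h : mu A = mscale kn (pushforward mu phi) A.
  have := @lebesgue_measure_unique R (mscale kn (pushforward mu phi)).
  move=> h0 m; apply: (h0 m) => // {A mA h0} X [[x y] /= _ <-].
  rewrite /mscale/= /pushforward/=.
  have [kp|kneg] := ltP 0 k.
    rewrite (_ : _ @^-1` _ = `](x - a) / k, (y - a) / k]%classic); last first.
      apply/seteqP; split => z /=; rewrite !in_itv/= ltr_pdivrMr// ler_pdivlMr//;
        by rewrite ltrBlDr lerBrDr mulrC.
    rewrite !lebesgue_measure_itv/= !lte_fin ltr_pM2r ?invr_gt0// ltrD2r.
    case: ifPn => xy; last by rewrite mule0.
    rewrite -!EFinB -EFinM; congr (_%:E).
    by rewrite -mulrBl gtr0_norm//; field; rewrite gt_eqF.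
  have kn0 : k < 0 by rewrite lt_neqAle k0.
  rewrite (_ : _ @^-1` _ = `[(y - a) / k, (x - a) / k[%classic); last first.
    apply/seteqP; split => z /=; rewrite !in_itv/= ler_ndivrMr// ltr_ndivlMr//;
      by rewrite ltrBlDr lerBrDr mulrC andbC.
  rewrite !lebesgue_measure_itv/= !lte_fin ltr_nM2r ?invr_lt0// ltrD2r.
  case: ifPn => xy; last by rewrite mule0.
  rewrite -!EFinB -EFinM; congr (_%:E).
  by rewrite -mulrBl ltr0_norm//; field.
rewrite (h mphi) /mscale/= muleA -EFinM mulVf ?gt_eqF// mul1e.
by [].
Qed.

Lemma ge0_int_affine (k a : R) (f : R -> \bar R) : k != 0 ->
  measurable_fun [set: R] f -> (forall x, 0 <= f x)%E ->
  (\int[mu]_x f (k * x + a)%R = (`|k|^-1)%:E * \int[mu]_x f x)%E.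
Proof.
move=> k0 mf f0.
have k0' : 0 <= `|k|^-1 by rewrite invr_ge0.
have mphi : measurable_fun [set: measurableTypeR R]
    (fun x : measurableTypeR R => k * x + a : measurableTypeR R).
  by apply: (@measurable_funD _ _ R) => //; exact: mulrl_measurable.
pose kn : {nonneg R} := NngNum k0'.
pose phi := fun x : measurableTypeR R => k * x + a : measurableTypeR R.
have -> : ((`|k|^-1)%:E * \int[mu]_x f x = \int[mscale kn mu]_x f x)%E.
  by rewrite ge0_integral_mscale.
have -> : (\int[mscale kn mu]_x f x = \int[pushforward mu phi]_x f x)%E.
  apply: eq_measure_integral => A mA _.
  exact: esym (lebesgue_affine a k0 mA).
by rewrite ge0_integral_pushforward.
Qed.

Lemma measurable_affine (k a : R) f : measurable_fun [set: R] f ->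
  measurable_fun [set: R] (fun x => f (k * x + a)).
Proof.
move=> mf; apply: (measurableT_comp mf).
by apply: measurable_funD.
Qed.

Lemma itg_affine (k a : R) f : k != 0 -> itg f -> itg (fun x => f (k * x + a)).
Proof.
move=> k0 hf; have mf := itg_meas hf.
apply: itgI; first exact: (@measurable_affine k a f mf).
rewrite (@ge0_int_affine k a (fun x => `|f x|%:E))//.
- have := itg_fin hf; rewrite -(@ge0_fin_numE _ (\int[mu]_x _)%E); last exact: integral_ge0.
  by move=> h; rewrite -ge0_fin_numE ?fin_numM// mule_ge0// ?lee_fin ?invr_ge0// integral_ge0.
- by apply/measurable_EFinP; apply: measurableT_comp.
Qed.

Lemma int_affine (k a : R) f : k != 0 -> itg f ->
  \int[mu]_x f (k * x + a) = `|k|^-1 * \int[mu]_x f x.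
Proof.
move=> k0 hf; have mf := itg_meas hf.
have hg := itg_affine a k0 hf.
apply: EFin_inj; rewrite EFinM -!intE//.
have e1 : (\int[mu]_x (fun x => (f (k * x + a)%R)%:E)^\+ x =
  \int[mu]_x (EFin \o f)^\+ (k * x + a)%R)%E by apply: eq_integral => x _; rewrite !funeposE.
have e2 : (\int[mu]_x (fun x => (f (k * x + a)%R)%:E)^\- x =
  \int[mu]_x (EFin \o f)^\- (k * x + a)%R)%E by apply: eq_integral => x _; rewrite !funenegE.
have mF : measurable_fun [set: R] (EFin \o f) by exact/measurable_EFinP.
have E1 : (\int[mu]_x (f (k * x + a)%R)%:E =
  (`|k|^-1)%:E * \int[mu]_x (EFin \o f)^\+ x -
  (`|k|^-1)%:E * \int[mu]_x (EFin \o f)^\- x)%E.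
  rewrite integralE e1 e2 ge0_int_affine//; last exact: measurable_funepos.
  by rewrite ge0_int_affine//; exact: measurable_funeneg.
have E2 : (\int[mu]_x (f x)%:E =
  \int[mu]_x (EFin \o f)^\+ x - \int[mu]_x (EFin \o f)^\- x)%E by rewrite integralE.
have P := integrable_pos_fin_num measurableT hf.
have N := integrable_neg_fin_num measurableT hf.
by rewrite E1 E2 -(fineK P) -(fineK N) -!EFinM -!EFinB -?EFinM; congr (_%:E); rewrite mulrBr.
Qed.

Lemma itg_shift a f : itg f -> itg (fun x => f (x + a)).
Proof.
move=> /(itg_affine a (oner_neq0 R)); apply: eq_itg => x.
by rewrite mul1r.
Qed.

Lemma int_shift a f : itg f -> \int[mu]_x f (x + a) = \int[mu]_x f x.
Proof.
move=> hf; have := int_affine a (oner_neq0 R) hf.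
rewrite normr1 invr1 mul1r => <-; apply: eq_int => x; by rewrite mul1r.
Qed.

Lemma itg_refl a f : itg f -> itg (fun x => f (a - x)).
Proof.
have n1 : (-1 : R) != 0 by rewrite oppr_eq0 oner_eq0.
move=> /(itg_affine a n1); apply: eq_itg => x.
by rewrite mulN1r addrC.
Qed.

Lemma int_refl a f : itg f -> \int[mu]_x f (a - x) = \int[mu]_x f x.
Proof.
have n1 : (-1 : R) != 0 by rewrite oppr_eq0 oner_eq0.
move=> hf; have := int_affine a n1 hf.
rewrite normrN normr1 invr1 mul1r => <-; apply: eq_int => x; by rewrite mulN1r addrC.
Qed.

End integration_toolkit.

(** * Double integrals and Fubini *)

Definition itg2 {R : realType} (F : R -> R -> R) : Prop :=
  (@lebesgue_measure R \x @lebesgue_measure R)%E.-integrable setT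
    (fun z => (F z.1 z.2)%:E).

Section real_fubini.
Context {R : realType}.
Notation mu := (@lebesgue_measure R).
Implicit Types F : R -> R -> R.

(** The Tonelli criterion in the form in which it is checked later: an integrable bound for the
    [L^1] norms of the slices. *)
Lemma itg2I F (g : R -> R) :
  measurable_fun [set: R * R] (fun z => F z.1 z.2) ->
  (forall x, itg (F x)) -> itg g -> (forall x, \int[mu]_y `|F x y| <= g x) ->
  itg2 F.
Proof.
move=> mF iF ig Fg; apply/integrable12ltyP => /=; first exact/measurable_EFinP.
apply: (@le_lt_trans _ _ (\int[mu]_x `|(g x)%:E|)%E); last exact: itg_fin.
apply: ge0_le_integral => //.
- by move=> x _; exact: integral_ge0.
- apply: (@measurable_fun_fubini_tonelli_F _ _ _ _ _ _
    (fun z : measurableTypeR R * measurableTypeR R => `|(F z.1 z.2)%:E|%E)) => //=.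
  by apply/measurable_EFinP; apply: measurableT_comp.
- by apply: measurableT_comp => //; apply/measurable_EFinP; exact: itg_meas.
- move=> x _ /=; have := Fg x; rewrite -lee_fin -intE; last exact/itg_norm.
  by move=> /le_trans; apply; rewrite lee_fin ler_norm.
Qed.

Lemma itg2_sym F : itg2 F -> itg2 (fun x y => F y x).
Proof.
move=> h; have /integrableP[/measurable_EFinP mF _] := h.
apply/integrable21ltyP => /=.
  apply/measurable_EFinP.
  exact: (measurableT_comp mF (measurable_fun_pair measurable_snd measurable_fst)).
by have /integrable12ltyP := h; apply; exact/measurable_EFinP.
Qed.

Lemma itg2_left F : itg2 F -> itg (fun x => \int[mu]_y F x y).
Proof.
move=> h; have hF := integrable_fubini_F h.
have /integrableP[mG _] := hF.
apply: itgI; first by apply: (measurableT_comp _ mG) => //; exact: fine_measurable.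
case/integrableP : hF => _; apply: le_lt_trans.
apply: ge0_le_integral => //.
- by apply/measurable_EFinP/measurableT_comp => //; apply: (measurableT_comp _ mG) => //; exact: fine_measurable.
- exact: measurableT_comp.
- move=> x _; rewrite /Rintegral /fubini_F; set I := (\int[_]_y _)%E.
  by case: I => [r| |] /=; rewrite ?lee_fin ?leey.
Qed.

Lemma itg2_right F : itg2 F -> itg (fun y => \int[mu]_x F x y).
Proof. by move=> /itg2_sym/itg2_left. Qed.

(** The inner integral is finite only for almost every [x]. Elsewhere its real value is the default
    [0], which the outer integral does not see. *)
Lemma fine_fubini F : itg2 F ->
  (\int[mu]_x (\int[mu]_y F x y)%:E = \int[mu]_x \int[mu]_y (F x y)%:E)%E.
Proof.
move=> h; have hF := integrable_fubini_F h.
apply: ae_eq_integral => //.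
- by apply/measurable_EFinP; exact: (itg_meas (itg2_left h)).
- by case/integrableP : hF.
have := integrable_ae measurableT hF.
apply: ae_mono => x /= + _ => /(_ I) fx.
by rewrite /Rintegral fineK.
Qed.

Lemma real_fubini F : itg2 F ->
  \int[mu]_x \int[mu]_y F x y = \int[mu]_y \int[mu]_x F x y.
Proof.
move=> h; apply: EFin_inj; rewrite -!intE; [|exact: itg2_right|exact: itg2_left].
rewrite fine_fubini// (fine_fubini (itg2_sym h)).
exact: (Fubini h).
Qed.

Lemma itg2Z k F : itg2 F -> itg2 (fun x y => k * F x y).
Proof. by move=> hf; have := integrableZl measurableT k hf; apply: eq_integrable. Qed.

Lemma itg2_le F G : measurable_fun [set: R * R] (fun z => F z.1 z.2) ->
  itg2 G -> (forall x y, `|F x y| <= G x y) -> itg2 F.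
Proof.
move=> mF iG FG; apply: le_integrable iG => //; first exact/measurable_EFinP.
by move=> [x y] _ /=; rewrite lee_fin (le_trans (FG x y))// ler_norm.
Qed.

Lemma itg2D F G : itg2 F -> itg2 G -> itg2 (fun x y => F x y + G x y).
Proof.
move=> hf hg.
by have := integrableD measurableT hf hg; apply: eq_integrable.
Qed.

Lemma itg2_meas F : itg2 F -> measurable_fun [set: R * R] (fun z => F z.1 z.2).
Proof. by move/integrableP => [/measurable_EFinP]. Qed.

End real_fubini.

Section measurability.
Context {d : measure_display} {T : measurableType d} {R : realType}.

Lemma measurable_natb (b : T -> bool) : measurable_fun [set: T] b ->
  measurable_fun [set: T] (fun x => (b x)%:R : R).
Proof.
move=> mb.
have -> : (fun x => (b x)%:R : R) = (fun x => if b x then 1 else 0).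
  by apply/funext => x; case: (b x).
exact: measurable_fun_ifT.
Qed.

Lemma measurable_powc (f : T -> R) c : measurable_fun [set: T] f ->
  measurable_fun [set: T] (fun x => f x `^ c).
Proof. by move=> mf; apply: (measurableT_comp (measurable_powR _) mf). Qed.

End measurability.

(** * Fundamental theorem of calculus on open and unbounded domains *)

Section open_ftc.
Context {R : realType}.
Notation mu := (@lebesgue_measure R).
Implicit Types (F f : R -> R).

Lemma derivable_continuousW F (x l : R) : is_derive x 1 F l -> {for x, continuous F}.
Proof. by move=> [dF _]; apply: differentiable_continuous; exact/derivable1_diffP. Qed.

Lemma ftc_segment F f (a b : R) : a <= b ->
  (forall x, a <= x <= b -> is_derive x 1 F (f x)) ->
  (forall x, a <= x <= b -> {for x, continuous f}) ->
  (\int[mu]_(x in `[a, b]) (f x)%:E = (F b - F a)%:E)%E.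
Proof.
rewrite le_eqVlt => /predU1P[->|ab] dF cf.
  by rewrite set_itv1 integral_set1 subrr.
rewrite EFinB; apply: continuous_FTC2 => //.
- apply: continuous_in_subspaceT => x; rewrite inE/= in_itv/=; exact: cf.
- split.
  + by move=> x; rewrite in_itv/= => /andP[/ltW ax /ltW xb]; have [] := dF x; rewrite ?ax.
  + apply: cvg_at_right_filter; apply: (derivable_continuousW (l := f a)); apply: dF.
    by rewrite lexx ltW.
  + apply: cvg_at_left_filter; apply: (derivable_continuousW (l := f b)); apply: dF.
    by rewrite lexx ltW.
- move=> x; rewrite in_itv/= => /andP[/ltW ax /ltW xb].
  have dx := dF x; rewrite derive1E; apply: derive_val; apply: dx; exact/andP.
Qed.

(** Here [f] may blow up at the boundary of [D]. Since [0 <= f], monotone convergence over the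
    compact intervals yields the value without prior integrability. *)
Lemma ftc_exhaustion F f (D : set R) (a b : nat -> R) (L : R) :
  (forall n, a n.+1 <= a n) -> (forall n, b n <= b n.+1) -> (forall n, a n <= b n) ->
  D = \bigcup_n `[a n, b n]%classic ->
  (forall x, D x -> is_derive x 1 F (f x)) ->
  (forall x, D x -> {for x, continuous f}) ->
  (forall x, D x -> 0 <= f x) ->
  F (b n) - F (a n) @[n --> \oo] --> L ->
  (\int[mu]_(x in D) (f x)%:E = L%:E)%E.
Proof.
move=> na nb ab DE dF cf f0 FL.
have sub n : `[a n, b n]%classic `<=` D by rewrite DE => x xn; exists n.
have h : (\int[mu]_(x in `[a n, b n]) (f x)%:E)%E @[n --> \oo] --> (\int[mu]_(x in D) (f x)%:E)%E.
  rewrite DE; apply: ge0_nondecreasing_set_cvg_integral.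
  - apply/nondecreasing_seqP => n; apply/subsetPset => x /=.
    by rewrite !in_itv/= => /andP[xa xb]; rewrite (le_trans (na n) xa) (le_trans xb).
  - by move=> i; exact: measurable_itv.
  - move=> i; apply/measurable_EFinP; apply: subspace_continuous_measurable_fun => //.
    apply: continuous_in_subspaceT => x; rewrite inE => /sub; exact: cf.
  - by move=> i x /sub Dx; rewrite lee_fin f0.
have h' : (\int[mu]_(x in `[a n, b n]) (f x)%:E)%E @[n --> \oo] --> L%:E.
  have E n : (\int[mu]_(x in `[a n, b n]) (f x)%:E = (F (b n) - F (a n))%:E)%E.
    apply: ftc_segment => // x xn.
      by apply: dF; apply: (sub n); rewrite /= in_itv.
    by apply: cf; apply: (sub n); rewrite /= in_itv.
  under eq_fun do rewrite E.
  by apply: cvg_EFin; [exact: nearW|exact: FL].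
exact: (cvg_unique _ h h').
Qed.

End open_ftc.

(** * Integrals of powers *)

Section power_integrals.
Context {R : realType}.
Notation mu := (@lebesgue_measure R).

Lemma continuous_normpowR (c : R) : 0 < c -> continuous (fun x : R => `|x| `^ c).
Proof.
move=> c0 x; have [->|x0] := eqVneq x 0.
  rewrite /continuous_at normr0 powR0 ?gt_eqF//.
  suff : `|t| `^ c @[t --> (0 : R)] --> (0 : R) by [].
  apply/cvgrPdist_lt => e e0.
  have ec : 0 < e `^ c^-1 by exact: powR_gt0.
  have E : \forall t \near (0 : R), `|t| < e `^ c^-1 by exact: nbhs0_lt.
  near=> t.
  rewrite sub0r normrN ger0_norm ?powR_ge0//.
  have -> : e = (e `^ c^-1) `^ c by rewrite -powRrM mulVf ?gt_eqF// powRr1// ltW.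
  by rewrite gt0_ltr_powR// ?nnegrE ?normr_ge0 ?powR_ge0//; near: t; exact: E.
apply: (@continuous_comp R R R (fun y => `|y|) (fun y => y `^ c) x).
  exact: (@norm_continuous _ R).
apply: (derivable_continuousW (l := c * `|x| `^ (c - 1))).
by apply: is_derive1_powR; rewrite normr_gt0.
Unshelve. all: by end_near. Qed.

Lemma continuous_powc (c x : R) : 0 < x -> {for x, continuous (fun t : R => t `^ c)}.
Proof. by move=> x0; apply: (derivable_continuousW (l := c * x `^ (c - 1))); exact: is_derive1_powR. Qed.

(** Translates an integral over a set into an integral over the line with a boolean factor, the form
    used for all truncated integrals below. *)
Lemma ge0_int_set (D : set R) (b : R -> bool) (f : R -> R) (L : R) : measurable D ->
  (forall x, D x <-> b x) ->
  measurable_fun [set: R] f -> (forall x, D x -> 0 <= f x) ->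
  (\int[mu]_(x in D) (f x)%:E = L%:E)%E ->
  itg (fun x => (b x)%:R * f x) /\ \int[mu]_x ((b x)%:R * f x) = L.
Proof.
move=> mD bD mf f0 h.
have E : (fun x => ((b x)%:R * f x)%:E) = ((fun x => (f x)%:E) \_ D).
  apply/funext => x; rewrite patchE.
  case: ifPn => [/set_mem/bD ->|]; first by rewrite mul1r.
  by move=> /negP xD; case: (boolP (b x)) => [/bD/mem_set//|_]; rewrite mul0r.
have H : (\int[mu]_x ((b x)%:R * f x)%:E = L%:E)%E.
  by rewrite -h [RHS]integral_mkcond E.
split; last by rewrite /Rintegral H.
apply: itgI.
  apply/measurable_EFinP.
  rewrite (_ : EFin \o _ = (fun x => (f x)%:E) \_ D)//.
  apply/(measurable_restrictT _ mD)/measurable_EFinP.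
  exact: measurable_funS mf.
rewrite (_ : (\int[mu]_x _)%E = L%:E) ?ltry// -H; apply: eq_integral => x _.
rewrite ger0_norm//; case: (boolP (b x)) => [/bD/f0|_]; first by rewrite mul1r.
by rewrite mul0r.
Qed.

(** With [c = 1] this is also the integral of the indicator of an interval, and it serves as such
    several times later. *)
Lemma int_pow_near (c x y : R) : 0 < c -> x < y ->
  itg (fun t => (x < t < y)%R%:R * (c * (t - x) `^ (c - 1))) /\
  \int[mu]_t ((x < t < y)%R%:R * (c * (t - x) `^ (c - 1))) = (y - x) `^ c.
Proof.
move=> c0; wlog -> : x y / x = 0.
  move=> /(_ 0 (y - x) erefl) + xy; rewrite subr_gt0 => /(_ xy).
  rewrite !subr0 => -[i1 i2].
  have E : (fun t => (x < t < y)%R%:R * (c * (t - x) `^ (c - 1))) =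
    (fun t => (fun t => (0 < t < y - x)%R%:R * (c * (t - 0) `^ (c - 1))) (t + (- x))).
    by apply/funext => t; rewrite subr0 subr_gt0 ltrD2r.
  rewrite E; split; first exact: (itg_shift (- x) i1).
  rewrite -i2; exact: (int_shift (- x) i1).
move=> y0; rewrite subr0.
apply: (@ge0_int_set `]0, y[%classic) => //.
- apply: measurable_funM => //; apply: measurable_powc.
  exact: measurable_funB.
- by move=> t _; rewrite mulr_ge0 ?powR_ge0// ltW.
pose a n : R := y / n.+2%:R.
have a_gt0 n : 0 < a n by rewrite divr_gt0.
have ale m n : (m <= n)%N -> a n <= a m.
  by move=> mn; rewrite /a ler_pM2l// lef_pV2 ?posrE// ler_nat.
have a0 : a n @[n --> \oo] --> (0 : R).
  rewrite /a -(mulr0 y); apply: cvgMr.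
  have := @cvg_harmonic R; rewrite -cvg_shiftS; exact.
(* The absolute value makes the antiderivative continuous at [0], which gives the limit at the
   singular end. *)
apply: (@ftc_exhaustion _ (fun t => `|t| `^ c) _ _ a (fun n => y - a n)).
- by move=> n; exact: ale.
- by move=> n; rewrite lerD2l lerN2; exact: ale.
- move=> n; have : a n <= y / 2%:R := ale 0%N n isT.
  by move: (a n) => b; lra.
- apply/seteqP; split => t /=.
    rewrite in_itv/= => /andP[t0 ty].
    have yt : 0 < y - t by rewrite subr_gt0.
    pose N := Num.bound (y / t + y / (y - t)).
    have hN : y / t + y / (y - t) < N%:R.
      by rewrite archi_boundP// addr_ge0// divr_ge0// ltW.
    exists N => //=; rewrite in_itv/= /a.
    have h1 : y / t < N.+2%:R.
      apply: (@lt_trans _ _ N%:R); last by rewrite ltr_nat.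
      by apply: le_lt_trans hN; rewrite lerDl divr_ge0// ltW.
    have h2 : y / (y - t) < N.+2%:R.
      apply: (@lt_trans _ _ N%:R); last by rewrite ltr_nat.
      by apply: le_lt_trans hN; rewrite lerDr divr_ge0// ltW.
    rewrite ler_pdivrMr// mulrC -ler_pdivrMr// (ltW h1)/=.
    by rewrite lerBrDr -lerBrDl ler_pdivrMr// mulrC -ler_pdivrMr// ltW.
  move=> [n _]/=; rewrite !in_itv/= => /andP[h1 h2].
  rewrite (lt_le_trans (a_gt0 n) h1)/= (le_lt_trans h2)//.
  by rewrite ltrBlDr ltrDl.
- move=> t /=; rewrite in_itv/= => /andP[t0 _]; rewrite subr0.
  apply: (@is_derive_eq _ _ _ _ _ _ (c * t `^ (c - 1))) => //.
  have := is_derive1_powR c t0.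
  apply: (near_eq_is_derive); rewrite ?oner_neq0//; near=> z.
  rewrite gtr0_norm//; near: z; exact: lt_nbhsr.
- move=> t /=; rewrite in_itv/= => /andP[t0 _].
  rewrite (_ : (fun _ => _) = fun t => c * (t `^ (c - 1))); last by apply/funext => z; rewrite subr0.
  by apply: cvgMr; apply: continuous_powc.
- by move=> t _; rewrite mulr_ge0 ?powR_ge0// ltW.
- rewrite -[X in _ --> X]subr0 -[X in X `^ c](gtr0_norm y0).
  have := continuous_normpowR c0 => cc.
  apply: cvgB.
    apply: (@continuous_cvg _ _ _ _ _ _ (fun x : R => `|x| `^ c) y (cc y)).
    by rewrite -[X in _ --> X]subr0; apply: cvgB => //; exact: cvg_cst.
  have H : `|a n| `^ c @[n --> \oo] --> `|0 : R| `^ c.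
    by apply: (@continuous_cvg _ _ _ _ _ _ (fun x : R => `|x| `^ c) 0 (cc 0)).
  by move: H; rewrite normr0 powR0 ?gt_eqF.
Unshelve. all: by end_near. Qed.

Lemma int_pow_far (c x y : R) : 0 < c -> x < y ->
  itg (fun t => (y < t)%R%:R * (c * (t - x) `^ (- c - 1))) /\
  \int[mu]_t ((y < t)%R%:R * (c * (t - x) `^ (- c - 1))) = (y - x) `^ (- c).
Proof.
move=> c0; wlog -> : x y / x = 0.
  move=> /(_ 0 (y - x) erefl) + xy; rewrite subr_gt0 => /(_ xy).
  rewrite !subr0 => -[i1 i2].
  have E : (fun t => (y < t)%R%:R * (c * (t - x) `^ (- c - 1))) =
    (fun t => (fun t => (y - x < t)%R%:R * (c * (t - 0) `^ (- c - 1))) (t + (- x))).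
    by apply/funext => t; rewrite subr0 ltrD2r.
  rewrite E; split; first exact: (itg_shift (- x) i1).
  rewrite -i2; exact: (int_shift (- x) i1).
move=> y0; rewrite subr0.
apply: (@ge0_int_set `]y, +oo[%classic) => //.
- by move=> x0; rewrite /= ?in_itv/= ?andbT.
- apply: measurable_funM => //; apply: measurable_powc.
  exact: measurable_funB.
- by move=> t _; rewrite mulr_ge0 ?powR_ge0// ltW.
pose a n : R := n.+1%:R^-1.
have a_gt0 n : 0 < a n by rewrite invr_gt0.
have ale m n : (m <= n)%N -> a n <= a m.
  by move=> mn; rewrite /a lef_pV2 ?posrE// ler_nat.
have a0 : a n @[n --> \oo] --> (0 : R) by exact: cvg_harmonic.
have a1 n : a n <= 1 by rewrite /a invf_le1// ler1n.
(* Written in terms of [t^-1], the limit at infinity becomes continuity of [|.|^c] at [0]. *)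
apply: (@ftc_exhaustion _ (fun t => - `|t^-1| `^ c) _ _ (fun n => y + a n) (fun n => y + n.+1%:R)).
- by move=> n; rewrite lerD2l; exact: ale.
- by move=> n; rewrite lerD2l ler_nat.
- by move=> n; rewrite lerD2l (le_trans (a1 n))// ler1n.
- apply/seteqP; split => t /=.
    rewrite in_itv/= andbT => ty.
    have yt : 0 < t - y by rewrite subr_gt0.
    pose N := Num.bound ((t - y) + (t - y)^-1).
    have hN : (t - y) + (t - y)^-1 < N%:R.
      by rewrite archi_boundP// addr_ge0// ?invr_ge0 ltW.
    exists N => //=; rewrite in_itv/= /a.
    have h1 : (t - y)^-1 < N.+1%:R.
      apply: (@lt_trans _ _ N%:R); last by rewrite ltr_nat.
      by apply: le_lt_trans hN; rewrite lerDr ltW.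
    have h2 : t - y < N.+1%:R.
      apply: (@lt_trans _ _ N%:R); last by rewrite ltr_nat.
      by apply: le_lt_trans hN; rewrite lerDl invr_ge0 ltW.
    apply/andP; split; last by rewrite -lerBlDl ltW.
    by rewrite -lerBrDl -[leRHS]invrK lef_pV2 ?posrE ?invr_gt0// ltW.
  move=> [n _]/=; rewrite !in_itv/= andbT => /andP[h1 h2].
  by rewrite (lt_le_trans _ h1)// ltrDl.
- move=> t /=; rewrite in_itv/= andbT => yt; rewrite subr0.
  have t0 : 0 < t := lt_trans y0 yt.
  have := is_deriveN (is_derive1_powR (- c) t0).
  rewrite -[X in is_derive _ _ _ X]mulNr opprK.
  apply: (near_eq_is_derive); rewrite ?oner_neq0//; near=> z.
  have z0 : 0 < z by near: z; exact: lt_nbhsr.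
  by rewrite /= gtr0_norm ?invr_gt0// -powR_inv1 ?ltW// -powRrM mulN1r.
- move=> t /=; rewrite in_itv/= andbT => yt.
  rewrite (_ : (fun _ => _) = fun t => c * (t `^ (- c - 1))); last by apply/funext => z; rewrite subr0.
  by apply: cvgMr; apply: continuous_powc; exact: lt_trans yt.
- by move=> t _; rewrite mulr_ge0 ?powR_ge0// ltW.
- have cc := continuous_normpowR c0.
  have h1 : - `|(y + n.+1%:R)^-1| `^ c @[n --> \oo] --> - (`|0 : R| `^ c).
    apply: cvgN; apply: (@continuous_cvg _ _ _ _ _ _ (fun x : R => `|x| `^ c) 0 (cc 0)).
    apply: (@squeeze_cvgr _ _ _ _ (fun=> 0) a) => //; last exact: cvg_cst.
    near=> n; apply/andP; split; first by rewrite invr_ge0 addr_ge0// ltW.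
    by rewrite /a lef_pV2 ?posrE ?addr_gt0// lerDr ltW.
  have h2 : - `|(y + a n)^-1| `^ c @[n --> \oo] --> - (`|(y + 0)^-1| `^ c).
    apply: cvgN; apply: (@continuous_cvg _ _ _ _ _ _ (fun x : R => `|x| `^ c) _ (cc _)).
    apply: cvgV; first by rewrite addr0 gt_eqF.
    by apply: cvgD => //; exact: cvg_cst.
  suff -> : y `^ (- c) = - `|0 : R| `^ c - - `|(y + 0)^-1| `^ c by exact: cvgB h1 h2.
  rewrite normr0 powR0 ?gt_eqF// oppr0 sub0r opprK addr0.
  by rewrite gtr0_norm ?invr_gt0// -powR_inv1 ?ltW// -powRrM mulN1r.
Unshelve. all: by end_near. Qed.

End power_integrals.

(** * Weights and smooth functions *)

Section weights.
Context {R : realType}.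
Notation mu := (@lebesgue_measure R).

Lemma measurable_normc c : measurable_fun [set: R] (fun t : R => `|t| `^ c).
Proof. by apply: measurable_powc; exact: normr_measurable. Qed.

Lemma measurable_wt c : measurable_fun [set: R] (fun t : R => (1 + `|t|) `^ c).
Proof. by apply/measurable_powc/measurable_funD => //; exact: normr_measurable. Qed.

Lemma itg_normpow (c : R) : 0 < c < 1 ->
  itg (fun t : R => (`|t| <= 1)%R%:R * `|t| `^ (- c)).
Proof.
move=> /andP[c0 c1]; have c1' : 0 < 1 - c by rewrite subr_gt0.
(* The interval ends at [2] so that the endpoint [1] lies in its interior. *)
have [i1 _] := @int_pow_near R (1 - c) 0 2 c1' (ltr0Sn R 1).
have i2 := itg_refl 0 i1.
apply: itg_le (itgZ (1 - c)^-1 (itgD i1 i2)) _.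
  apply: measurable_funM; last exact: measurable_normc.
  by apply: measurable_natb; apply: measurable_fun_ler => //; exact: normr_measurable.
have E (b : bool) z : (1 - c)^-1 * (b%:R * ((1 - c) * z)) = b%:R * z.
  by rewrite mulrCA mulKf ?gt_eqF.
move=> t; rewrite !subr0 !sub0r (_ : 1 - c - 1 = - c); last by ring.
have pos (b : bool) z : 0 <= b%:R * z `^ (- c).
  by rewrite mulr_ge0 ?ler0n ?powR_ge0.
rewrite ger0_norm// mulrDr !E.
case: (boolP (`|t| <= 1)) => [t1|_]; last by rewrite mul0r addr_ge0.
rewrite mul1r.
have [t0|t0|->] := ltgtP t 0.
- rewrite (_ : (0 < - t < 2) = true); last first.
    by rewrite oppr_gt0 t0/=; move: t1; rewrite ltr0_norm//; lra.
  by rewrite mul1r ler_wpDl// ltr0_norm.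
- rewrite (_ : (true && (t < 2)) = true); last first.
    by move: t1; rewrite gtr0_norm//=; lra.
  by rewrite mul1r ler_wpDr// gtr0_norm.
- by rewrite normr0 powR0 ?oppr_eq0 ?gt_eqF// addr_ge0.
Qed.

Lemma itg_wt (a : R) : 1 < a -> itg (fun x : R => (1 + `|x|) `^ (- a)).
Proof.
move=> a1; have c0 : 0 < a - 1 by rewrite subr_gt0.
(* The base point [-1] produces [1 + t], and the threshold [-1/2] lets the open ray contain [0]. *)
have h : (-1 : R) < - (1/2) by lra.
have [i1 _] := @int_pow_far R (a - 1) (-1) (- (1/2)) c0 h.
have i2 := itg_refl 0 i1.
apply: itg_le (itgZ (a - 1)^-1 (itgD i1 i2)) _; first exact: measurable_wt.
move=> t; rewrite sub0r opprK (_ : - (a - 1) - 1 = - a); last by ring.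
have E (b : bool) z : (a - 1)^-1 * (b%:R * ((a - 1) * z)) = b%:R * z.
  by rewrite mulrCA mulKf ?gt_eqF.
have pos (b : bool) z : 0 <= b%:R * z `^ (- a).
  by rewrite mulr_ge0 ?ler0n ?powR_ge0.
rewrite ger0_norm ?powR_ge0// mulrDr !E.
have [t0|t0] := leP 0 t.
- rewrite (_ : (- (1/2) < t) = true); last by lra.
  rewrite (_ : true%:R * (t + 1) `^ (- a) = (1 + t) `^ (- a)); last by rewrite mul1r addrC.
  by rewrite ger0_norm// lerDl; exact: pos.
- rewrite (_ : (- (1/2) < - t) = true); last by lra.
  rewrite (_ : true%:R * (- t + 1) `^ (- a) = (1 - t) `^ (- a)); last by rewrite mul1r addrC.
  by rewrite ltr0_norm// lerDr; exact: pos.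
Qed.

Lemma wt_gt0 (a x : R) : 0 < (1 + `|x|) `^ a.
Proof. by apply: powR_gt0; rewrite ltr_pwDl. Qed.

Lemma wt_mul (a b x : R) : (1 + `|x|) `^ a * (1 + `|x|) `^ b = (1 + `|x|) `^ (a + b).
Proof.
rewrite powRD//; apply/implyP => _.
by rewrite gt_eqF// ltr_pwDl.
Qed.

Lemma wt_le (a b x : R) : a <= b -> (1 + `|x|) `^ a <= (1 + `|x|) `^ b.
Proof. by move=> ab; apply: ler_powR => //; rewrite lerDl. Qed.

Lemma powR_anti (a x y : R) : 0 <= a -> 0 < x -> x <= y -> y `^ (- a) <= x `^ (- a).
Proof.
move=> a0 x0 xy; have y0 := lt_le_trans x0 xy.
rewrite !powRN lef_pV2 ?posrE ?powR_gt0// ge0_ler_powR// nnegrE ltW//.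
Qed.

(* The maximum of 1+|y| and 1+|x-y| is at least (1+|x|)/2. *)
Lemma wt_conv (a x y : R) : 0 <= a ->
  (1 + `|y|) `^ (- a) * (1 + `|x - y|) `^ (- a) <=
  2 `^ a * (1 + `|x|) `^ (- a) * ((1 + `|y|) `^ (- a) + (1 + `|x - y|) `^ (- a)).
Proof.
move=> a0.
have tri : 1 + `|x| <= (1 + `|y|) + (1 + `|x - y|).
  have := ler_normD y (x - y); rewrite addrC subrK; lra.
have E : 2 `^ a * (1 + `|x|) `^ (- a) = ((1 + `|x|) / 2) `^ (- a).
  by rewrite [in RHS]powRM// ?invr_ge0// ?addr_ge0// mulrC; congr (_ * _); rewrite -powR_inv1// -powRrM mulrNN mul1r.
rewrite E.
have x2 : 0 < (1 + `|x|) / 2 by rewrite divr_gt0// ltr_pwDl.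
have w1 := ltW (wt_gt0 (- a) y); have w2 := ltW (wt_gt0 (- a) (x - y)).
have w0 : 0 <= ((1 + `|x|) / 2) `^ (- a) by exact: powR_ge0.
have [h|h] := leP ((1 + `|x|) / 2) (1 + `|y|).
  have h' := powR_anti a0 x2 h.
  apply: (@le_trans _ _ (((1 + `|x|) / 2) `^ (- a) * (1 + `|x - y|) `^ (- a))).
    by rewrite ler_wpM2r.
  by rewrite ler_wpM2l// lerDr.
have h1 : (1 + `|x|) / 2 <= 1 + `|x - y| by lra.
have h' := powR_anti a0 x2 h1.
apply: (@le_trans _ _ ((1 + `|y|) `^ (- a) * ((1 + `|x|) / 2) `^ (- a))).
  by rewrite ler_wpM2l.
by rewrite mulrC ler_wpM2l// lerDl.
Qed.

End weights.

(** * Rules of differentiation and smooth functions *)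

Section real_derivatives.
Context {R : realType}.
Implicit Types (f g : R -> R) (x a b : R).

Lemma isd_eq f x a b : is_derive x 1 f a -> a = b -> is_derive x 1 f b.
Proof. by move=> h <-. Qed.

Lemma isdD f g x a b : is_derive x 1 f a -> is_derive x 1 g b ->
  is_derive x 1 (fun y => f y + g y) (a + b).
Proof. by move=> df dg; exact: is_deriveD. Qed.

Lemma isdN f x a : is_derive x 1 f a -> is_derive x 1 (fun y => - f y) (- a).
Proof. by move=> df; exact: is_deriveN. Qed.

Lemma isdB f g x a b : is_derive x 1 f a -> is_derive x 1 g b ->
  is_derive x 1 (fun y => f y - g y) (a - b).
Proof. by move=> df dg; exact: is_deriveB. Qed.

Lemma isdM f g x a b : is_derive x 1 f a -> is_derive x 1 g b ->
  is_derive x 1 (fun y => f y * g y) (a * g x + f x * b).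
Proof.
move=> df dg; apply: (isd_eq (is_deriveM df dg)).
by rewrite /GRing.scale/= addrC (mulrC a).
Qed.

Lemma isd_id (x : R) : is_derive x 1 (fun y : R => y) 1.
Proof. exact: is_derive_id. Qed.

Lemma isd_cst (c x : R) : is_derive x 1 (fun _ : R => c) 0.
Proof. exact: is_derive_cst. Qed.

Lemma isdZ k f x a : is_derive x 1 f a -> is_derive x 1 (fun y => k * f y) (k * a).
Proof.
move=> df; apply: (isd_eq (isdM (isd_cst k x) df)).
by rewrite mul0r add0r.
Qed.

Lemma isd_comp f g x a b : is_derive (g x) 1 f a -> is_derive x 1 g b ->
  is_derive x 1 (fun y => f (g y)) (a * b).
Proof. by move=> df dg; exact: is_derive1_comp. Qed.

Lemma isdV f x a : f x != 0 -> is_derive x 1 f a ->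
  is_derive x 1 (fun y => (f y)^-1) (- a / f x ^+ 2).
Proof.
move=> f0 df; apply: (isd_eq (is_deriveV f0 df)).
by rewrite /GRing.scale/= mulNr mulrC mulNr.
Qed.

Lemma isd_near f g x a : (\forall y \near x, f y = g y) ->
  is_derive x 1 f a -> is_derive x 1 g a.
Proof. by move=> fg; exact: near_eq_is_derive. Qed.

Lemma isd_affine f (f' : R) (k a x : R) : is_derive (k * x + a) 1 f f' ->
  is_derive x 1 (fun y => f (k * y + a)) (k * f').
Proof.
move=> df; have da := isdD (isdZ k (isd_id x)) (isd_cst a x).
apply: (isd_eq (@isd_comp f (fun y => k * y + a) x _ _ df da)).
by rewrite addr0 mulr1 mulrC.
Qed.

End real_derivatives.

Section smooth.
Context {R : realType}.
Implicit Types f g : R -> R.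

(** Differentiability of order [n], by recursion on an existential derivative: closure under sums,
    products and affine substitutions then follows by induction on [n]. [smoothP] connects it with
    [derive1n]. *)
Fixpoint Cn (n : nat) (f : R -> R) : Prop :=
  if n is n'.+1 then exists2 f' : R -> R, (forall x : R, is_derive x 1 f (f' x)) & Cn n' f'
  else True.

Definition smooth f := forall n, Cn n f.

Lemma CnW n f : Cn n.+1 f -> Cn n f.
Proof.
elim: n f => //= n IH f [f' df Cf']; exists f' => //.
by apply: IH; case: Cf' => g dg Cg; exists g.
Qed.

Lemma is_deriveE f (f' : R -> R) : (forall x : R, is_derive x 1 f (f' x)) -> (derive1 f) = f'.
Proof. by move=> h; apply/funext => x; rewrite derive1E derive_val. Qed.

Lemma smoothP f : smooth f <-> forall n (x : R), derivable (derive1n n f) x 1.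
Proof.
split.
  move=> h n; have := h n.+1; elim: n f {h} => [|n IH] f.
    by move=> [f' df _] x; have [] := df x.
  move=> [f' df Cf'] x; rewrite derive1Sn (is_deriveE df).
  exact: IH.
move=> h n; elim: n f h => //= n IH f h.
exists ((derive1 f)).
  by move=> x; have := h 0%N x => dx; rewrite derive1E; exact/derivableP.
by apply: IH => k x; have := h k.+1 x; rewrite derive1Sn.
Qed.

Lemma smooth_is_derive f (x : R) : smooth f -> is_derive x 1 f ((derive1 f) x).
Proof. by move=> /(_ 1%N)[f' df _]; rewrite (is_deriveE df). Qed.

Lemma smooth_derive f : smooth f -> smooth ((derive1 f)).
Proof. by move=> h n; have [f' df C] := h n.+1; rewrite (is_deriveE df). Qed.

Lemma smoothI f (f' : R -> R) : (forall x : R, is_derive x 1 f (f' x)) -> smooth f' -> smooth f.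
Proof. by move=> df h [|n]//; exists f'. Qed.

Lemma CnD n f g : Cn n f -> Cn n g -> Cn n (fun x => f x + g x).
Proof.
elim: n f g => //= n IH f g [f' df Cf] [g' dg Cg].
exists (fun x => f' x + g' x); last exact: IH.
by move=> x; exact: is_deriveD.
Qed.

Lemma Cn_cst n (c : R) : Cn n (fun _ => c).
Proof.
elim: n c => //= n IH c; exists (fun _ => 0); last exact: IH.
by move=> x; exact: is_derive_cst.
Qed.

Lemma CnM n f g : Cn n f -> Cn n g -> Cn n (fun x => f x * g x).
Proof.
elim: n f g => //= n IH f g [f' df Cf] [g' dg Cg].
exists (fun x => f x * g' x + g x * f' x).
  move=> x; exact: is_deriveM.
apply: CnD; apply: IH => //.
- by apply: CnW; exists f'.
- by apply: CnW; exists g'.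
Qed.

Lemma Cn_affine n f (k a : R) : Cn n f -> Cn n (fun x => f (k * x + a)).
Proof.
elim: n f => //= n IH f [f' df Cf].
exists (fun x => k * f' (k * x + a)); last first.
  by apply: CnM; [exact: Cn_cst|exact: IH].
by move=> x; exact: isd_affine.
Qed.

Lemma smooth_continuous f : smooth f -> continuous f.
Proof. by move=> h x; exact: (derivable_continuousW (smooth_is_derive x h)). Qed.

Lemma smooth_measurable f : smooth f -> measurable_fun [set: R] f.
Proof. by move=> h; apply: continuous_measurable_fun; exact: smooth_continuous. Qed.

End smooth.

(** * A smooth bump function *)

Section bump.
Context {R : realType}.

(** Raise [t/n <= exp(t/n)] to the power [n]. *)
Lemma exprn_le_expR (n : nat) (t : R) : 0 <= t -> t ^+ n <= n%:R ^+ n * expR t.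
Proof.
move=> t0; case: n => [|n].
  by rewrite !expr0 mul1r -[leLHS]expR0 ler_expR.
have n0 : (0 : R) < n.+1%:R by rewrite ltr0n.
have h : t / n.+1%:R <= expR (t / n.+1%:R).
  by apply: le_trans (expR_ge1Dx _); rewrite lerDr.
have : (t / n.+1%:R) ^+ n.+1 <= expR (t / n.+1%:R) ^+ n.+1.
  by rewrite lerXn2r// nnegrE ?expR_ge0// divr_ge0// ltW.
rewrite -expRM_natr -mulrA mulVf ?gt_eqF// mulr1 expr_div_n ler_pdivrMr ?exprn_gt0//.
by rewrite mulrC.
Qed.

Lemma poly_le_expR (P : {poly R}) :
  exists2 C, 0 <= C & forall t, 0 <= t -> `|P.[t]| <= C * expR t.
Proof.
exists (\sum_(i < size P) `|P`_i| * i%:R ^+ i).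
  by apply: sumr_ge0 => i _; rewrite mulr_ge0// exprn_ge0.
move=> t t0; rewrite horner_coef (le_trans (ler_norm_sum _ _ _))// mulr_suml.
apply: ler_sum => i _; rewrite normrM -mulrA ler_wpM2l//.
by rewrite ger0_norm ?exprn_ge0// exprn_le_expR.
Qed.

(* [x |-> P(1/x) exp(-1/x)], extended by 0; this class is stable under derivation *)
Definition flat (P : {poly R}) (x : R) : R :=
  if 0 < x then P.[x^-1] * expR (- x^-1) else 0.

Lemma is_derive_quadratic0 (f : R -> R) (C : R) : (forall h, `|f h| <= C * h ^+ 2) ->
  is_derive (0 : R) 1 f 0.
Proof.
move=> hf; have f0 : f 0 = 0.
  by apply/normr0_eq0/le_anti; rewrite normr_ge0 andbT (le_trans (hf 0))// expr0n mulr0.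
have C0 : 0 <= C.
  by have := le_trans (normr_ge0 _) (hf 1); rewrite expr1n mulr1.
have H : h^-1 *: (f (h *: 1 + 0) - f 0) @[h --> (0 : R)^'] --> (0 : R).
  apply/cvgr0Pnorm_lt => e e0; near=> h.
  rewrite f0 subr0 addr0 [h *: _]mulr1 normrZ normfV.
  have h0 : 0 < `|h| by rewrite normr_gt0; near: h; exact: nbhs_dnbhs_neq.
  rewrite mulrC ltr_pdivrMr// (le_lt_trans (hf h))// -real_normK ?num_real// expr2 mulrA ltr_pM2r//.
  have hC : `|h| < e / (C + 1).
    by near: h; apply: dnbhs0_lt; rewrite divr_gt0// ltr_wpDl.
  have : `|h| * (C + 1) < e by rewrite -ltr_pdivlMr// ltr_wpDl.
  by apply: le_lt_trans; rewrite mulrC ler_wpM2l// lerDl.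
split; first by apply/cvg_ex; exists 0.
exact/cvg_lim.
Unshelve. all: by end_near. Qed.

Lemma flat_quadratic P : exists C, forall x, `|flat P x| <= C * x ^+ 2.
Proof.
(* The additional factor ['X^2], evaluated at [x^-1], supplies the [x^2] that makes [flat P]
   differentiable at [0] with derivative [0]. *)
have [C C0 hC] := poly_le_expR (P * 'X^2).
exists C => x; rewrite /flat; case: ifPn => [x0|_]; last first.
  by rewrite normr0 mulr_ge0// sqr_ge0.
have xV : 0 < x^-1 by rewrite invr_gt0.
have := hC _ (ltW xV); rewrite hornerM hornerXn normrM [X in _ * X]ger0_norm; last first.
  by rewrite exprn_ge0// ltW.
rewrite (_ : x^-1 ^+ 2 = (x ^+ 2)^-1); last by rewrite -exprVn.
rewrite ler_pdivrMr ?exprn_gt0// => h.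
rewrite normrM [X in _ * X]ger0_norm ?expR_ge0//.
by rewrite expRN ler_pdivrMr ?expR_gt0// mulrAC.
Qed.

Lemma flat_derive P (x : R) : is_derive x 1 (flat P) (flat ('X^2 * (P - P^`())) x).
Proof.
have [x0|x0|->] := ltgtP x 0.
- rewrite {2}/flat ltNge (ltW x0)/=.
  apply: (@near_eq_is_derive _ _ _ (fun _ => 0)); rewrite ?oner_neq0//.
  by near=> z; rewrite /flat ltNge ltW//; near: z; exact: lt_nbhsl.
- rewrite {2}/flat x0.
  have dV := isdV (f := id) (lt0r_neq0 x0) (isd_id x).
  have dP := isd_comp (is_derive_poly P x^-1) dV.
  have dE := @isd_comp R expR (fun y => - y^-1) x _ _ (is_derive_expR (- x^-1)) (isdN dV).
  apply: (@isd_near _ (fun y => P.[y^-1] * expR (- y^-1))).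
    by near=> z; rewrite /flat ifT//; near: z; exact: lt_nbhsr.
  apply: (isd_eq (isdM dP dE)).
  rewrite hornerM hornerXn hornerD hornerN /=.
  by field; rewrite gt_eqF.
- rewrite {2}/flat ltxx.
  by have [C hC] := flat_quadratic P; exact: is_derive_quadratic0 hC.
Unshelve. all: by end_near. Qed.

Lemma smooth_flat P : smooth (flat P).
Proof.
move=> n; elim: n P => //= n IH P.
by exists (flat ('X^2 * (P - P^`()))) => //; exact: flat_derive.
Qed.

Definition bump (x : R) : R := flat 1 x * flat 1 (1 - x).

Lemma smooth_bump : smooth bump.
Proof.
move=> n; apply: CnM; first exact: smooth_flat.
have := @Cn_affine _ n (flat 1) (-1) 1 (@smooth_flat 1 n).
by congr Cn; apply/funext => x; rewrite mulN1r addrC.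
Qed.

Lemma bump_ge0 x : 0 <= bump x.
Proof.
rewrite mulr_ge0// /flat; case: ifP => // _;
  by rewrite mulr_ge0 ?expR_ge0// hornerC.
Qed.

Lemma bump_gt0 x : 0 < x < 1 -> 0 < bump x.
Proof.
move=> /andP[x0 x1]; rewrite /bump /flat x0 subr_gt0 x1 !hornerC !mul1r.
by rewrite mulr_gt0// expR_gt0.
Qed.

Lemma bump_out x : ~~ (0 < x < 1) -> bump x = 0.
Proof.
rewrite /bump /flat subr_gt0; case: (0 < x) => /=; last by rewrite mul0r.
by move=> /negbTE ->; rewrite mulr0.
Qed.

End bump.

(** * Test functions and their second differences *)

Section test_functions.
Context {R : realType}.
Notation mu := (@lebesgue_measure R).
Implicit Types phi : R -> R.

Definition tst phi := smooth phi /\ exists L : R, forall x, L < `|x| -> phi x = 0.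

Lemma test_functionP phi : test_function phi <-> tst phi.
Proof.
rewrite /test_function /tst -smoothP; split => -[sphi h]; split => //.
  have [M [_ hM]] := compact_bounded h.
  exists (M + 1) => x xM; apply/eqP; apply: contraTT xM => phix.
  by rewrite -leNgt; apply: (hM (M + 1)); rewrite ?ltrDl//; exact: subset_closure.
have [L hL] := h.
have clo : closed (`[- L, L]%classic : set R) by exact: interval_closed.
apply: (@subclosed_compact _ _ `[- L, L]%classic); [exact: closed_closure|exact: segment_compact|].
rewrite [X in _ `<=` X](closure_id _).1//; apply: closure_subset => x /= phix.
rewrite in_itv/= -ler_norml leNgt; apply/negP => /hL x0.
by rewrite x0 eqxx in phix.
Qed.

Lemma tst_derive phi : tst phi -> tst (derive1 phi).
Proof.
move=> [s [L hL]]; split; first exact: smooth_derive.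
exists L => x xL.
have d := smooth_is_derive x s.
suff : is_derive x 1 phi 0 by move=> h; rewrite derive1E derive_val.
apply: (isd_near _ (isd_cst 0 x)).
have : \forall y \near x, L < `|y|.
  have cn : {for x, continuous (fun y : R => `|y|)} by exact: (@norm_continuous _ R).
  by have := cvgr_gt _ cn; apply.
by apply: filterS => y /hL.
Qed.

Lemma tst_affine phi (k a : R) : k != 0 -> tst phi -> tst (fun x => phi (k * x + a)).
Proof.
move=> k0 [s [L hL]]; split; first by move=> n; exact: Cn_affine.
exists ((L + `|a|) / `|k|) => x; rewrite ltr_pdivrMr ?normr_gt0// => h.
apply: hL; rewrite -(ltrD2r `|a|) (lt_le_trans h)// mulrC -normrM.
by rewrite -{1}[k * x](addrK a) (le_trans (ler_normB _ _)).
Qed.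

Lemma tst_shift phi a : tst phi -> tst (fun x => phi (x + a)).
Proof.
move=> /(tst_affine a (oner_neq0 R)).
by congr tst; apply/funext => x; rewrite mul1r.
Qed.

Lemma tst_refl phi a : tst phi -> tst (fun x => phi (a - x)).
Proof.
have n1 : (-1 : R) != 0 by rewrite oppr_eq0 oner_eq0.
move=> /(tst_affine a n1).
by congr tst; apply/funext => x; rewrite mulN1r addrC.
Qed.

Lemma tstD phi psi : tst phi -> tst psi -> tst (fun x => phi x + psi x).
Proof.
move=> [s [L hL]] [s' [L' hL']]; split; first by move=> n; exact: CnD.
exists (Num.max L L') => x; rewrite gt_max => /andP[h h'].
by rewrite hL// hL'// addr0.
Qed.

Lemma tstZ k phi : tst phi -> tst (fun x => k * phi x).
Proof.
move=> [s [L hL]]; split; first by move=> n; apply: CnM => //; exact: Cn_cst.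
by exists L => x h; rewrite hL// mulr0.
Qed.

Lemma tst_supp phi : tst phi -> exists2 L : R, 0 <= L & forall x, L < `|x| -> phi x = 0.
Proof.
move=> [_ [L hL]]; exists (Num.max 0 L); first by rewrite le_max lexx.
by move=> x; rewrite gt_max => /andP[_ /hL].
Qed.

Lemma tst_continuous phi : tst phi -> continuous phi.
Proof. by move=> [s _]; exact: smooth_continuous. Qed.

Lemma tst_measurable phi : tst phi -> measurable_fun [set: R] phi.
Proof. by move=> [s _]; exact: smooth_measurable. Qed.

Lemma tst_is_derive phi (x : R) : tst phi -> is_derive x 1 phi (derive1 phi x).
Proof. by move=> [s _]; exact: smooth_is_derive. Qed.

Lemma bounded_on_segment (f : R -> R) a b : a <= b -> {in `[a, b], continuous f} ->
  exists2 B, 0 <= B & forall x, a <= x <= b -> `|f x| <= B.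
Proof.
move=> ab cf.
have cf' : {within `[a, b], continuous (fun x => `|f x|)}.
  apply: continuous_in_subspaceT => x /set_mem /= xab.
  by apply: (@continuous_comp R R R f (fun y => `|y|)); [exact: cf|exact: (@norm_continuous _ R)].
have [c _ hc] := EVT_max ab cf'.
by exists `|f c| => // x xab; apply: hc; rewrite in_itv.
Qed.

Lemma tst_bound phi : tst phi -> exists2 B, 0 <= B & forall x, `|phi x| <= B.
Proof.
move=> tp; have [L L0 hL] := tst_supp tp.
have LL : - L <= L by lra.
have [B B0 hB] := bounded_on_segment LL (fun x _ => @tst_continuous _ tp x).
exists B => // x; have [xL|/hL->] := leP `|x| L; last by rewrite normr0.
by apply: hB; rewrite -ler_norml.
Qed.

Lemma compact_decay (f : R -> R) L B (a : R) : 0 <= a -> 0 <= L -> 0 <= B ->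
  (forall x, L < `|x| -> f x = 0) -> (forall x, `|f x| <= B) ->
  forall x, `|f x| <= B * (1 + L) `^ a * (1 + `|x|) `^ (- a).
Proof.
move=> a0 L0 B0 hL hB x.
have [xL|/hL->] := leP `|x| L; last by rewrite normr0 !mulr_ge0// powR_ge0.
apply: (le_trans (hB x)); rewrite -mulrA ler_peMr//.
rewrite powRN ler_pdivlMr ?wt_gt0// mul1r ge0_ler_powR// ?nnegrE ?addr_ge0//.
by rewrite lerD2l.
Qed.

Lemma tst_decay phi a : 0 <= a -> tst phi ->
  exists2 C, 0 <= C & forall x, `|phi x| <= C * (1 + `|x|) `^ (- a).
Proof.
move=> a0 tp; have [L L0 hL] := tst_supp tp; have [B B0 hB] := tst_bound tp.
exists (B * (1 + L) `^ a); first by rewrite mulr_ge0// powR_ge0.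
exact: compact_decay.
Qed.

Lemma itg_growth_decay (H f : R -> R) (A C r c : R) :
  measurable_fun [set: R] H -> measurable_fun [set: R] f -> 0 <= A -> 0 <= C ->
  (forall x, `|H x| <= A * (1 + `|x|) `^ r) ->
  (forall x, `|f x| <= C * (1 + `|x|) `^ c) -> r + c < -1 ->
  itg (fun x => H x * f x).
Proof.
move=> mH mf A0 C0 hH hf rc.
have a1 : 1 < - (r + c) by lra.
apply: (itg_le _ (itgZ (A * C) (itg_wt a1))); first exact: measurable_funM.
move=> x; rewrite opprK -wt_mul normrM mulrACA.
by apply: ler_pM.
Qed.

Lemma tst_itgM (H : R -> R) A r phi : measurable_fun [set: R] H -> 0 <= A ->
  (forall x, `|H x| <= A * (1 + `|x|) `^ r) -> tst phi ->
  itg (fun x => H x * phi x).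
Proof.
move=> mH A0 hH tp.
have [|C C0 hC] := @tst_decay phi (`|r| + 2) _ tp; first by rewrite addr_ge0.
apply: itg_growth_decay hH hC _ => //; first exact: tst_measurable.
by have := ler_norm r; lra.
Qed.

Lemma tst_itg phi : tst phi -> itg phi.
Proof.
move=> tp; apply: (@eq_itg _ (fun x => 1 * phi x)); first by move=> x; rewrite mul1r.
apply: (@tst_itgM (fun=> 1) 1 0) => // x.
by rewrite normr1 powRr0 mulr1.
Qed.

Lemma int_derivative0 (F f : R -> R) (L : R) :
  (forall x : R, is_derive x 1 F (f x)) -> continuous f ->
  (forall x, L < `|x| -> F x = 0 /\ f x = 0) -> \int[mu]_x f x = 0.
Proof.
move=> dF cf h; pose M := `|L| + 1.
have ML : L < M by have := ler_norm L; rewrite /M; lra.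
have M0 : 0 <= M by rewrite addr_ge0.
have -> : \int[mu]_x f x = \int[mu]_(x in `[- M, M]) f x.
  rewrite [RHS]Rintegral_mkcond; apply: eq_int => x; rewrite patchE.
  case: ifPn => // /negP xM; apply: (h x _).2; apply: (lt_le_trans ML).
  rewrite leNgt; apply/negP => xM'; apply: xM; apply/mem_set => /=.
  by rewrite in_itv/= -ler_norml ltW.
have MM : - M <= M by lra.
rewrite /Rintegral (ftc_segment MM)/=; last by move=> x _; exact: cf.
rewrite !(h _ _).1 ?subrr// ?normrN ger0_norm//.
Qed.

Lemma mvt_le (f f' : R -> R) (B a b : R) : a <= b ->
  (forall x : R, a <= x <= b -> is_derive x 1 f (f' x)) ->
  (forall x, a <= x <= b -> `|f' x| <= B) -> `|f b - f a| <= B * (b - a).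
Proof.
move=> ab df hB.
have [| |c cab ->] := @MVT_segment R f f' a b ab.
- by move=> x; rewrite in_itv/= => /andP[/ltW ax /ltW xb]; apply: df; rewrite ax.
- apply: continuous_in_subspaceT => x /set_mem /=; rewrite in_itv/= => xab.
  exact: (derivable_continuousW (df x xab)).
rewrite normrM [X in _ * X]ger0_norm ?subr_ge0// ler_wpM2r ?subr_ge0//.
by apply: hB; rewrite in_itv/= in cab.
Qed.

Lemma mvt_lip (f f' : R -> R) (B : R) : (forall x : R, is_derive x 1 f (f' x)) ->
  (forall x, `|f' x| <= B) -> forall x y, `|f y - f x| <= B * `|y - x|.
Proof.
move=> df hB x y; have [xy|/ltW yx] := leP x y.
  rewrite [X in B * X]ger0_norm ?subr_ge0//; exact: mvt_le.
rewrite distrC [X in B * X]distrC [X in B * X]ger0_norm ?subr_ge0//; exact: mvt_le.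
Qed.

Definition dd phi (x h : R) : R := 2 * phi x - phi (x + h) - phi (x - h).

Lemma dd_N phi x h : dd phi x (- h) = dd phi x h.
Proof. by rewrite /dd opprK; ring. Qed.

Lemma dd_refl phi a x h : dd (fun y => phi (a - y)) x h = dd phi (a - x) h.
Proof.
rewrite /dd (_ : a - (x + h) = a - x - h); last by ring.
by rewrite (_ : a - (x - h) = a - x + h); [ring|ring].
Qed.

Lemma tst_dd phi h : tst phi -> tst (fun x => dd phi x h).
Proof.
move=> tp.
have := tstD (tstD (tstZ 2 tp) (tstZ (-1) (tst_shift h tp))) (tstZ (-1) (tst_shift (- h) tp)).
by congr tst; apply/funext => x; rewrite /dd !mulN1r.
Qed.

Lemma dd_derive phi h (x : R) : tst phi ->
  is_derive x 1 (fun x => dd phi x h) (dd (derive1 phi) x h).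
Proof.
move=> tp.
have sh a : is_derive x 1 (fun x => phi (x + a)) (derive1 phi (x + a)).
  have := @isd_affine _ phi (derive1 phi (1 * x + a)) 1 a x (tst_is_derive _ tp).
  rewrite mul1r; move/isd_eq; rewrite mul1r => /(_ _ erefl).
  by congr is_derive; apply/funext => y; rewrite mul1r.
exact: isdB (isdB (isdZ 2 (tst_is_derive x tp)) (sh h)) (sh (- h)).
Qed.

Lemma dd_le phi B x h : tst phi -> (forall y, `|derive1 (derive1 phi) y| <= B) ->
  `|dd phi x h| <= 2 * B * h ^+ 2.
Proof.
move=> tp hB; have tp' := tst_derive tp.
have lip := mvt_lip (fun y => tst_is_derive y tp') hB.
wlog h0 : h / 0 <= h.
  move=> H; have [/H//|/ltW h0] := leP 0 h.
  by rewrite -dd_N -sqrrN; apply: H; rewrite oppr_ge0.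
(* Mean value theorem in the increment: the derivative in [t] is [phi'(x-t) - phi'(x+t)], of size at
   most [2 B t]. *)
pose g t := dd phi x t.
have dg (t : R) : is_derive t 1 g (derive1 phi (x - t) - derive1 phi (x + t)).
  have s1 : is_derive t 1 (fun t => phi (x + t)) (derive1 phi (x + t)).
    have := @isd_affine _ phi (derive1 phi (1 * t + x)) 1 x t (tst_is_derive _ tp).
    rewrite mul1r; move/isd_eq; rewrite mul1r addrC => /(_ _ erefl).
    by congr is_derive; apply/funext => y; rewrite mul1r addrC.
  have s2 : is_derive t 1 (fun t => phi (x - t)) (- derive1 phi (x - t)).
    have := @isd_affine _ phi (derive1 phi (-1 * t + x)) (-1) x t (tst_is_derive _ tp).
    rewrite !mulN1r addrC.
    by congr is_derive; apply/funext => y; rewrite mulN1r addrC.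
  apply: (isd_eq (isdB (isdB (isd_cst (2 * phi x) t) s1) s2)).
  by ring.
have := @mvt_le g _ (2 * B * h) 0 h h0 (fun t _ => dg t).
rewrite /g {2}/dd addr0 subr0 (_ : 2 * phi x - phi x - phi x = 0) ?subr0; last by ring.
rewrite expr2 [_ * (h * h)]mulrA; apply => t /andP[t0 th].
apply: le_trans (lip _ _) _; rewrite (_ : x - t - (x + t) = - (2 * t)); last by ring.
rewrite normrN ger0_norm ?mulr_ge0// mulrCA -mulrA ler_pM2l// ler_wpM2l//.
exact: le_trans (normr_ge0 _) (hB x).
Qed.

End test_functions.

(** * First-order expansions with quadratic remainder *)

Section quadratic.
Context {R : realType}.

Lemma isd_quadratic (f : R -> R) (x l C : R) :
  (forall h, `|f (x + h) - f x - h * l| <= C * h ^+ 2) -> is_derive x 1 f l.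
Proof.
move=> H; have d0 := is_derive_quadratic0 H.
have dg : is_derive x 1 (fun y => y - x) 1.
  by apply: (isd_eq (isdB (isd_id x) (isd_cst x x))); rewrite subr0.
have d0' : is_derive (x - x) 1 (fun h => f (x + h) - f x - h * l) 0 by rewrite subrr.
have d1 := @isd_comp _ _ (fun y => y - x) x _ _ d0' dg.
have d2 := isdD d1 (isdD (isd_cst (f x) x) (isdZ l dg)).
have := isd_eq d2 (_ : _ = l); rewrite mul0r !add0r mulr1 => /(_ erefl).
congr is_derive; apply/funext => y; rewrite addrC (addrC x) subrK.
by rewrite mulrC; ring.
Qed.

Lemma mvt_quadratic (f f' f'' : R -> R) (B : R) :
  (forall x : R, is_derive x 1 f (f' x)) -> (forall x : R, is_derive x 1 f' (f'' x)) ->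
  (forall x, `|f'' x| <= B) -> forall x h, `|f (x + h) - f x - h * f' x| <= B * h ^+ 2.
Proof.
move=> df df' hB x h.
have lip := mvt_lip df' hB.
pose g (y : R) := f y - (y - x) * f' x.
have dg (y : R) : is_derive y 1 g (f' y - f' x).
  apply: (isd_eq (isdB (df y) (isdM (isdB (isd_id y) (isd_cst x y)) (isd_cst (f' x) y)))).
  by ring.
have E : f (x + h) - f x - h * f' x = g (x + h) - g x by rewrite /g; ring.
have B0 : 0 <= B := le_trans (normr_ge0 _) (hB x).
rewrite E; have [h0|/ltW h0] := leP 0 h.
  have xh : x <= x + h by rewrite lerDl.
  have := @mvt_le _ g _ (B * h) x (x + h) xh (fun y _ => dg y).
  rewrite (_ : x + h - x = h); last by ring.
  rewrite expr2 [B * (h * h)]mulrA; apply => y /andP[xy yh].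
  apply: le_trans (lip _ _) _; rewrite ler_wpM2l// ger0_norm; lra.
have xh : x + h <= x by lra.
have := @mvt_le _ g _ (B * - h) (x + h) x xh (fun y _ => dg y).
rewrite distrC (_ : x - (x + h) = - h); last by ring.
rewrite (_ : B * h ^+ 2 = B * - h * - h); last by ring.
apply => y /andP[xy yh].
apply: le_trans (lip _ _) _; rewrite ler_wpM2l// ler0_norm; lra.
Qed.

End quadratic.

(** * The fractional Laplacian as an integral of second differences *)

Section operator.
Context {R : realType}.
Variable p : R.
Hypothesis hp : 0 < p < 1.
Notation mu := (@lebesgue_measure R).
Implicit Types phi : R -> R.

Let p0 : 0 < p. Proof. by case/andP: hp. Qed.

Let p1 : p < 1. Proof. by case/andP: hp. Qed.

Let q0 : 0 <= 2 + p. Proof. by rewrite addr_ge0// ltW. Qed.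

(* For [p = 2 s - 1] this is [(2 / C_s) (-Delta)^s phi (x)] (see [frac_lapE]);
   symmetrising in [h] makes the integral converge absolutely. *)
Definition fl phi (x : R) : R := \int[mu]_h (dd phi x h * `|h| `^ (- (2 + p))).

(** Integrable majorant in the increment [h]. Near [0] a second difference is of order [h^2], and
    [h^2 |h|^(-2-p) = |h|^(-p)] is integrable because [p < 1]; far away the kernel is below a
    multiple of [(1+|h|)^(-2)]. *)
Definition nearw (h : R) : R := (`|h| <= 1)%R%:R * `|h| `^ (- p) + (1 + `|h|) `^ (- 2).

Definition ind (L t : R) : R := (`|t| <= L)%R%:R.

Lemma measurable_ind L : measurable_fun [set: R] (ind L).
Proof. by apply: measurable_natb; apply: measurable_fun_ler => //; exact: normr_measurable. Qed.

Lemma ind_ge0 L t : 0 <= ind L t. Proof. exact: ler0n. Qed.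

Lemma itg_ind L : itg (ind L).
Proof.
have [L0|L0] := leP 0 L; last first.
  apply: (eq_itg _ itg0) => x; rewrite /ind leNgt (lt_le_trans L0)//.
have a0 : (0 : R) <= 2 by [].
have H := @compact_decay R (ind L) L 1 2 a0 L0 ler01.
have i2 : (1 : R) < 2 by lra.
apply: (itg_le (measurable_ind L) (itgZ (1 * (1 + L) `^ 2) (itg_wt i2))).
apply: H => x; rewrite /ind; last by case: (`|x| <= L); rewrite ?normr1 ?normr0.
by rewrite ltNge => /negbTE ->.
Qed.

Lemma itg_nearw : itg nearw.
Proof.
have i2 : (1 : R) < 2 by lra.
exact: itgD (itg_normpow hp) (itg_wt i2).
Qed.

Lemma nearw_ge0 h : 0 <= nearw h.
Proof. by rewrite addr_ge0 ?powR_ge0// mulr_ge0 ?powR_ge0// ler0n. Qed.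

Lemma nearw_in h : `|h| <= 1 -> `|h| `^ (- p) <= nearw h.
Proof. by rewrite /nearw => ->; rewrite mul1r lerDl powR_ge0. Qed.

Lemma nearw_out h : (1 + `|h|) `^ (- 2) <= nearw h.
Proof. by rewrite /nearw lerDr mulr_ge0 ?powR_ge0// ler0n. Qed.

Lemma measurable_dd phi : measurable_fun [set: R] phi ->
  measurable_fun [set: R * R] (fun z => dd phi z.1 z.2).
Proof.
move=> mphi; apply: measurable_funB; first apply: measurable_funB.
- by apply: measurable_funM => //; exact: (measurableT_comp mphi).
- by apply: (measurableT_comp mphi); exact: measurable_funD.
- by apply: (measurableT_comp mphi); exact: measurable_funB.
Qed.

Lemma measurable_ddx phi x : measurable_fun [set: R] phi ->
  measurable_fun [set: R] (fun h => dd phi x h).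
Proof.
move=> mphi; apply: measurable_funB; first apply: measurable_funB => //.
- by apply: (measurableT_comp mphi); exact: measurable_funD.
- by apply: (measurableT_comp mphi); exact: measurable_funB.
Qed.

Lemma normpow_le1 (h : R) : `|h| <= 1 -> h ^+ 2 * `|h| `^ (- (2 + p)) <= `|h| `^ (- p).
Proof.
move=> h1; have [->|h0] := eqVneq h 0; first by rewrite expr0n mul0r powR_ge0.
have nh0 : 0 < `|h| by rewrite normr_gt0.
rewrite -real_normK ?num_real// -powR_mulrn// -powRD; last by apply/implyP => _; rewrite gt_eqF.
by rewrite opprD addrA subrr add0r.
Qed.

Lemma normpow_ge1 (h : R) : 1 < `|h| -> `|h| `^ (- (2 + p)) <= 4 * (1 + `|h|) `^ (- 2).
Proof.
move=> h1; have nh0 : 0 < `|h| by lra.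
have e2 : - (2 + p) <= - 2 by have := p0; lra.
apply: (@le_trans _ _ (`|h| `^ (- 2))).
  by apply: ler_powR e2; exact: ltW.
rewrite !powRN !powR_mulrn//.
rewrite ler_pdivlMr; last by rewrite exprn_gt0//; lra.
rewrite mulrC ler_pdivrMr ?exprn_gt0//; nra.
Qed.

(** For bounded [x] the majorant [nearw] suffices. For large [x] one has [phi x = 0], and a shifted
    term survives only if [|h| >= |x| - L]; there the kernel itself is at most a multiple of
    [(1+|x|)^(-2-p)], while the indicators confine [h] to two sets of bounded measure. *)
Lemma dd_bound phi : tst phi -> exists C L : R, [/\ 0 <= C, 0 <= L & forall x h,
  `|dd phi x h * `|h| `^ (- (2 + p))| <=
  C * (1 + `|x|) `^ (- (2 + p)) * (nearw h + ind L (h + x) + ind L (x - h))].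
Proof.
move=> tp; have [L L0 hL] := tst_supp tp; have [B0 B00 hB0] := tst_bound tp.
have [B2 B20 hB2] := tst_bound (tst_derive (tst_derive tp)).
(* Chosen so that [|x| > M] implies [|x| - L >= (1 + |x|)/2]. *)
pose M := 2 * L + 2.
pose C1 := (2 * B2 + 16 * B0) * (1 + M) `^ (2 + p).
pose C2 := B0 * 2 `^ (2 + p).
have C10 : 0 <= C1 by rewrite mulr_ge0 ?powR_ge0// addr_ge0// mulr_ge0.
have C20 : 0 <= C2 by rewrite mulr_ge0 ?powR_ge0.
exists (C1 + C2), L; split => //; first exact: addr_ge0.
move=> x h.
have w0 : 0 <= (1 + `|x|) `^ (- (2 + p)) by exact: powR_ge0.
rewrite normrM [X in _ * X]ger0_norm ?powR_ge0//.
have [xM|xM] := leP `|x| M.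
  apply: (@le_trans _ _ (C1 * (1 + `|x|) `^ (- (2 + p)) * nearw h)); last first.
    apply: ler_pM; [exact: mulr_ge0|exact: nearw_ge0| |].
      by rewrite ler_wpM2r// lerDl.
    by rewrite -addrA lerDl addr_ge0 ?ind_ge0.
  apply: (@le_trans _ _ ((2 * B2 + 16 * B0) * nearw h)); last first.
    rewrite ler_wpM2r ?nearw_ge0// -mulrA ler_peMr ?addr_ge0 ?mulr_ge0//.
    rewrite powRN ler_pdivlMr ?wt_gt0// mul1r.
    have M0 : 0 <= M by rewrite /M; lra.
    apply: ge0_ler_powR; [exact: q0|by rewrite nnegrE addr_ge0|by rewrite nnegrE addr_ge0|by rewrite lerD2l].
  have [h1|h1] := leP `|h| 1.
    apply: (@le_trans _ _ (2 * B2 * (`|h| `^ (- p)))).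
      apply: (@le_trans _ _ (2 * B2 * h ^+ 2 * `|h| `^ (- (2 + p)))).
        by rewrite ler_wpM2r ?powR_ge0// dd_le.
      by rewrite -mulrA ler_wpM2l ?mulr_ge0// normpow_le1.
    apply: ler_pM; [exact: mulr_ge0|exact: powR_ge0|by rewrite lerDl mulr_ge0|].
    exact: nearw_in.
  apply: (@le_trans _ _ (16 * B0 * (1 + `|h|) `^ (- 2))); last first.
    apply: ler_pM; [exact: mulr_ge0|exact: powR_ge0|by rewrite lerDr mulr_ge0|].
    exact: nearw_out.
  apply: (@le_trans _ _ (4 * B0 * (4 * (1 + `|h|) `^ (- 2)))); last first.
    by rewrite mulrACA mulrA; apply: ler_wpM2r; [exact: powR_ge0|lra].
  apply: ler_pM; [exact: normr_ge0|exact: powR_ge0| |exact: normpow_ge1].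
  rewrite /dd.
  have := ler_normB (2 * phi x - phi (x + h)) (phi (x - h)).
  have := ler_normB (2 * phi x) (phi (x + h)).
  have := hB0 x; have := hB0 (x + h); have := hB0 (x - h).
  by rewrite normrM [`|2|]ger0_norm//; lra.
have Lx : L < `|x| by apply: le_lt_trans xM; rewrite /M; lra.
apply: (@le_trans _ _ (C2 * (1 + `|x|) `^ (- (2 + p)) * (ind L (h + x) + ind L (x - h)))); last first.
  apply: ler_pM; [exact: mulr_ge0|by rewrite addr_ge0 ?ind_ge0| |].
    by rewrite ler_wpM2r// lerDr.
  by rewrite -addrA lerDr nearw_ge0.
rewrite /dd (hL x Lx) mulr0 sub0r.
have far : `|x| - L <= `|h| -> `|h| `^ (- (2 + p)) <= 2 `^ (2 + p) * (1 + `|x|) `^ (- (2 + p)).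
  move=> xh.
  have E : 2 `^ (2 + p) * (1 + `|x|) `^ (- (2 + p)) = ((1 + `|x|) / 2) `^ (- (2 + p)).
    by rewrite [in RHS]powRM// ?invr_ge0// ?addr_ge0// mulrC; congr (_ * _); rewrite -powR_inv1// -powRrM mulrNN mul1r.
  have xh2 : (1 + `|x|) / 2 <= `|h| by rewrite /M in xM; lra.
  by rewrite E; apply: powR_anti => //; rewrite divr_gt0// ltr_pwDl.
have i1 : `|phi (x + h)| <= B0 * ind L (h + x).
  rewrite /ind addrC; have [h1|h1] := leP `|h + x| L; first by rewrite mulr1.
  by rewrite hL ?normr0 ?mulr0.
have i2 : `|phi (x - h)| <= B0 * ind L (x - h).
  rewrite /ind; have [h1|h1] := leP `|x - h| L; first by rewrite mulr1.
  by rewrite hL ?normr0 ?mulr0.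
have [hx|hx] := leP (`|x| - L) `|h|.
  apply: (@le_trans _ _ ((B0 * ind L (h + x) + B0 * ind L (x - h)) * (2 `^ (2 + p) * (1 + `|x|) `^ (- (2 + p))))).
    apply: ler_pM; [exact: normr_ge0|exact: powR_ge0| |exact: far].
    apply: le_trans (ler_normB _ _) _; rewrite normrN; exact: lerD.
  by rewrite -mulrDr /C2 le_eqVlt; apply/orP; left; apply/eqP; ring.
rewrite !hL ?subr0 ?oppr0 ?normr0 ?mul0r.
- by rewrite !mulr_ge0 ?addr_ge0 ?ind_ge0.
- have := ler_normD (x - h) h; rewrite subrK; lra.
- have := ler_normB (x + h) h; rewrite addrK; lra.
Qed.

(** The point is that the value does not depend on [x]: the indicators are a translate and a
    reflection of [ind L]. *)
Lemma fl_majorant x L C : itg (fun h => C * (nearw h + ind L (h + x) + ind L (x - h))) /\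
  \int[mu]_h (C * (nearw h + ind L (h + x) + ind L (x - h))) =
  C * (\int[mu]_h nearw h + \int[mu]_h ind L h + \int[mu]_h ind L h).
Proof.
have i1 := itg_shift x (itg_ind L); have i2 := itg_refl x (itg_ind L).
have i12 := itgD itg_nearw i1.
split; first exact: itgZ (itgD i12 i2).
rewrite intZ; last exact: itgD.
by rewrite intD// intD ?int_shift ?int_refl//; [exact: itg_ind|exact: itg_ind|exact: itg_nearw].
Qed.

Lemma fl_itg phi x : tst phi -> itg (fun h => dd phi x h * `|h| `^ (- (2 + p))).
Proof.
move=> tp; have [C [L [C0 L0 H]]] := dd_bound tp.
have [i1 _] := fl_majorant x L (C * (1 + `|x|) `^ (- (2 + p))).
apply: itg_le i1 (H x); apply: measurable_funM; last exact: measurable_normc.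
by apply: measurable_ddx; exact: tst_measurable.
Qed.

Lemma fl_abs phi : tst phi -> exists2 C, 0 <= C & forall x,
  \int[mu]_h `|dd phi x h * `|h| `^ (- (2 + p))| <= C * (1 + `|x|) `^ (- (2 + p)).
Proof.
move=> tp; have [C [L [C0 L0 H]]] := dd_bound tp.
exists (C * (\int[mu]_h nearw h + \int[mu]_h ind L h + \int[mu]_h ind L h)).
  rewrite mulr_ge0// !addr_ge0//; apply: int_ge0 => x; rewrite ?nearw_ge0 ?ind_ge0//.
move=> x; have [i1 e1] := fl_majorant x L (C * (1 + `|x|) `^ (- (2 + p))).
rewrite mulrAC -e1; apply: int_le => //; exact/itg_norm/fl_itg.
Qed.

(** For [p = 2 s - 1] the exponent [2 + p] is [1 + 2 s], so [fl phi] can be integrated against every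
    element of [L_s]. *)
Lemma fl_decay phi : tst phi -> exists2 C, 0 <= C & forall x,
  `|fl phi x| <= C * (1 + `|x|) `^ (- (2 + p)).
Proof.
move=> tp; have [C C0 H] := fl_abs tp; exists C => // x.
by apply: le_trans (H x); apply: int_norm; exact: fl_itg.
Qed.

Lemma fl_itg2 (H : R -> R) A phi : measurable_fun [set: R] H -> 0 <= A ->
  (forall x, `|H x| <= A * (1 + `|x|) `^ p) -> tst phi ->
  itg2 (fun x h => H x * (dd phi x h * `|h| `^ (- (2 + p)))).
Proof.
move=> mH A0 hH tp; have [C C0 hC] := fl_abs tp.
have i2 : (1 : R) < 2 by lra.
apply: (itg2I (g := fun x => A * C * (1 + `|x|) `^ (- 2))).
- apply: measurable_funM; first exact: (measurableT_comp mH).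
  apply: measurable_funM; first by apply: measurable_dd; exact: tst_measurable.
  exact: (measurableT_comp (measurable_normc _)).
- by move=> x; exact/itgZ/fl_itg.
- exact/itgZ/itg_wt.
- move=> x; under eq_Rintegral do rewrite normrM.
  rewrite intZ; last exact/itg_norm/fl_itg.
  rewrite (_ : - 2 = p - (2 + p)); last by ring.
  rewrite -wt_mul mulrACA; apply: ler_pM => //.
  by apply: int_ge0.
Qed.

Lemma fl_measurable phi : tst phi -> measurable_fun [set: R] (fl phi).
Proof.
move=> tp; have h1 x : `|1 : R| <= 1 * (1 + `|x : R|) `^ p.
  by rewrite normr1 mul1r -[X in X <= _](powRr0 (1 + `|x|)); apply: wt_le; exact: ltW.
have := itg2_left (fl_itg2 (H := fun=> 1) _ ler01 h1 tp).
move=> /(_ (measurable_cst _))/itg_meas.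
by congr measurable_fun; apply/funext => x; rewrite /fl; apply: eq_int => h; rewrite mul1r.
Qed.

Lemma fl_itgM (H : R -> R) A phi : measurable_fun [set: R] H -> 0 <= A ->
  (forall x, `|H x| <= A * (1 + `|x|) `^ p) -> tst phi ->
  itg (fun x => H x * fl phi x).
Proof.
move=> mH A0 hH tp; have [C C0 hC] := fl_decay tp.
by apply: itg_growth_decay hH hC _ => //; [exact: fl_measurable|lra].
Qed.

Lemma fl_fubini (H : R -> R) A phi : measurable_fun [set: R] H -> 0 <= A ->
  (forall x, `|H x| <= A * (1 + `|x|) `^ p) -> tst phi ->
  \int[mu]_x (H x * fl phi x) =
  \int[mu]_h ((\int[mu]_x (H x * dd phi x h)) * `|h| `^ (- (2 + p))).
Proof.
move=> mH A0 hH tp.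
transitivity (\int[mu]_x \int[mu]_h (H x * (dd phi x h * `|h| `^ (- (2 + p))))).
  by apply: eq_int => x; rewrite intZ//; exact: fl_itg.
rewrite (real_fubini (fl_itg2 mH A0 hH tp)); apply: eq_int => h.
rewrite mulrC -intZ; last exact: tst_itgM hH (tst_dd h tp).
by apply: eq_int => x; ring.
Qed.

Lemma fl_refl phi a x : fl (fun y => phi (a - y)) x = fl phi (a - x).
Proof. by apply: eq_int => h; rewrite dd_refl. Qed.

(** After [fl_fubini] the integration by parts takes place at fixed [h], where the second difference
    of [phi] has compact support: there are no boundary terms although [H] grows. *)
Lemma fl_ibp (H H' : R -> R) A phi : (forall x : R, is_derive x 1 H (H' x)) ->
  continuous H' -> 0 <= A ->
  (forall x, `|H x| <= A * (1 + `|x|) `^ p) ->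
  (forall x, `|H' x| <= A * (1 + `|x|) `^ p) -> tst phi ->
  \int[mu]_x (H x * fl (derive1 phi) x) = - \int[mu]_x (H' x * fl phi x).
Proof.
move=> dH cH' A0 hH hH' tp.
have cH : continuous H by move=> x; exact: (derivable_continuousW (dH x)).
have mH := continuous_measurable_fun cH; have mH' := continuous_measurable_fun cH'.
rewrite (fl_fubini mH A0 hH (tst_derive tp)) (fl_fubini mH' A0 hH' tp).
rewrite -intN; last first.
  apply: eq_itg (itg2_right (fl_itg2 mH' A0 hH' tp)) => h.
  rewrite mulrC -intZ; last exact: tst_itgM hH' (tst_dd h tp).
  by apply: eq_int => x; ring.
apply: eq_int => h; rewrite -mulNr; congr (_ * _).
have td := tst_dd h tp.
have [L L0 hL] := tst_supp td; have [L' L'0 hL'] := tst_supp (tst_dd h (tst_derive tp)).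
have i1 := tst_itgM mH A0 hH (tst_dd h (tst_derive tp)).
have i2 := tst_itgM mH' A0 hH' td.
apply/eqP; rewrite -subr_eq0 opprK -intD//; apply/eqP.
apply: (@int_derivative0 _ (fun x => H x * dd phi x h) _ (Num.max L L')).
- move=> x; apply: (isd_eq (isdM (dH x) (dd_derive h x tp))).
  by rewrite addrC.
- move=> x; apply: cvgD; apply: cvgM; [exact: cH| |exact: cH'|exact: (tst_continuous td)].
  exact: (tst_continuous (tst_dd h (tst_derive tp))).
- by move=> x; rewrite gt_max => /andP[/hL -> /hL' ->]; rewrite !mulr0 addr0.
Qed.

(** At fixed [h] a second difference integrates to zero by translation invariance. *)
Lemma fl_int0 phi : tst phi -> \int[mu]_x fl phi x = 0.
Proof.
move=> tp; have h1 x : `|1 : R| <= 1 * (1 + `|x : R|) `^ p.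
  by rewrite normr1 mul1r -[X in X <= _](powRr0 (1 + `|x|)); apply: wt_le; exact: ltW.
transitivity (\int[mu]_x (1 * fl phi x)); first by apply: eq_int => x; rewrite mul1r.
rewrite (fl_fubini (measurable_cst _) ler01 h1 tp).
rewrite -[RHS]int0; apply: eq_int => h.
have ip := tst_itg tp; have is1 := itg_shift h ip; have is2 := itg_shift (- h) ip.
rewrite (_ : \int[mu]_x (1 * dd phi x h) = 0) ?mul0r//.
transitivity (\int[mu]_x (2 * phi x - phi (x + h) - phi (x - h))).
  by apply: eq_int => x; rewrite mul1r.
rewrite intB; [|exact: itgB (itgZ 2 ip) is1|exact: is2].
rewrite intB; [|exact: itgZ|exact: is1].
rewrite intZ// (int_shift h ip) (int_shift (- h) ip); ring.
Qed.

End operator.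

(** * Convolution of a bounded, compactly supported function with a test function *)

Section convolution.
Context {R : realType}.
Variable p : R.
Hypothesis hp : 0 < p < 1.
Notation mu := (@lebesgue_measure R).
Variables (G : R -> R) (L B : R).
Hypotheses (mG : measurable_fun [set: R] G) (L0 : 0 <= L) (B0 : 0 <= B)
  (hL : forall x, L < `|x| -> G x = 0) (hB : forall x, `|G x| <= B).

Let growth a : 0 <= a -> exists2 A, 0 <= A & forall x, `|G x| <= A * (1 + `|x|) `^ (- a).
Proof.
move=> a0; exists (B * (1 + L) `^ a); first by rewrite mulr_ge0 ?powR_ge0.
exact: compact_decay.
Qed.

Lemma conv_itg chi x : tst chi -> itg (fun y => G y * chi (x - y)).
Proof.
move=> tc; have [A A0 hA] := growth (lexx 0).
exact: tst_itgM hA (tst_refl x tc).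
Qed.

Let itgG : itg G.
Proof.
have [A A0 hA] := growth (ler0n R 2).
have i2 : (1 : R) < 2 by lra.
exact: itg_le mG (itgZ A (itg_wt i2)) hA.
Qed.

Definition convol (chi : R -> R) (x : R) := \int[mu]_y (G y * chi (x - y)).

(** The Taylor remainder of [chi] is at most [B2 * h^2] uniformly in the point, and this bound
    survives integration against [|G|]. *)
Lemma conv_derive chi (x : R) : tst chi -> is_derive x 1 (convol chi) (convol (derive1 chi) x).
Proof.
move=> tc; have tc' := tst_derive tc.
have [B2 B20 hB2] := tst_bound (tst_derive tc').
have := mvt_quadratic (fun x => tst_is_derive x tc) (fun x => tst_is_derive x tc') hB2 => H.
apply: (@isd_quadratic _ _ _ _ (B2 * \int[mu]_y `|G y|)) => h.
rewrite /convol -intZ; last exact: conv_itg.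
rewrite -intB; [|exact: conv_itg|exact: conv_itg].
rewrite -intB; last 2 first.
- by apply: itgB; exact: conv_itg.
- by apply: itgZ; exact: conv_itg.
rewrite mulrAC -intZ; last exact: itg_norm.
apply: int_norm_le.
- apply: itgB; first by apply: itgB; exact: conv_itg.
  by apply: itgZ; exact: conv_itg.
- exact/itgZ/itg_norm.
move=> y.
rewrite (_ : _ - _ = G y * (chi (x - y + h) - chi (x - y) - h * derive1 chi (x - y))); last first.
  rewrite (_ : x + h - y = x - y + h); ring.
by rewrite normrM mulrC ler_wpM2r.
Qed.

Lemma conv_tst chi : tst chi -> tst (convol chi).
Proof.
move=> tc; split.
  move=> n; elim: n chi tc => //= n IH chi tc.
  exists (convol (derive1 chi)); last exact/IH/tst_derive.
  by move=> x; exact: conv_derive.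
have [M M0 hM] := tst_supp tc.
exists (L + M) => x xLM; rewrite /convol -[RHS]int0; apply: eq_int => y.
have [yL|/hL->] := leP `|y| L; last by rewrite mul0r.
rewrite hM ?mulr0//; have := ler_normD (x - y) y; rewrite subrK; lra.
Qed.

Lemma conv_fl chi x : tst chi -> fl p (convol chi) x = \int[mu]_y (G y * fl p chi (x - y)).
Proof.
move=> tc; have [A A0 hA] := growth (lexx 0).
have hA' y : `|G y| <= A * (1 + `|y|) `^ p.
  apply: le_trans (hA y) _; rewrite ler_wpM2l//; apply: wt_le.
  by rewrite oppr0; case/andP: hp => /ltW.
transitivity (\int[mu]_y (G y * fl p (fun y => chi (x - y)) y)); last first.
  by apply: eq_int => y; rewrite fl_refl.
rewrite (fl_fubini hp mG A0 hA' (tst_refl x tc)).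
apply: eq_int => h; congr (_ * _); rewrite /dd/convol.
have i0 := conv_itg x tc; have i1 := conv_itg (x + h) tc; have i2 := conv_itg (x - h) tc.
rewrite -intZ// -intB//; last exact: itgZ.
rewrite -intB//; last by apply: itgB => //; exact: itgZ.
apply: eq_int => y.
rewrite (_ : x - (y + h) = x - h - y); last by ring.
by rewrite (_ : x - (y - h) = x + h - y); ring.
Qed.

End convolution.

(** * The fundamental solution *)

Section fundamental.
Context {R : realType}.
Variable p : R.
Hypothesis hp : 0 < p < 1.
Notation mu := (@lebesgue_measure R).
Notation flp := (@fl R p).

Let p0 : 0 < p. Proof. by case/andP: hp. Qed.

Let p1 : p < 1. Proof. by case/andP: hp. Qed.

Lemma fl_shift phi a x : flp (fun y => phi (y + a)) x = flp phi (x + a).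
Proof.
apply: eq_int => h; rewrite /dd (_ : x + h + a = x + a + h); last by ring.
by rewrite (_ : x - h + a = x + a - h); last by ring.
Qed.

Lemma mvt_noninc (f f' : R -> R) (a b : R) : a <= b ->
  (forall x : R, a <= x <= b -> is_derive x 1 f (f' x)) ->
  (forall x, a <= x <= b -> f' x <= 0) -> f b <= f a.
Proof.
move=> ab df hB.
have [| |c cab e] := @MVT_segment R f f' a b ab.
- by move=> x; rewrite in_itv/= => /andP[/ltW ax /ltW xb]; apply: df; rewrite ax.
- apply: continuous_in_subspaceT => x /set_mem /=; rewrite in_itv/= => xab.
  exact: (derivable_continuousW (df x xab)).
rewrite -subr_le0 e mulr_le0_ge0 ?subr_ge0//.
by apply: hB; rewrite in_itv/= in cab.
Qed.

Lemma isd_normpow (c x : R) : 0 < x -> is_derive x 1 (fun t => `|t| `^ c) (c * x `^ (c - 1)).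
Proof.
move=> x0; apply: (isd_near _ (is_derive1_powR c x0)).
near=> z; rewrite gtr0_norm//; near: z; exact: lt_nbhsr.
Unshelve. all: by end_near. Qed.

(* An antiderivative of [(p + 1) |x|^p]. By homogeneity its image under [fl] is constant on
   each half-line, which makes [|x|^p] a fundamental solution up to the factor [kap]. *)
Definition oddpow (x : R) : R := x * `|x| `^ p.

Lemma oddpowN x : oddpow (- x) = - oddpow x.
Proof. by rewrite /oddpow normrN mulNr. Qed.

Lemma oddpow_derive (x : R) : is_derive x 1 oddpow ((p + 1) * `|x| `^ p).
Proof.
have pos (y : R) : 0 < y -> is_derive y 1 oddpow ((p + 1) * `|y| `^ p).
  move=> y0; apply: (isd_eq (isdM (isd_id y) (isd_normpow p y0))).
  by rewrite mulrCA mulr_powRB1 ?ltW// gtr0_norm//; ring.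
have [x0|x0|->] := ltgtP x 0.
- have nx0 : 0 < - x by rewrite oppr_gt0.
  have := isdN (@isd_affine _ oddpow _ (-1) 0 x (_ : is_derive (-1 * x + 0) 1 _ _)).
  rewrite addr0 mulN1r => /(_ _ (pos _ nx0)).
  rewrite normrN mulN1r opprK; congr is_derive; apply/funext => y.
  by rewrite addr0 mulN1r oddpowN opprK.
- exact: pos.
rewrite normr0 powR0 ?gt_eqF// mulr0.
have H : h^-1 *: (oddpow (h *: 1 + 0) - oddpow 0) @[h --> (0 : R)^'] --> (0 : R).
  have c0 : `|h| `^ p @[h --> (0 : R)^'] --> (0 : R).
    apply: cvg_within_filter.
    have := @continuous_normpowR R p p0 0%R.
    by rewrite /continuous_at normr0 powR0 ?gt_eqF.
  apply: cvg_trans c0; apply: near_eq_cvg; near=> h.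
  have h0 : h != 0 by near: h; exact: nbhs_dnbhs_neq.
  rewrite addr0 [h *: 1]mulr1 /oddpow mul0r subr0 /GRing.scale/= mulrA mulVf// mul1r//.
split; first by apply/cvg_ex; exists 0.
exact/cvg_lim.
Unshelve. all: by end_near. Qed.

Definition ddo (h : R) : R := dd oddpow 1 h.

Lemma ddo_derive (t : R) : is_derive t 1 ddo ((p + 1) * (`|1 - t| `^ p - `|1 + t| `^ p)).
Proof.
have s1 : is_derive t 1 (fun t => oddpow (1 + t)) ((p + 1) * `|1 + t| `^ p).
  have := @isd_affine _ oddpow _ 1 1 t (oddpow_derive _).
  rewrite !mul1r (addrC t).
  by congr is_derive; apply/funext => y; rewrite mul1r addrC.
have s2 : is_derive t 1 (fun t => oddpow (1 - t)) (- ((p + 1) * `|1 - t| `^ p)).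
  have := @isd_affine _ oddpow _ (-1) 1 t (oddpow_derive _).
  rewrite !mulN1r (addrC (- t)).
  by congr is_derive; apply/funext => y; rewrite mulN1r addrC.
apply: (isd_eq (isdB (isdB (isd_cst (2 * oddpow 1) t) s1) s2)).
by ring.
Qed.

Lemma ddo0 : ddo 0 = 0.
Proof. by rewrite /ddo /dd addr0 subr0; ring. Qed.

Lemma ddo_noninc a b : 0 <= a -> a <= b -> ddo b <= ddo a.
Proof.
move=> a0 ab; apply: (mvt_noninc ab (fun x _ => ddo_derive x)) => t /andP[ta _].
rewrite mulr_ge0_le0 ?addr_ge0// ?(ltW p0)// subr_le0 ge0_ler_powR ?nnegrE// ?(ltW p0)//.
rewrite [leRHS]ger0_norm; last by lra.
by rewrite ler_norml; lra.
Qed.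

Lemma ddo_le0 h : ddo h <= 0.
Proof.
have pos t : 0 <= t -> ddo t <= 0 by move=> t0; rewrite -ddo0; exact: ddo_noninc.
have [/pos//|/ltW h0] := leP 0 h.
by rewrite /ddo -dd_N; apply: pos; rewrite oppr_ge0.
Qed.

(** For [h <= 1/2] the points [1 - h] and [1 + h] stay away from the singular point [0], and [ddo]
    is quadratic in [h]. For larger [h] the growth [|h|^(p+1)] of [oddpow] would leave [|h|^(-1)],
    which is not integrable; by oddness the shifted terms combine to
    [oddpow (h + 1) - oddpow (h - 1)], which is only of order [|h|^p]. *)
Lemma ddo_bound : exists2 C, 0 <= C & forall h, `|ddo h * `|h| `^ (- (2 + p))| <= C * nearw p h.
Proof.
pose C1 := (p + 1) * (2 * (p * (1/2) `^ (p - 1))).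
have C10 : 0 <= C1.
  by rewrite mulr_ge0 ?addr_ge0 ?(ltW p0)// !mulr_ge0 ?powR_ge0 ?(ltW p0).
have near0 h : 0 <= h <= 1/2 -> `|ddo h| <= C1 * h ^+ 2.
  move=> /andP[h0 h1].
  have := @mvt_le _ ddo _ (C1 * h) 0 h h0 (fun x _ => ddo_derive x).
  rewrite ddo0 !subr0 expr2 [_ * (h * h)]mulrA; apply => t /andP[t0 th].
  rewrite normrM [`|p + 1|]ger0_norm ?addr_ge0 ?(ltW p0)// /C1 -mulrA ler_wpM2l ?addr_ge0 ?(ltW p0)//.
  rewrite distrC.
  have tt : 1 - t <= 1 + t by lra.
  have := @mvt_le _ (fun t => `|t| `^ p) (fun t => p * t `^ (p - 1)) (p * (1/2) `^ (p - 1)) _ _ tt.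
  rewrite (_ : 1 + t - (1 - t) = 2 * t); last by ring.
  move=> H; apply: (le_trans (H _ _)).
  - by move=> x /andP[x1 x2]; apply: isd_normpow; lra.
  - move=> x /andP[x1 x2]; rewrite ger0_norm ?mulr_ge0 ?powR_ge0 ?(ltW p0)//.
    rewrite ler_wpM2l ?(ltW p0)//.
    by rewrite -[p - 1]opprB; apply: powR_anti; have := p1; lra.
  rewrite (_ : _ * (2 * t) = 2 * (p * (1/2) `^ (p - 1)) * t); last by ring.
  by rewrite ler_wpM2l// !mulr_ge0 ?powR_ge0 ?(ltW p0).
have far0 h : 0 <= h -> `|ddo h| <= 6 * (1 + `|h|) `^ p.
  move=> h0; rewrite /ddo/dd (_ : 1 - h = - (h - 1)); last by ring.
  rewrite oddpowN opprK.
  have e1 : oddpow 1 = 1 by rewrite /oddpow normr1 powR1 mul1r.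
  have hh : h - 1 <= h + 1 by lra.
  have := @mvt_le _ oddpow _ (2 * (1 + `|h|) `^ p) _ _ hh (fun x _ => oddpow_derive x).
  rewrite (_ : h + 1 - (h - 1) = 2); last by ring.
  rewrite e1 (addrC 1 h) => H.
  have w1 : 1 <= (1 + `|h|) `^ p.
    by rewrite -[leLHS](powRr0 (1 + `|h|)); apply: wt_le; exact: ltW.
  have {}H : `|oddpow (h + 1) - oddpow (h - 1)| <= 2 * (1 + `|h|) `^ p * 2.
    apply: H => x /andP[x1 x2].
    rewrite normrM [`|p + 1|]ger0_norm ?addr_ge0 ?(ltW p0)// ger0_norm ?powR_ge0//.
    apply: ler_pM; rewrite ?addr_ge0 ?powR_ge0 ?(ltW p0)//; first by have := p1; lra.
    rewrite ge0_ler_powR ?nnegrE ?addr_ge0// ?(ltW p0)//.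
    by rewrite (ger0_norm h0) ler_norml; lra.
  rewrite (_ : _ + _ = 2 - (oddpow (h + 1) - oddpow (h - 1))); last by ring.
  by apply: le_trans (ler_normB _ _) _; rewrite [`|2|]ger0_norm//; lra.
(* The [6] is that of [far0]; the powers make up [4^(2 + p)], from [(1 + |h|)/4 <= |h|] when
   [h > 1/2]. *)
pose C2 := 6 * 2 `^ (2 + p) * 2 `^ (2 + p).
exists (C1 + C2); first by rewrite addr_ge0// !mulr_ge0 ?powR_ge0.
have C20 : 0 <= C2 by rewrite !mulr_ge0 ?powR_ge0.
move=> h; wlog h0 : h / 0 <= h.
  move=> H; have [/H//|/ltW h0] := leP 0 h.
  have := H (- h); rewrite oppr_ge0 => /(_ h0).
  by rewrite /ddo dd_N normrN /nearw normrN.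
rewrite normrM [X in _ * X]ger0_norm ?powR_ge0//.
have [h1|h1] := leP h (1/2).
  apply: (@le_trans _ _ (C1 * (h ^+ 2 * `|h| `^ (- (2 + p))))).
    by rewrite mulrA ler_wpM2r ?powR_ge0// near0// h0.
  have nh : `|h| <= 1 by rewrite ger0_norm//; lra.
  apply: ler_pM => //; first by rewrite mulr_ge0 ?sqr_ge0 ?powR_ge0.
    by rewrite lerDl.
  by apply: le_trans (normpow_le1 _ nh) _; exact: nearw_in.
have H2 : `|h| `^ (- (2 + p)) <= 2 `^ (2 + p) * 2 `^ (2 + p) * (1 + `|h|) `^ (- (2 + p)).
  have E : 2 `^ (2 + p) * 2 `^ (2 + p) * (1 + `|h|) `^ (- (2 + p)) = ((1 + `|h|) / 4) `^ (- (2 + p)).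
    rewrite [in RHS]powRM// ?invr_ge0// ?addr_ge0// mulrC; congr (_ * _).
    by rewrite -powR_inv1// -powRrM mulrNN mul1r -powRM//; congr (_ `^ _); ring.
  rewrite E; apply: powR_anti.
  - by rewrite addr_ge0// ltW.
  - by rewrite divr_gt0// ltr_pwDl.
  - by rewrite ger0_norm//; lra.
apply: (@le_trans _ _ (6 * (1 + `|h|) `^ p * (2 `^ (2 + p) * 2 `^ (2 + p) * (1 + `|h|) `^ (- (2 + p))))).
  by apply: ler_pM => //; first [exact: powR_ge0|exact: far0].
rewrite (_ : _ * _ = C2 * ((1 + `|h|) `^ p * (1 + `|h|) `^ (- (2 + p)))); last by rewrite /C2; ring.
rewrite wt_mul (_ : p - (2 + p) = - 2); last by ring.
by apply: ler_pM; rewrite ?powR_ge0 ?nearw_out// lerDr.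
Qed.

Lemma measurable_oddpow : measurable_fun [set: R] oddpow.
Proof. by apply: measurable_funM => //; exact: measurable_normc. Qed.

Lemma ddo_itg : itg (fun h => ddo h * `|h| `^ (- (2 + p))).
Proof.
have [C C0 hC] := ddo_bound.
apply: (itg_le _ (itgZ C (itg_nearw hp)) hC).
apply: measurable_funM; last exact: measurable_normc.
exact: measurable_ddx measurable_oddpow.
Qed.

(** [fl oddpow] is [flp oddpow 1] times the sign function, whose derivative is twice the Dirac mass
    at [0]; the denominator comes from [oddpow' = (p + 1) |x|^p]. *)
Definition kap : R := - 2 * flp oddpow 1 / (p + 1).

(** The integrand of [flp oddpow 1] is nonpositive, and on []1, 2[] monotonicity gives
    [ddo <= ddo 1 = m < 0], so the integral is strictly negative. *)
Lemma kap_gt0 : 0 < kap.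
Proof.
pose m := 2 - 2 * 2 `^ p.
have m0 : m < 0.
  have : (1 : R) < 2 `^ p.
    have : 1 `^ p < 2 `^ p :> R by apply: gt0_ltr_powR; rewrite ?nnegrE//; lra.
    by rewrite powR1.
  by rewrite /m; lra.
have e1 : ddo 1 = m.
  by rewrite /ddo/dd/oddpow subrr mul0r subr0 normr1 powR1 mul1r mulr1 /m ger0_norm.
have [i2 e2] := int_pow_near (ltr01) (ltr_pwDl ltr01 (lexx (1 : R))).
have k : flp oddpow 1 <= m * 2 `^ (- (2 + p)).
  have E : \int[mu]_h (m * 2 `^ (- (2 + p)) * ((1 < h < 1 + 1)%R%:R * (1 * (h - 1) `^ (1 - 1)))) = m * 2 `^ (- (2 + p)).
    by rewrite intZ// e2 addrK powR1 mulr1.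
  rewrite -[leRHS]E; apply: int_le; [exact: ddo_itg|exact: itgZ|] => h.
  rewrite subrr powRr0 !mulr1.
  have [/andP[h1 h2]|_] := boolP (1 < h < 1 + 1); last first.
    by rewrite mulr0 mulr_le0_ge0 ?powR_ge0// ddo_le0.
  rewrite mulr1.
  have hm : ddo h <= m by rewrite -e1; apply: ddo_noninc => //; exact: ltW.
  have hb : 2 `^ (- (2 + p)) <= `|h| `^ (- (2 + p)).
    rewrite gtr0_norm; last by lra.
    by apply: powR_anti; [rewrite addr_ge0// ltW|lra|lra].
  apply: (@le_trans _ _ (m * `|h| `^ (- (2 + p)))).
    by rewrite ler_wpM2r ?powR_ge0.
  by rewrite ler_nM2l.
have k0 : flp oddpow 1 < 0.
  by apply: (le_lt_trans k); rewrite nmulr_rlt0// powR_gt0.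
rewrite /kap mulNr -mulrN divr_gt0//; last by rewrite addr_gt0.
by rewrite mulr_gt0// oppr_gt0.
Qed.

Lemma dd_oddpow_scale l x h : 0 < l -> dd oddpow (l * x) (l * h) = l `^ (p + 1) * dd oddpow x h.
Proof.
move=> l0.
have E y : oddpow (l * y) = l `^ (p + 1) * oddpow y.
  rewrite /oddpow normrM powRM// (gtr0_norm l0) powRD ?powRr1 ?ltW//; first by ring.
  by apply/implyP => _; rewrite gt_eqF.
by rewrite /dd -mulrDr -mulrBr !E; ring.
Qed.

Lemma dd_oddpowN x h : dd oddpow (- x) h = - dd oddpow x h.
Proof.
rewrite /dd (_ : - x + h = - (x - h)); last by ring.
by rewrite (_ : - x - h = - (x + h)) ?oddpowN; ring.
Qed.

Lemma dd_oddpow0 h : dd oddpow 0 h = 0.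
Proof. by rewrite /dd add0r sub0r oddpowN /oddpow mul0r; ring. Qed.

Lemma oddpow_scaled x : 0 < x ->
  (fun h => dd oddpow x h * `|h| `^ (- (2 + p))) =
  (fun h => x^-1 * (fun h => ddo h * `|h| `^ (- (2 + p))) (x^-1 * h + 0)).
Proof.
move=> x0; apply/funext => h; rewrite /= addr0.
have xV : 0 < x^-1 by rewrite invr_gt0.
rewrite /ddo -{2}(mulVf (lt0r_neq0 x0)) dd_oddpow_scale// normrM powRM// (gtr0_norm xV).
have -> : (x^-1) `^ (p + 1) * dd oddpow x h * ((x^-1) `^ (- (2 + p)) * `|h| `^ (- (2 + p))) =
  (x^-1) `^ (p + 1) * (x^-1) `^ (- (2 + p)) * (dd oddpow x h * `|h| `^ (- (2 + p))) by ring.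
rewrite -powRD; last by apply/implyP => _; rewrite gt_eqF.
rewrite (_ : p + 1 - (2 + p) = - 1); last by ring.
rewrite powR_inv1; last by rewrite invr_ge0 ltW.
by rewrite invrK mulKf ?gt_eqF.
Qed.

(** The degrees [p + 1] of [oddpow], [-(2 + p)] of the kernel and [1] of the measure add up to zero.
    The integral of the absolute value is included because it is the uniform bound behind
    [oddpow_itg2]. *)
Lemma oddpow_int x : 0 < x ->
  [/\ itg (fun h => dd oddpow x h * `|h| `^ (- (2 + p))), flp oddpow x = flp oddpow 1 &
  \int[mu]_h `|dd oddpow x h * `|h| `^ (- (2 + p))| = \int[mu]_h `|ddo h * `|h| `^ (- (2 + p))|].
Proof.
move=> x0; have xV : x^-1 != 0 by rewrite invr_eq0 gt_eqF.
have n1 : `|x^-1|^-1 = x by rewrite gtr0_norm ?invr_gt0// invrK.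
have i1 := itg_affine 0 xV ddo_itg.
split.
- by rewrite oddpow_scaled//; exact: itgZ.
- rewrite /fl oddpow_scaled// intZ// (int_affine 0 xV ddo_itg).
  by rewrite n1 mulrA mulVf ?gt_eqF// mul1r.
- have -> : (fun h => `|dd oddpow x h * `|h| `^ (- (2 + p))|) =
    (fun h => x^-1 * (fun h => `|ddo h * `|h| `^ (- (2 + p))|) (x^-1 * h + 0)).
    apply/funext => h; have := congr1 (fun f => `|f h|) (oddpow_scaled x0) => /= ->.
    by rewrite normrM gtr0_norm ?invr_gt0.
  have i2 := itg_affine 0 xV (itg_norm ddo_itg).
  rewrite intZ//.
  rewrite (int_affine 0 xV (itg_norm ddo_itg)).
  by rewrite n1 mulrA mulVf ?gt_eqF// mul1r.
Qed.

Lemma oddpow_fl x : flp oddpow x = (0 < x)%R%:R * flp oddpow 1 - (x < 0)%R%:R * flp oddpow 1.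
Proof.
have [x0|x0|->] := ltgtP x 0; rewrite ?mul1r ?mul0r ?subr0 ?sub0r.
- have nx0 : 0 < - x by rewrite oppr_gt0.
  have [i e _] := oddpow_int nx0; rewrite -e.
  have -> : flp oddpow x = \int[mu]_h (- (dd oddpow (- x) h * `|h| `^ (- (2 + p)))).
    by apply: eq_int => h; rewrite dd_oddpowN mulNr opprK.
  exact: intN i.
- by have [] := oddpow_int x0.
- by rewrite -[RHS]int0; apply: eq_int => h; rewrite dd_oddpow0 mul0r.
Qed.

Lemma oddpow_itg2 phi : tst phi ->
  itg2 (fun x h => phi x * (dd oddpow x h * `|h| `^ (- (2 + p)))).
Proof.
move=> tp; pose c := \int[mu]_h `|ddo h * `|h| `^ (- (2 + p))|.
have key x : itg (fun h => dd oddpow x h * `|h| `^ (- (2 + p))) /\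
  \int[mu]_h `|dd oddpow x h * `|h| `^ (- (2 + p))| <= c.
  have [x0|x0|->] := ltgtP x 0.
  - have nx0 : 0 < - x by rewrite oppr_gt0.
    have [i _ e] := oddpow_int nx0; split.
      by apply: eq_itg (itgN i) => h; rewrite dd_oddpowN mulNr opprK.
    rewrite /c -e (_ : \int[mu]_h `|dd oddpow x h * _| = \int[mu]_h `|dd oddpow (- x) h * `|h| `^ (- (2 + p))|); first exact: lexx.
    by apply: eq_int => h; rewrite dd_oddpowN mulNr normrN.
  - have [i _ e] := oddpow_int x0; split; [exact: i|rewrite e; exact: lexx].
  - split; first by apply: eq_itg itg0 => h; rewrite dd_oddpow0 mul0r.
    rewrite (_ : \int[mu]_h _ = 0); first by apply: int_ge0.
    by rewrite -[RHS]int0; apply: eq_int => h; rewrite dd_oddpow0 mul0r normr0.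
apply: (itg2I (g := fun x => c * `|phi x|)).
- apply: measurable_funM; first exact: (measurableT_comp (tst_measurable tp)).
  apply: measurable_funM; first exact: measurable_dd measurable_oddpow.
  exact: (measurableT_comp (measurable_normc _)).
- by move=> x; apply: itgZ; exact: (key x).1.
- exact/itgZ/itg_norm/tst_itg.
- move=> x; under eq_Rintegral do rewrite normrM.
  rewrite intZ; last exact: itg_norm (key x).1.
  rewrite mulrC; apply: ler_wpM2r; [exact: normr_ge0|exact: (key x).2].
Qed.

Lemma normpow_growth a (x : R) : `| `|x - a| `^ p | <= (1 + `|a|) `^ p * (1 + `|x|) `^ p.
Proof.
rewrite ger0_norm ?powR_ge0// -powRM ?addr_ge0//.
apply: ge0_ler_powR; rewrite ?nnegrE ?mulr_ge0 ?addr_ge0//; first exact: ltW.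
have := ler_normB x a; have : 0 <= `|a| * `|x| by rewrite mulr_ge0.
by lra.
Qed.

Lemma measurable_normpow_shift a : measurable_fun [set: R] (fun x : R => `|x - a| `^ p).
Proof.
by apply: measurable_powc; apply: measurableT_comp => //; exact: measurable_funB.
Qed.

Lemma oddpow_growth : forall x, `|oddpow x| <= 1 * (1 + `|x|) `^ (p + 1).
Proof.
move=> x; rewrite mul1r /oddpow normrM [X in _ * X]ger0_norm ?powR_ge0// powRD; last first.
  by apply/implyP => _; rewrite gt_eqF// ltr_pwDl.
rewrite powRr1 ?addr_ge0// mulrC; apply: ler_pM; rewrite ?powR_ge0 ?lerDr//.
by apply: ge0_ler_powR; rewrite ?nnegrE ?addr_ge0 ?lerDr// ltW.
Qed.

(** Write [|x|^p] as [oddpow' / (p + 1)] and integrate by parts; by translation the second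
    difference can then be moved from [phi'] to [oddpow]. *)
Lemma int_normpow_dd phi h : tst phi ->
  \int[mu]_x (`|x| `^ p * dd phi x h) = - (p + 1)^-1 * \int[mu]_x (derive1 phi x * dd oddpow x h).
Proof.
move=> tp; have tp' := tst_derive tp.
have pp : p + 1 != 0 by rewrite gt_eqF// addr_gt0.
have td := tst_dd h tp; have td' := tst_dd h tp'.
have mo := measurable_oddpow; have og := oddpow_growth.
have i1 := tst_itgM mo ler01 og td'.
have ng x : `| `|x : R| `^ p| <= 1 * (1 + `|x|) `^ p.
  by have := normpow_growth 0 x; rewrite subr0 normr0 addr0 powR1.
have i2 := tst_itgM (measurable_normc p) ler01 ng td.
have e1 : (p + 1) * \int[mu]_x (`|x| `^ p * dd phi x h) = - \int[mu]_x (oddpow x * dd (derive1 phi) x h).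
  rewrite -intZ//; apply/eqP; rewrite -subr_eq0 opprK -intD//; last exact: itgZ.
  have [L L0 hL] := tst_supp td; have [L' L'0 hL'] := tst_supp td'.
  apply/eqP; apply: (@int_derivative0 _ (fun x => oddpow x * dd phi x h) _ (Num.max L L')).
  - move=> x; apply: (isd_eq (isdM (oddpow_derive x) (dd_derive h x tp))).
    by rewrite mulrA.
  - move=> x; apply: cvgD; apply: cvgM.
    + exact: cvg_cst.
    + apply: cvgM; first exact: continuous_normpowR.
      exact: (tst_continuous td).
    + exact: (derivable_continuousW (oddpow_derive x)).
    + exact: (tst_continuous td').
  - by move=> x; rewrite gt_max => /andP[/hL -> /hL' ->]; rewrite !mulr0 addr0.
have e2 : \int[mu]_x (oddpow x * dd (derive1 phi) x h) = \int[mu]_x (derive1 phi x * dd oddpow x h).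
  have j a : itg (fun x => oddpow (x + a) * derive1 phi x).
    have := itg_shift a (tst_itgM mo ler01 og (tst_shift (- a) tp')).
    by apply: eq_itg => x; rewrite addrK.
  have j' a : itg (fun x => oddpow x * derive1 phi (x + a)).
    exact: tst_itgM mo ler01 og (tst_shift a tp').
  have s a : \int[mu]_x (oddpow x * derive1 phi (x + a)) = \int[mu]_x (oddpow (x - a) * derive1 phi x).
    rewrite -(int_shift (- a) (j' a)); apply: eq_int => x.
    by rewrite subrK.
  have j0 := tst_itgM mo ler01 og tp'.
  transitivity (\int[mu]_x (2 * (oddpow x * derive1 phi x) - oddpow x * derive1 phi (x + h) - oddpow x * derive1 phi (x - h))).
    by apply: eq_int => x; rewrite /dd; ring.
  transitivity (\int[mu]_x (2 * (oddpow x * derive1 phi x) - oddpow (x + h) * derive1 phi x - oddpow (x - h) * derive1 phi x)); last first.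
    by apply: eq_int => x; rewrite /dd; ring.
  rewrite intB; [|exact: (itgB (itgZ 2 j0) (j' h))|exact: j'].
  rewrite intB; [|exact: (itgZ 2 j0)|exact: j'].
  rewrite intB; [|exact: (itgB (itgZ 2 j0) (j h))|exact: j].
  rewrite intB; [|exact: (itgZ 2 j0)|exact: j].
  have s2 : \int[mu]_x (oddpow x * derive1 phi (x - h)) = \int[mu]_x (oddpow (x + h) * derive1 phi x).
    by rewrite s; apply: eq_int => x; rewrite opprK.
  exact: (etrans (congr2 (fun u v => \int[mu]_x (2 * (oddpow x * derive1 phi x)) - u - v) (s h) s2) (addrAC _ _ _)).
apply: (mulfI pp); rewrite e1 e2; by field.
Qed.

Lemma int_half_derivative phi : tst phi ->
  \int[mu]_x (derive1 phi x * ((0 < x)%R%:R - (x < 0)%R%:R)) = - 2 * phi 0.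
Proof.
move=> tp; have tp' := tst_derive tp; have [L L0 hL] := tst_supp tp.
have [L' L'0 hL'] := tst_supp tp'.
pose M := Num.max L L' + 1.
have M1 : L < M by rewrite ltr_pwDr// le_max lexx.
have M2 : L' < M by rewrite ltr_pwDr// le_max lexx orbT.
have M0 : 0 <= M by rewrite addr_ge0// le_max L0.
have M0' : - M <= 0 by rewrite oppr_le0.
have f1 := @ftc_segment _ phi (derive1 phi) 0 M M0 (fun x _ => tst_is_derive x tp) (fun x _ => @tst_continuous _ _ tp' x).
have f2 := @ftc_segment _ phi (derive1 phi) (- M) 0 M0' (fun x _ => tst_is_derive x tp) (fun x _ => @tst_continuous _ _ tp' x).
have r1 : \int[mu]_(x in `[0, M]) derive1 phi x = - phi 0.
  by rewrite /Rintegral f1/= hL ?sub0r// ger0_norm.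
have r2 : \int[mu]_(x in `[- M, 0]) derive1 phi x = phi 0.
  by rewrite /Rintegral f2/= [X in _ - X]hL ?subr0// normrN ger0_norm.
rewrite Rintegral_mkcond in r1; rewrite Rintegral_mkcond in r2.
have ip := tst_itg tp'.
have i a b : itg (derive1 phi \_ `[a, b]).
  rewrite /itg -restrict_EFin; apply/integrable_restrict => //.
  by rewrite setTI; apply: integrableS ip.
transitivity (\int[mu]_x ((derive1 phi \_ `[0, M]) x - (derive1 phi \_ `[- M, 0]) x)).
  apply: eq_int => x; rewrite !patchE.
  have [x0|x0|->] := ltgtP x 0.
  - rewrite memNset; last by rewrite /= in_itv/= leNgt x0.
    rewrite sub0r mulrN1 add0r; case: ifPn => // /negP xM.
    rewrite oppr0 hL' ?oppr0//; apply: (lt_trans M2); rewrite ltNge; apply/negP => xM'.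
    by apply: xM; rewrite inE/= in_itv/= (ltW x0) andbT lerNl -(ltr0_norm x0).
  - have -> : (x \in `[- M, 0]%classic) = false.
      by apply/negP => /set_mem /=; rewrite in_itv/= (leNgt x) x0 andbF.
    rewrite !subr0 mulr1; case: ifPn => // /negP xM.
    rewrite hL'//; apply: (lt_trans M2); rewrite ltNge; apply/negP => xM'.
    by apply: xM; rewrite inE/= in_itv/= (ltW x0)/= -(gtr0_norm x0).
  - rewrite subrr mulr0 !mem_set ?subrr// /= in_itv/= lexx ?M0// andbT; exact: M0'.
by rewrite intB// r1 r2; ring.
Qed.

(** The operator cannot be put on [|x|^p] directly: its second difference at [0] is [-2 |h|^p],
    which times the kernel is not integrable. At fixed [h] the pairing is therefore transferred to
    [oddpow], for which Fubini is available. *)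
Lemma fundamental0 phi : tst phi -> \int[mu]_x (`|x| `^ p * flp phi x) = - kap * phi 0.
Proof.
move=> tp; have tp' := tst_derive tp.
have ng x : `| `|x : R| `^ p| <= 1 * (1 + `|x|) `^ p.
  by have := normpow_growth 0 x; rewrite subr0 normr0 addr0 powR1.
rewrite (fl_fubini hp (measurable_normc p) ler01 ng tp).
have i2 := oddpow_itg2 tp'.
have ex h : itg (fun x => derive1 phi x * dd oddpow x h).
  have mo := measurable_oddpow; have og := oddpow_growth.
  have j a : itg (fun x => oddpow (x + a) * derive1 phi x).
    have := itg_shift a (tst_itgM mo ler01 og (tst_shift (- a) tp')).
    by apply: eq_itg => x; rewrite addrK.
  apply: (eq_itg _ (itgB (itgB (itgZ 2 (j 0)) (j h)) (j (- h)))) => x.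
  by rewrite /dd addr0; ring.
transitivity (- (p + 1)^-1 * \int[mu]_h \int[mu]_x (derive1 phi x * (dd oddpow x h * `|h| `^ (- (2 + p))))).
  rewrite -intZ; last exact: itg2_right i2.
  apply: eq_int => h; rewrite int_normpow_dd// -mulrA; congr (_ * _).
  rewrite mulrC -intZ//; apply: eq_int => x; ring.
rewrite -(real_fubini i2).
transitivity (- (p + 1)^-1 * \int[mu]_x (flp oddpow 1 * (derive1 phi x * ((0 < x)%R%:R - (x < 0)%R%:R)))).
  congr (_ * _); apply: eq_int => x; rewrite intZ.
    by rewrite -/(fl p oddpow x) oddpow_fl; ring.
  have [x0|x0|->] := ltgtP x 0.
  - have nx0 : 0 < - x by rewrite oppr_gt0.
    by have [i _ _] := oddpow_int nx0; apply: eq_itg (itgN i) => h; rewrite dd_oddpowN mulNr opprK.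
  - by have [] := oddpow_int x0.
  - by apply: eq_itg itg0 => h; rewrite dd_oddpow0 mul0r.
rewrite intZ ?int_half_derivative//; last first.
  have := itg2_left i2.
  have k0 : flp oddpow 1 != 0.
    by apply: contraTneq kap_gt0 => k0; rewrite /kap k0 mulr0 mul0r ltxx.
  move=> /(itgZ (flp oddpow 1)^-1); apply: eq_itg => x; rewrite intZ.
    rewrite -/(fl p oddpow x) (oddpow_fl x) -mulrBl mulrCA (mulrC (_ - _)).
    by rewrite mulKf.
  have [x0|x0|->] := ltgtP x 0.
  - have nx0 : 0 < - x by rewrite oppr_gt0.
    by have [i _ _] := oddpow_int nx0; apply: eq_itg (itgN i) => h; rewrite dd_oddpowN mulNr opprK.
  - by have [] := oddpow_int x0.
  - by apply: eq_itg itg0 => h; rewrite dd_oddpow0 mul0r.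
by rewrite /kap; field; rewrite gt_eqF// addr_gt0.
Qed.

Lemma fundamental phi y : tst phi -> \int[mu]_x (`|x - y| `^ p * flp phi x) = - kap * phi y.
Proof.
move=> tp; have := fundamental0 (tst_shift y tp); rewrite add0r => <-.
have A0 : 0 <= (1 + `|y|) `^ p by exact: powR_ge0.
have i := fl_itgM hp (measurable_normpow_shift y) A0 (normpow_growth y) tp.
rewrite -(int_shift y i); apply: eq_int => x.
by rewrite addrK fl_shift.
Qed.

End fundamental.

(** * Liouville theorem *)

Section glue.
Context {R : realType}.

Lemma isd_glue (P Q P' Q' : R -> R) (c : R) :
  (forall t : R, is_derive t 1 P (P' t)) ->
  (forall t : R, c <= t -> is_derive t 1 Q (Q' t)) -> P c = Q c -> P' c = Q' c ->
  forall t : R, is_derive t 1 (fun t => if t < c then P t else Q t)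
                           (if t < c then P' t else Q' t).
Proof.
move=> dP dQ PQ PQ' t; have [tc|ct|->] := ltgtP t c.
- apply: (isd_near _ (dP t)); near=> z; rewrite ifT//.
  by near: z; exact: lt_nbhsl.
- apply: (isd_near _ (dQ t (ltW ct))); near=> z; rewrite ifF//.
  by apply/negbTE; rewrite -leNgt; apply: ltW; near: z; exact: lt_nbhsr.
have [eP vP] := dP c; have [eQ vQ] := dQ c (lexx c).
have limP : h^-1 *: (P (h *: 1 + c) - P c) @[h --> (0 : R)^'] --> P' c.
  by rewrite -vP; exact: eP.
have limQ : h^-1 *: (Q (h *: 1 + c) - Q c) @[h --> (0 : R)^'] --> Q' c.
  by rewrite -vQ; exact: eQ.
pose f t := if t < c then P t else Q t.
have H : h^-1 *: (f (h *: 1 + c) - f c) @[h --> (0 : R)^'] --> Q' c.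
  apply/cvgrPdist_lt => e e0.
  have hP : \forall h \near (0 : R)^', `|P' c - h^-1 *: (P (h *: 1 + c) - P c)| < e.
    by move/cvgrPdist_lt : limP; apply.
  have hQ : \forall h \near (0 : R)^', `|Q' c - h^-1 *: (Q (h *: 1 + c) - Q c)| < e.
    by move/cvgrPdist_lt : limQ; apply.
  near=> h; rewrite /f ltxx; case: ifPn => _.
    by rewrite -PQ -PQ'; near: h; exact: hP.
  by near: h; exact: hQ.
split; first by apply/cvg_ex; exists (Q' c).
exact/cvg_lim.
Unshelve. all: by end_near. Qed.

End glue.

(* [H = |x|^p] outside [-1, 1], continued inside by an even polynomial so as to
   be of class C^4: a power of [x^2] is replaced by its Taylor polynomial at 1. *)
Section parametrix.
Context {R : realType}.
Variable p : R.
Hypothesis hp : 0 < p < 1.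
Notation mu := (@lebesgue_measure R).

Let p0 : 0 < p. Proof. by case/andP: hp. Qed.

Let p1 : p < 1. Proof. by case/andP: hp. Qed.

Let a := p / 2.

(** Falling factorial, the [j]-th derivative of [t^a] at [1]. Accordingly [taylor j] is the [j]-th
    derivative of the degree-four Taylor polynomial of [t^a] at [1]. *)
Definition fall (j : nat) : R := \prod_(k < j) (a - k%:R).

Definition taylor (j : nat) (t : R) : R :=
  match j with
  | 0 => fall 0 + fall 1 * (t - 1) + fall 2 * (t - 1) ^+ 2 / 2 + fall 3 * (t - 1) ^+ 3 / 6
         + fall 4 * (t - 1) ^+ 4 / 24
  | 1 => fall 1 + fall 2 * (t - 1) + fall 3 * (t - 1) ^+ 2 / 2 + fall 4 * (t - 1) ^+ 3 / 6
  | 2 => fall 2 + fall 3 * (t - 1) + fall 4 * (t - 1) ^+ 2 / 2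
  | 3 => fall 3 + fall 4 * (t - 1)
  | _ => fall 4
  end.

Definition om (j : nat) (t : R) : R :=
  if t < 1 then taylor j t else fall j * t `^ (a - j%:R).

Lemma fallS j : fall j.+1 = fall j * (a - j%:R).
Proof. by rewrite /fall big_ord_recr. Qed.

Lemma isd_pow (t : R) n : is_derive t 1 (fun t : R => (t - 1) ^+ n.+1) (n.+1%:R * (t - 1) ^+ n).
Proof.
elim: n => [|n IH].
  rewrite expr0 mulr1; apply: (isd_eq (isdB (isd_id t) (isd_cst 1 t))).
  by rewrite subr0.
have := isdM (isdB (isd_id t) (isd_cst 1 t)) IH.
rewrite subr0 mul1r => /isd_eq H.
have E : (fun y : R => (y - 1) * (y - 1) ^+ n.+1) = (fun y => (y - 1) ^+ n.+2).
  by apply/funext => y; rewrite -exprS.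
by rewrite E in H; apply: H; rewrite mulrCA -exprS -[in RHS]natr1 mulrDl mul1r addrC.
Qed.

Lemma taylor_derive j (t : R) : (j < 4)%N -> is_derive t 1 (taylor j) (taylor j.+1 t).
Proof.
have d1 := isd_pow t 0; have d2 := isd_pow t 1; have d3 := isd_pow t 2; have d4 := isd_pow t 3.
have Z n (k l c d : R) : is_derive t 1 (fun t : R => (t - 1) ^+ n) d ->
    is_derive t 1 (fun t : R => k * (t - 1) ^+ n / l) (k * d / l).
  move=> h; apply: (isd_eq (isdM (isdZ k h) (isd_cst l^-1 t))).
  by rewrite mulr0 addr0.
have L k : is_derive t 1 (fun t : R => k * (t - 1)) k.
  by apply: (isd_eq (isdZ k d1)); rewrite expr0 !mulr1.
case: j => [|[|[|[|//]]]] _ /=.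
- apply: (isd_eq (isdD (isdD (isdD (isdD (isd_cst (fall 0) t) (L (fall 1)))
    (Z 2%N (fall 2) 2 0 _ d2)) (Z 3%N (fall 3) 6 0 _ d3)) (Z 4%N (fall 4) 24 0 _ d4))).
  by field.
- apply: (isd_eq (isdD (isdD (isdD (isd_cst (fall 1) t) (L (fall 2)))
    (Z 2%N (fall 3) 2 0 _ d2)) (Z 3%N (fall 4) 6 0 _ d3))).
  by field.
- apply: (isd_eq (isdD (isdD (isd_cst (fall 2) t) (L (fall 3))) (Z 2%N (fall 4) 2 0 _ d2))).
  by field.
- by apply: (isd_eq (isdD (isd_cst (fall 3) t) (L (fall 4)))); rewrite add0r.
Qed.

Lemma om_derive j (t : R) : (j < 4)%N -> is_derive t 1 (om j) (om j.+1 t).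
Proof.
move=> j4; apply: (@isd_glue _ (taylor j) (fun t => fall j * t `^ (a - j%:R))
  (taylor j.+1) (fun t => fall j.+1 * t `^ (a - j.+1%:R)) 1).
- by move=> z; exact: taylor_derive.
- move=> z z1; have z0 : 0 < z by lra.
  apply: (isd_eq (isdZ (fall j) (is_derive1_powR (a - j%:R) z0))).
  rewrite mulrA -fallS; congr (_ * _ `^ _).
  by rewrite -natr1; ring.
- by rewrite powR1 mulr1; case: j j4 => [|[|[|[|//]]]] _ /=; rewrite subrr; ring.
- by rewrite powR1 mulr1; case: j j4 => [|[|[|[|//]]]] _ /=; rewrite ?subrr; ring.
Qed.

Lemma om_continuous j : (j < 5)%N -> continuous (om j).
Proof.
move=> j5 t; have [j4|] := ltnP j 4.
  exact: (derivable_continuousW (om_derive t j4)).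
rewrite leq_eqVlt ltnNge -ltnS j5 orbF => /eqP <-.
have [t1|t1] := ltP t 1.
  apply: (derivable_continuousW (l := 0)); apply: (isd_near _ (isd_cst (fall 4) t)).
  by near=> z; rewrite /om ifT//; near: z; exact: lt_nbhsl.
(* At order four the Taylor branch is the constant [fall 4], so [om 4] is the power branch evaluated
   at [max z 1]. *)
have c0 : continuous (fun z : R => fall 4 * (Num.max z 1) `^ (a - 4%:R)).
  move=> z; apply: cvgMr.
  have m0 : 0 < Num.max z 1 by rewrite lt_max ltr01 orbT.
  apply: (@continuous_comp R R R (fun z => Num.max z 1) (fun z => z `^ (a - 4%:R)) z).
    by apply: continuous_max; [exact: cvg_id|exact: cvg_cst].
  exact: continuous_powc.
have -> : om 4 = (fun z : R => fall 4 * (Num.max z 1) `^ (a - 4%:R)).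
  apply/funext => z; rewrite /om; have [z1|z1] := ltP z 1.
    by rewrite powR1 mulr1.
  by [].
exact: c0.
Unshelve. all: by end_near. Qed.

Lemma om_bound j : (j < 5)%N -> exists2 C, 0 <= C & forall t, 0 <= t ->
  `|om j t| <= C * (1 + t) `^ (a - j%:R).
Proof.
move=> j5; have [B B0 hB] := @bounded_on_segment R (om j) 0 1 ler01 (fun x _ => @om_continuous j j5 x).
pose e := `|a - j%:R|.
have pw t : 0 < t -> t <= 2 -> 1 <= t -> 2 `^ (- e) <= t `^ (a - j%:R).
  move=> t0 t2 t1; have e0 : 0 <= e by exact: normr_ge0.
  apply: le_trans (powR_anti e0 t0 t2) _; apply: ler_powR => //.
  by rewrite /e lerNl -normrN ler_norm.
exists ((B + `|fall j|) * 2 `^ e); first by rewrite mulr_ge0 ?powR_ge0// addr_ge0.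
move=> t t0; have t1 : 0 < 1 + t by lra.
have [t2|t2] := ltP t 1.
  apply: (@le_trans _ _ (B + `|fall j|)).
    by apply: le_trans (hB t _) _; [rewrite t0 ltW|rewrite lerDl].
  rewrite -mulrA ler_peMr ?addr_ge0//.
  have := pw (1 + t) t1; rewrite powRN => h.
  have {}h : (2 `^ e)^-1 <= (1 + t) `^ (a - j%:R) by apply: h; lra.
  rewrite mulrC -ler_pdivrMr ?powR_gt0// div1r//.
rewrite /om ltNge t2/= normrM [X in _ * X]ger0_norm ?powR_ge0// -mulrA.
apply: ler_pM; [exact: normr_ge0|exact: powR_ge0|by rewrite lerDr|].
(* For [t >= 1] the numbers [t] and [1 + t] differ by the factor [1 + t^-1], between [1] and [2];
   [e] bounds the exponent whatever its sign. *)
have T : t `^ (a - j%:R) = ((1 + t) / (1 + t^-1)) `^ (a - j%:R).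
  by congr (_ `^ _); field; rewrite !gt_eqF//; lra.
have tV : 0 < t^-1 by rewrite invr_gt0; lra.
rewrite T powRM ?invr_ge0; [|lra|lra].
rewrite mulrC ler_wpM2r ?powR_ge0//.
rewrite -powR_inv1; last by lra.
rewrite -powRrM.
apply: (@le_trans _ _ ((1 + t^-1) `^ e)).
  by apply: ler_powR; [lra|rewrite mulN1r -[leRHS]normrN ler_norm].
have tV1 : t^-1 <= 1 by rewrite invf_le1//; lra.
by apply: ge0_ler_powR; [exact: normr_ge0|rewrite nnegrE; lra|rewrite nnegrE; lra|lra].
Qed.

(** The successive derivatives of [om 0 (x^2)], written out by the chain rule. *)
Definition Hd (j : nat) (x : R) : R :=
  match j with
  | 0 => om 0 (x ^+ 2)
  | 1 => 2 * x * om 1 (x ^+ 2)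
  | 2 => 2 * om 1 (x ^+ 2) + 4 * x ^+ 2 * om 2 (x ^+ 2)
  | 3 => 12 * x * om 2 (x ^+ 2) + 8 * x ^+ 3 * om 3 (x ^+ 2)
  | _ => 12 * om 2 (x ^+ 2) + 48 * x ^+ 2 * om 3 (x ^+ 2) + 16 * x ^+ 4 * om 4 (x ^+ 2)
  end.

Lemma isd_X (x : R) n : is_derive x 1 (fun t : R => t ^+ n.+1) (n.+1%:R * x ^+ n).
Proof.
have := @isd_affine _ (fun t => (t - 1) ^+ n.+1) _ 1 1 x (isd_pow (1 * x + 1) n).
rewrite !mul1r addrK.
have -> : (fun y : R => (1 * y + 1 - 1) ^+ n.+1) = (fun t : R => t ^+ n.+1); last by [].
by apply/funext => y; rewrite mul1r addrK.
Qed.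

Lemma Hd_derive j (x : R) : (j < 4)%N -> is_derive x 1 (Hd j) (Hd j.+1 x).
Proof.
have d2 := isd_X x 1; have d3 := isd_X x 2.
have O k : (k < 4)%N -> is_derive x 1 (fun x : R => om k (x ^+ 2)) (om k.+1 (x ^+ 2) * (2%:R * x ^+ 1)).
  by move=> k4; exact: (@isd_comp _ (om k) (fun x => x ^+ 2) x _ _ (om_derive _ k4) d2).
have O0 := O 0%N isT; have O1 := O 1%N isT; have O2 := O 2%N isT; have O3 := O 3%N isT.
case: j => [|[|[|[|//]]]] _ /=.
- by apply: (isd_eq O0); ring.
- by apply: (isd_eq (isdM (isdZ 2 (isd_id x)) O1)); ring.
- by apply: (isd_eq (isdD (isdZ 2 O1) (isdM (isdZ 4 d2) O2))); ring.
- by apply: (isd_eq (isdD (isdM (isdZ 12 (isd_id x)) O2) (isdM (isdZ 8 d3) O3))); ring.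
Qed.

Lemma Hd_continuous j : (j < 5)%N -> continuous (Hd j).
Proof.
move=> j5 x; have [j4|] := ltnP j 4.
  exact: (derivable_continuousW (Hd_derive x j4)).
rewrite leq_eqVlt ltnNge -ltnS j5 orbF => /eqP <-.
have O k : (k < 5)%N -> {for x, continuous (fun x : R => om k (x ^+ 2))}.
  move=> k5; apply: (@continuous_comp R R R (fun x => x ^+ 2) (om k) x).
    exact: exprn_continuous.
  exact: om_continuous.
have X n (k : R) : {for x, continuous (fun x : R => k * x ^+ n)}.
  by apply: cvgMr; exact: exprn_continuous.
apply: cvgD; first apply: cvgD.
- by apply: cvgMr; exact: O.
- by apply: cvgM; [exact: X|exact: O].
- by apply: cvgM; [exact: X|exact: O].
Qed.

Lemma sqr_pow (x : R) (b : R) (n : nat) : `|x| ^+ n * (1 + x ^+ 2) `^ b <= (1 + x ^+ 2) `^ (b + n%:R / 2).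
Proof.
have s0 : 0 <= x ^+ 2 by exact: sqr_ge0.
rewrite powRD; last by apply/implyP => _; rewrite gt_eqF//; lra.
rewrite mulrC ler_wpM2l ?powR_ge0//.
rewrite (mulrC _ 2^-1) powRrM powR_mulrn ?powR_ge0// lerXn2r ?nnegrE ?powR_ge0//.
rewrite powR12_sqrt; last by lra.
by rewrite -sqrtr_sqr ler_wsqrtr// lerDr.
Qed.

Lemma Hd_bound j : (j < 5)%N -> exists2 C, 0 <= C & forall x,
  `|Hd j x| <= C * (1 + x ^+ 2) `^ (a - j%:R / 2).
Proof.
have [C0 C00 h0] := om_bound (isT : (0 < 5)%N); have [C1 C10 h1] := om_bound (isT : (1 < 5)%N).
have [C2 C20 h2] := om_bound (isT : (2 < 5)%N); have [C3 C30 h3] := om_bound (isT : (3 < 5)%N).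
have [C4 C40 h4] := om_bound (isT : (4 < 5)%N).
(* Every term of [Hd j] is some [k x^n om i (x^2)] with [n = 2 i - j], and so has order
   [a - i + n/2 = a - j/2] in [1 + x^2]. *)
have T (k c C : R) n i x : 0 <= k -> 0 <= C -> (forall t, 0 <= t -> `|om i t| <= C * (1 + t) `^ (a - i%:R)) ->
   c = a - i%:R + n%:R / 2 ->
   `|k * x ^+ n * om i (x ^+ 2)| <= k * C * (1 + x ^+ 2) `^ c.
  move=> k0 Cp h ->; rewrite !normrM (ger0_norm k0) normrX -!mulrA ler_wpM2l//.
  apply: (@le_trans _ _ (`|x| ^+ n * (C * (1 + x ^+ 2) `^ (a - i%:R)))).
    by rewrite ler_wpM2l ?exprn_ge0//; apply: h; exact: sqr_ge0.
  by rewrite mulrCA ler_wpM2l//; exact: sqr_pow.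
move=> j5; case: j j5 => [|[|[|[|[|//]]]]] _.
- exists C0 => // x; have := T 1 (a - 0%:R / 2) C0 0%N 0%N x ler01 C00 h0.
  by rewrite !mul1r; apply; ring.
- exists (2 * C1); first exact: mulr_ge0; move=> x.
  have := T 2 (a - 1%:R / 2) C1 1%N 1%N x (ler0n _ 2) C10 h1.
  by rewrite expr1; apply; field.
- exists (2 * C1 + 4 * C2); first by rewrite addr_ge0// mulr_ge0.
  move=> x; rewrite mulrDl; apply: le_trans (ler_normD _ _) _; apply: lerD.
    have := T 2 (a - 2%:R / 2) C1 0%N 1%N x (ler0n _ 2) C10 h1.
    by rewrite expr0 mulr1; apply; field.
  by apply: (T 4 _ C2 2%N 2%N x) => //; field.
- exists (12 * C2 + 8 * C3); first by rewrite addr_ge0// mulr_ge0.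
  move=> x; rewrite mulrDl; apply: le_trans (ler_normD _ _) _; apply: lerD.
    have := T 12 (a - 3%:R / 2) C2 1%N 2%N x (ler0n _ 12) C20 h2.
    by rewrite expr1; apply; field.
  by apply: (T 8 _ C3 3%N 3%N x) => //; field.
- exists (12 * C2 + 48 * C3 + 16 * C4); first by rewrite !addr_ge0// mulr_ge0.
  move=> x; rewrite (mulrDl (12 * C2 + 48 * C3) (16 * C4)) (mulrDl (12 * C2) (48 * C3)).
  apply: le_trans (ler_normD _ _) _; apply: lerD.
    apply: le_trans (ler_normD _ _) _; apply: lerD.
      have := T 12 (a - 4%:R / 2) C2 0%N 2%N x (ler0n _ 12) C20 h2.
      by rewrite expr0 mulr1; apply; field.
    by apply: (T 48 _ C3 2%N 3%N x) => //; field.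
  by apply: (T 16 _ C4 4%N 4%N x) => //; field.
Qed.

Lemma Hd_growth j : (j < 5)%N -> exists2 C, 0 <= C & forall x, `|Hd j x| <= C * (1 + `|x|) `^ p.
Proof.
move=> j5; have [C C0 h] := Hd_bound j5; exists C => // x.
apply: le_trans (h x) _; rewrite ler_wpM2l//.
have s0 : 0 <= x ^+ 2 by exact: sqr_ge0.
apply: (@le_trans _ _ ((1 + x ^+ 2) `^ a)).
  apply: ler_powR; first by lra.
  by rewrite gerBl divr_ge0.
rewrite /a mulrC powRrM ge0_ler_powR ?nnegrE ?powR_ge0 ?addr_ge0// ?(ltW p0)//.
rewrite powR12_sqrt; last by lra.
rewrite -[leRHS]ger0_norm ?addr_ge0// -sqrtr_sqr ler_wsqrtr//.
rewrite -[x ^+ 2]real_normK ?num_real//; have := normr_ge0 x; nra.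
Qed.

Lemma Hd4_decay : exists2 C, 0 <= C & forall x, `|Hd 4 x| <= C * (1 + `|x|) `^ (p - 4).
Proof.
have [C C0 h] := Hd_bound (isT : (4 < 5)%N).
exists (C * 2 `^ (2 - a)); first by rewrite mulr_ge0 ?powR_ge0.
move=> x; apply: le_trans (h x) _; rewrite -mulrA ler_wpM2l//.
have s0 : 0 <= x ^+ 2 by exact: sqr_ge0.
have a2 : 0 <= 2 - a by have := p1; rewrite /a; lra.
rewrite (_ : a - 4%:R / 2 = - (2 - a)); last by field.
have E : 2 `^ (2 - a) * (1 + `|x|) `^ (p - 4) = ((1 + `|x|) ^+ 2 / 2) `^ (- (2 - a)).
  rewrite powRM ?exprn_ge0 ?addr_ge0 ?invr_ge0// mulrC; congr (_ * _).
    by rewrite -powR_mulrn ?addr_ge0// -powRrM; congr (_ `^ _); rewrite /a; field.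
  by rewrite -powR_inv1// -powRrM mulrNN mul1r.
rewrite E; apply: powR_anti => //.
rewrite ler_pdivrMr// -[x ^+ 2]real_normK ?num_real//.
have := sqr_ge0 (1 - `|x|); nra.
Qed.

(** The [j]-th derivative of [r^p H(x / r)]; the factor [r^p] makes the rescaled function equal to
    [|x|^p] for [|x| >= r]. *)
Definition HR (r : R) (j : nat) (x : R) : R := r `^ p * r^-1 ^+ j * Hd j (r^-1 * x).

Lemma HR_derive r j (x : R) : (j < 4)%N -> is_derive x 1 (HR r j) (HR r j.+1 x).
Proof.
move=> j4; have := @isd_affine _ (Hd j) _ r^-1 0 x (Hd_derive (r^-1 * x + 0) j4).
have -> : (fun y => Hd j (r^-1 * y + 0)) = (fun y => Hd j (r^-1 * y)).
  by apply/funext => y; rewrite addr0.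
move=> /(isdZ (r `^ p * r^-1 ^+ j))/isd_eq; apply.
by rewrite addr0 /HR exprS; ring.
Qed.

Lemma HR_continuous r j : (j < 5)%N -> continuous (HR r j).
Proof.
move=> j5 x; apply: cvgMr.
apply: (@continuous_comp R R R (fun x => r^-1 * x) (Hd j) x).
  by apply: cvgMr; exact: cvg_id.
exact: Hd_continuous.
Qed.

Lemma HR_growth r j : 1 <= r -> (j < 5)%N ->
  exists2 C, 0 <= C & forall x, `|HR r j x| <= C * (1 + `|x|) `^ p.
Proof.
move=> r1 j5; have [C C0 h] := Hd_growth j5.
have r0 : 0 < r by lra.
have rV : 0 <= r^-1 by rewrite invr_ge0 ltW.
have rV1 : r^-1 <= 1 by rewrite invf_le1.
exists (r `^ p * r^-1 ^+ j * C); first by rewrite !mulr_ge0 ?powR_ge0 ?exprn_ge0.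
move=> x; rewrite /HR normrM ger0_norm ?mulr_ge0 ?powR_ge0 ?exprn_ge0//.
rewrite -[leRHS]mulrA ler_wpM2l ?mulr_ge0 ?powR_ge0 ?exprn_ge0//.
apply: le_trans (h _) _; rewrite ler_wpM2l//.
apply: ge0_ler_powR; rewrite ?nnegrE ?addr_ge0 ?(ltW p0)//.
by rewrite lerD2l normrM (ger0_norm rV) ler_piMl.
Qed.

(** By homogeneity the left side is below a multiple of [(r+|x|)^(p-4)]. Of the exponent [4 - p],
    the part [2 + p] is spent on the weight in [x], and the surplus [2 - 2 p], positive since
    [p < 1], on decay in [r]. *)
Lemma HR4_decay : exists2 C, 0 <= C & forall r x, 1 <= r ->
  `|HR r 4 x| <= C * r `^ (- (2 - 2 * p)) * (1 + `|x|) `^ (- (2 + p)).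
Proof.
have [C C0 h] := Hd4_decay; exists C => // r x r1.
have r0 : 0 < r by lra.
have rV : 0 < r^-1 by rewrite invr_gt0.
have rx : 0 < r + `|x| by rewrite ltr_pwDl.
rewrite /HR normrM ger0_norm ?mulr_ge0 ?powR_ge0 ?exprn_ge0 ?(ltW rV)//.
apply: (@le_trans _ _ (r `^ p * r^-1 ^+ 4 * (C * (1 + `|r^-1 * x|) `^ (p - 4)))).
  by rewrite ler_wpM2l ?mulr_ge0 ?powR_ge0 ?exprn_ge0 ?(ltW rV).
have -> : r `^ p * r^-1 ^+ 4 * (C * (1 + `|r^-1 * x|) `^ (p - 4)) = C * (r + `|x|) `^ (p - 4).
  rewrite normrM (gtr0_norm rV).
  have -> : 1 + r^-1 * `|x| = r^-1 * (r + `|x|) by rewrite mulrDr mulVf ?gt_eqF.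
  rewrite powRM ?(ltW rV) ?(ltW rx)//.
  have -> : r^-1 ^+ 4 = r `^ (- 4%:R) by rewrite powR_invn ?ltW// exprVn.
  have -> : r^-1 `^ (p - 4) = r `^ (4 - p) by rewrite -powR_inv1 ?ltW// -powRrM; congr (_ `^ _); ring.
  have -> : forall u v w z : R, u * v * (C * (w * z)) = u * v * w * (C * z) by move=> *; ring.
  rewrite -!powRD; try by apply/implyP => _; rewrite gt_eqF.
  by rewrite (_ : p + - 4%:R + (4 - p) = 0) ?powRr0 ?mul1r//; ring.
rewrite -mulrA ler_wpM2l//.
rewrite (_ : p - 4 = - (2 - 2 * p) - (2 + p)); last by ring.
rewrite powRD; last by apply/implyP => _; rewrite gt_eqF.
apply: ler_pM; rewrite ?powR_ge0//.
  by apply: powR_anti => //; [have := p1; lra|rewrite lerDl].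
apply: powR_anti; first by rewrite addr_ge0// ltW.
  by rewrite ltr_pwDl.
by rewrite lerD2r.
Qed.

Lemma HR_out r x : 0 < r -> r <= `|x| -> HR r 0 x = `|x| `^ p.
Proof.
move=> r0 rx; rewrite /HR expr0 mulr1 /Hd /om ifF; last first.
  apply/negbTE; rewrite -leNgt exprMn exprVn mulrC ler_pdivlMr ?exprn_gt0// mul1r.
  by rewrite -[x ^+ 2]real_normK ?num_real// lerXn2r ?nnegrE// ltW.
rewrite /fall big_ord0 mul1r subr0 -[(r^-1 * x) ^+ 2]real_normK ?num_real//.
rewrite -powR_mulrn// -powRrM (_ : 2%:R * a = p); last by rewrite /a; field.
have rV : 0 < r^-1 by rewrite invr_gt0.
rewrite normrM (gtr0_norm rV) powRM ?(ltW rV)// mulrA -powRM ?(ltW rV) ?(ltW r0)//.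
by rewrite mulfV ?gt_eqF// powR1 mul1r.
Qed.

Lemma derive1_refl (th : R -> R) b : tst th ->
  derive1 (derive1 (fun y => th (b - y))) = (fun y => derive1 (derive1 th) (b - y)).
Proof.
move=> tt; have D (f : R -> R) (y : R) : tst f -> is_derive y 1 (fun y => f (b - y)) (- derive1 f (b - y)).
  move=> tf; have := @isd_affine _ f _ (-1) b y (tst_is_derive (-1 * y + b) tf).
  rewrite !mulN1r (addrC (- y)); congr is_derive.
  by apply/funext => z; rewrite mulN1r addrC.
rewrite (is_deriveE (fun y => D th y tt)).
apply: is_deriveE => y; have := isdN (D _ y (tst_derive tt)).
by rewrite opprK.
Qed.

Lemma HR_ibp r th j : 1 <= r -> (j < 4)%N -> tst th ->
  \int[mu]_y (HR r j y * fl p (derive1 th) y) = - \int[mu]_y (HR r j.+1 y * fl p th y).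
Proof.
move=> r1 j4 tt; have j5 : (j < 5)%N by exact: ltnW.
have [A A0 hA] := HR_growth r1 j5; have [B B0 hB] := HR_growth r1 (j4 : (j.+1 < 5)%N).
apply: (fl_ibp hp (A := A + B)) => //.
- by move=> x; exact: HR_derive.
- exact: HR_continuous.
- exact: addr_ge0.
- by move=> x; apply: le_trans (hA x) _; rewrite ler_wpM2r ?powR_ge0// lerDl.
- by move=> x; apply: le_trans (hB x) _; rewrite ler_wpM2r ?powR_ge0// lerDr.
Qed.

Lemma HR_fl r th : 1 <= r -> tst th ->
  \int[mu]_y (HR r 0 y * fl p (derive1 (derive1 (derive1 (derive1 th)))) y) =
  \int[mu]_y (HR r 4 y * fl p th y).
Proof.
move=> r1 t0; have t1 := tst_derive t0; have t2 := tst_derive t1; have t3 := tst_derive t2.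
by rewrite (HR_ibp r1 (isT : (0 < 4)%N) t3) (HR_ibp r1 (isT : (1 < 4)%N) t2)
  (HR_ibp r1 (isT : (2 < 4)%N) t1) (HR_ibp r1 (isT : (3 < 4)%N) t0) !opprK.
Qed.

Lemma growth0 (x : R) : `| `|x| `^ p| <= 1 * (1 + `|x|) `^ p.
Proof. by have := normpow_growth hp 0 x; rewrite subr0 normr0 addr0 powR1. Qed.

(** Bounded and supported in [[-r, r]], so that its convolution with a test function is again a test
    function. *)
Definition GR (r y : R) : R := `|y| `^ p - HR r 0 y.

Lemma measurable_HR r j : (j < 5)%N -> measurable_fun [set: R] (HR r j).
Proof. by move=> j5; apply: continuous_measurable_fun; exact: HR_continuous. Qed.

Lemma itg_wtc : itg (fun y : R => (1 + `|y|) `^ (- (2 + p))).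
Proof. by apply: itg_wt; have := p0; lra. Qed.

(** The part [|y|^p] of [GR] contributes exactly [- kap * th''''] by [fundamental0]. In the part
    [HR] the four derivatives pass from [th] to [HR], and [wt_conv] preserves the weight under the
    convolution. The constant is chosen before [r]. *)
Lemma parametrix_error th : tst th -> exists2 C, 0 <= C & forall r, 1 <= r ->
  exists phi, [/\ tst phi, measurable_fun [set: R] (fl p phi) &
  forall x, `|fl p phi x + kap p * derive1 (derive1 (derive1 (derive1 th))) x| <=
     C * r `^ (- (2 - 2 * p)) * (1 + `|x|) `^ (- (2 + p))].
Proof.
move=> t0; have t4 := tst_derive (tst_derive (tst_derive (tst_derive t0))).
have [A A0 hA] := HR4_decay; have [B B0 hB] := fl_decay hp t0.
pose I := \int[mu]_y (1 + `|y|) `^ (- (2 + p)).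
have I0 : 0 <= I by apply: int_ge0 => y; exact: powR_ge0.
exists (A * B * (2 `^ (2 + p) * (I + I))); first by rewrite !mulr_ge0 ?powR_ge0 ?addr_ge0.
move=> r r1; have r0 : 0 < r by lra.
have [D D0 hD] := HR_growth r1 (isT : (0 < 5)%N).
have mG : measurable_fun [set: R] (GR r).
  by apply: measurable_funB; [exact: measurable_normc|exact: measurable_HR].
have GL y : r < `|y| -> GR r y = 0 by move=> ry; rewrite /GR HR_out ?subrr// ltW.
pose BB := (1 + D) * (1 + r) `^ p.
have BB0 : 0 <= BB by rewrite mulr_ge0 ?powR_ge0// addr_ge0.
have GB y : `|GR r y| <= BB.
  have [yr|/GL ->] := leP `|y| r; last by rewrite normr0.
  apply: le_trans (ler_normB _ _) _.
  apply: (@le_trans _ _ ((1 + D) * (1 + `|y|) `^ p)).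
    by rewrite mulrDl; apply: lerD; [exact: growth0|exact: hD].
  rewrite ler_wpM2l ?addr_ge0// ge0_ler_powR ?nnegrE ?addr_ge0 ?lerD2l ?(ltW r0) ?(ltW p0)//.
set chi := derive1 _ in t4 *.
exists (convol (GR r) chi); split.
- exact: conv_tst mG (ltW r0) BB0 GL GB _ t4.
- by apply: (fl_measurable hp); exact: conv_tst mG (ltW r0) BB0 GL GB _ t4.
move=> x; rewrite (conv_fl hp mG (ltW r0) BB0 GL GB x t4).
have tx := tst_refl x t4; have sx := tst_refl x t0.
have e1 := fundamental0 hp tx; rewrite subr0 in e1.
have e2 := HR_fl r1 sx; rewrite (derive1_refl x t0) (derive1_refl x (tst_derive (tst_derive t0))) -/chi in e2.
have i1 := fl_itgM hp (measurable_normc p) ler01 growth0 tx.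
have i2 := fl_itgM hp (measurable_HR r (isT : (0 < 5)%N)) D0 hD tx.
clearbody chi.
have -> : \int[mu]_y (GR r y * fl p chi (x - y)) =
  - kap p * chi x - \int[mu]_y (HR r 4 y * fl p (fun y => th (x - y)) y).
  transitivity (\int[mu]_y (`|y| `^ p * fl p (fun y => chi (x - y)) y) -
    \int[mu]_y (HR r 0 y * fl p (fun y => chi (x - y)) y)).
    rewrite -(intB i1 i2); apply: eq_int => y.
    have -> : fl p (fun y => chi (x - y)) y = fl p chi (x - y) := fl_refl p chi x y.
    exact: mulrBl.
  exact: (congr2 (fun u v => u - v) e1 e2).
rewrite mulNr addrAC addNr sub0r normrN.
have sh := itg_refl x itg_wtc.
have maj : itg (fun y => A * B * r `^ (- (2 - 2 * p)) * (2 `^ (2 + p) * (1 + `|x|) `^ (- (2 + p)) *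
    ((1 + `|y|) `^ (- (2 + p)) + (1 + `|x - y|) `^ (- (2 + p))))).
  exact: (itgZ _ (itgZ _ (itgD itg_wtc sh))).
have -> : A * B * (2 `^ (2 + p) * (I + I)) * r `^ (- (2 - 2 * p)) * (1 + `|x|) `^ (- (2 + p)) =
   \int[mu]_y (A * B * r `^ (- (2 - 2 * p)) * (2 `^ (2 + p) * (1 + `|x|) `^ (- (2 + p)) *
    ((1 + `|y|) `^ (- (2 + p)) + (1 + `|x - y|) `^ (- (2 + p))))).
  rewrite intZ; last exact: (itgZ _ (itgD itg_wtc sh)).
  rewrite intZ; last exact: (itgD itg_wtc sh).
  rewrite (intD itg_wtc sh) (int_refl x itg_wtc) -/I; ring.
have [D4 D40 hD4] := HR_growth r1 (isT : (4 < 5)%N).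
have i4 := fl_itgM hp (measurable_HR r (isT : (4 < 5)%N)) D40 hD4 sx.
apply: (int_norm_le i4 maj) => y; have -> : fl p (fun y => th (x - y)) y = fl p th (x - y) := fl_refl p th x y.
rewrite normrM.
apply: (@le_trans _ _ (A * r `^ (- (2 - 2 * p)) * (1 + `|y|) `^ (- (2 + p)) *
  (B * (1 + `|x - y|) `^ (- (2 + p))))).
  by apply: ler_pM => //; exact: hA.
rewrite (_ : _ * _ * _ * _ = A * B * r `^ (- (2 - 2 * p)) *
   ((1 + `|y|) `^ (- (2 + p)) * (1 + `|x - y|) `^ (- (2 + p)))); last by ring.
rewrite ler_wpM2l ?mulr_ge0 ?powR_ge0//.
by apply: wt_conv; rewrite addr_ge0// ltW.
Qed.

Lemma small_powR (X C b : R) : 0 < b -> 0 <= X -> 0 <= C ->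
  (forall r, 1 <= r -> X <= C * r `^ (- b)) -> X = 0.
Proof.
move=> b0 X0 C0 h; apply/eqP; rewrite eq_le X0 andbT leNgt; apply/negP => Xp.
(* Then [r^b = 1 + C / X], and the bound would say [X + C <= C]. *)
pose r := (1 + C / X) `^ b^-1.
have d : 1 <= 1 + C / X by rewrite lerDl divr_ge0.
have r1 : 1 <= r.
  by rewrite -[leLHS](powRr0 (1 + C / X)); apply: ler_powR => //; rewrite invr_ge0 ltW.
have := h r r1; rewrite powRN -powRrM mulVf ?gt_eqF// powRr1; last by lra.
rewrite ler_pdivlMr; last by lra.
by rewrite mulrDr mulr1 mulrCA mulfV ?gt_eqF// mulr1; lra.
Qed.

(* Testing [f] against [fl] of [(|x|^p - H_r) * th''''], which equals [- kap th''''] up to a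
   term of size [r^(2 p - 2)], and letting [r] grow. *)
Lemma liouville4 (f : R -> R) th : measurable_fun [set: R] f ->
  itg (fun x => f x * (1 + `|x|) `^ (- (2 + p))) ->
  (forall phi, tst phi -> \int[mu]_x (f x * fl p phi x) = 0) -> tst th ->
  \int[mu]_x (f x * derive1 (derive1 (derive1 (derive1 th))) x) = 0.
Proof.
move=> mf fw h t0; have t4 := tst_derive (tst_derive (tst_derive (tst_derive t0))).
have [C C0 hC] := parametrix_error t0; move: t4 hC; set chi := derive1 _ => t4 hC.
have q0 : 0 <= 2 + p by rewrite addr_ge0// ltW.
have pull (g : R -> R) K : measurable_fun [set: R] g ->
    (forall x, `|g x| <= K * (1 + `|x|) `^ (- (2 + p))) ->
    itg (fun x => f x * g x) /\
    `|\int[mu]_x (f x * g x)| <= K * \int[mu]_x `|f x * (1 + `|x|) `^ (- (2 + p))|.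
  move=> mg gK.
  have b x : `|f x * g x| <= K * `|f x * (1 + `|x|) `^ (- (2 + p))|.
    rewrite !normrM [`|_ `^ _|]ger0_norm ?powR_ge0// mulrCA ler_wpM2l//.
  have i := itgZ K (itg_norm fw).
  have i' : itg (fun x => f x * g x) by apply: (itg_le _ i b); exact: measurable_funM.
  by split => //; rewrite -intZ; [exact: int_norm_le|exact: itg_norm].
have [Q Q0 hQ] := tst_decay q0 t4.
have [ic _] := pull chi Q (tst_measurable t4) hQ.
have k0 := kap_gt0 hp.
suff : `|kap p * \int[mu]_x (f x * chi x)| = 0.
  by move/normr0_eq0/eqP; rewrite mulf_eq0 gt_eqF//= => /eqP.
have b0 : 0 < 2 - 2 * p by have := p1; lra.
apply: (small_powR b0 _ _ (C := C * \int[mu]_x `|f x * (1 + `|x|) `^ (- (2 + p))|)) => //.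
  by rewrite mulr_ge0// int_ge0.
move=> r r1; have [phi [tp mp hp']] := hC r r1.
have [Q' Q'0 hQ'] := fl_decay hp tp.
have [ip _] := pull (fl p phi) Q' mp hQ'.
have mk : measurable_fun [set: R] (fun x => kap p * chi x).
  by apply: measurable_funM => //; exact: tst_measurable.
have [ie] := pull (fun x => fl p phi x + kap p * chi x) (C * r `^ (- (2 - 2 * p))) (measurable_funD mp mk) hp'.
have -> : \int[mu]_x (f x * (fl p phi x + kap p * chi x)) = kap p * \int[mu]_x (f x * chi x).
  rewrite -intZ// -[RHS]add0r -(h phi tp) -intD//; last exact: itgZ.
  by apply: eq_int => x; ring.
by rewrite [X in _ -> _ <= X]mulrAC.
Qed.

End parametrix.

(** * Dominated convergence *)

Section dominated.
Context {R : realType}.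
Notation mu := (@lebesgue_measure R).

Lemma int_dominated (F : nat -> R -> R) (f g : R -> R) :
  (forall n, measurable_fun [set: R] (F n)) -> measurable_fun [set: R] f -> itg g ->
  (forall x, F n x @[n --> \oo] --> f x) -> (forall n x, `|F n x| <= g x) ->
  \int[mu]_x F n x @[n --> \oo] --> \int[mu]_x f x.
Proof.
move=> mF mf ig cF bF.
have iF n : itg (F n) by exact: itg_le (mF n) ig (bF n).
have cE x : (F n x)%:E @[n --> \oo] --> (f x)%:E.
  by apply: cvg_EFin; [exact: nearW|exact: cF].
have [ifn _ H] := @dominated_convergence _ _ R mu setT measurableT
  (fun n x => (F n x)%:E) (fun x => (f x)%:E) (fun x => (g x)%:E)
  (fun n => proj2 (measurable_EFinP _ _) (mF n)) (proj2 (measurable_EFinP _ _) mf)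
  (ae_all (fun x _ => cE x)) ig
  (ae_all (fun x n _ => bF n x)).
apply: fine_cvg; rewrite fineK; last exact: integrable_fin_num.
exact: H.
Qed.

End dominated.

(** * Functions with a vanishing distributional derivative *)

Section du_bois_reymond.
Context {R : realType}.
Notation mu := (@lebesgue_measure R).
Implicit Types f g th : R -> R.

Definition loc f := measurable_fun [set: R] f /\ forall L, itg (fun x => f x * ind L x).

Lemma loc_tst f th : loc f -> tst th -> itg (fun x => f x * th x).
Proof.
move=> [mf lf] tt; have [L L0 hL] := tst_supp tt; have [B B0 hB] := tst_bound tt.
apply: (itg_le _ (itgZ B (itg_norm (lf L)))).
  by apply: measurable_funM => //; exact: tst_measurable.
move=> x; rewrite !normrM mulrCA ler_wpM2l//.
rewrite /ind; have [xL|/hL ->] := leP `|x| L; first by rewrite normr1 mulr1.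
by rewrite !normr0 mulr0.
Qed.

Lemma loc_continuous f : continuous f -> loc f.
Proof.
move=> cf; split; first exact: continuous_measurable_fun.
move=> L; have [L0|L0] := leP 0 L; last first.
  apply: (eq_itg _ itg0) => x; rewrite /ind leNgt (lt_le_trans L0)// mulr0//.
have LL : - L <= L by lra.
have [B B0 hB] := bounded_on_segment LL (fun x _ => cf x).
apply: (itg_le _ (itgZ B (itg_ind L))).
  by apply: measurable_funM; [exact: continuous_measurable_fun|exact: measurable_ind].
move=> x; rewrite normrM [X in _ * X]ger0_norm ?ind_ge0//.
rewrite /ind; have [xL|_] := leP `|x| L; last by rewrite !mulr0.
by rewrite !mulr1; apply: hB; rewrite -ler_norml.
Qed.

Lemma locB f g : loc f -> loc g -> loc (fun x => f x - g x).
Proof.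
move=> [mf lf] [mg lg]; split; first exact: measurable_funB.
by move=> L; apply: (eq_itg _ (itgB (lf L) (lg L))) => x; rewrite mulrBl.
Qed.

Lemma loc_locally_integrable f : loc f -> locally_integrable [set: R] f.
Proof.
move=> [mf lf]; split => //; first exact: openT.
move=> K _ cK; have [M [_ hM]] := compact_bounded cK.
pose L := M + 1.
have KL x : K x -> `|x| <= L by move=> Kx; apply: hM => //; rewrite /L ltrDl.
apply: (@le_lt_trans _ _ (\int[mu]_x `|(f x * ind L x)%:E|)%E); last exact: itg_fin.
apply: (@le_trans _ _ (\int[mu]_(x in K) `|(f x * ind L x)%:E|)%E).
  rewrite le_eqVlt; apply/orP; left; apply/eqP; apply: eq_integral => x /set_mem /KL xL.
  by rewrite /ind xL mulr1.
apply: ge0_subset_integral => //.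
  exact: compact_measurable.
by apply/measurable_EFinP; apply: measurableT_comp => //; exact: (itg_meas (lf L)).
Qed.

Definition moll (x : R) : R := bump x / \int[mu]_y bump y.

Lemma tst_bump : tst (@bump R).
Proof.
split; first exact: smooth_bump.
exists 1 => x x1; apply: bump_out; apply/negP => /andP[x0 xl].
by move: x1; rewrite gtr0_norm//; lra.
Qed.

Lemma int_bump_gt0 : 0 < \int[mu]_y @bump R y.
Proof.
have i := tst_itg tst_bump.
rewrite lt_neqAle int_ge0 ?andbT; last by move=> x; exact: bump_ge0.
apply/eqP => e.
have z : (\int[mu]_x `|(@bump R x)%:E| = 0)%E.
  transitivity (\int[mu]_x (@bump R x)%:E)%E.
    by apply: eq_integral => x _; rewrite gee0_abs// lee_fin bump_ge0.
  by rewrite (intE i) -e.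
have mb : measurable_fun [set: R] (fun x => (@bump R x)%:E).
  by apply/measurable_EFinP; exact: (itg_meas i).
have ae0 := proj1 (ae_eq_integral_abs mu measurableT mb) z.
have c : (mu `]0%R, 1%R[%classic <= 0)%E.
  case: ae0 => N [mN N0 sub]; rewrite -N0; apply: le_measure; rewrite ?inE//.
  move=> x /=; rewrite in_itv/= => x01; apply: sub => /= h.
  have := h I; move=> [] h0; by have := bump_gt0 x01; rewrite h0 ltxx.
by move: c; rewrite lebesgue_measure_itv/= lte_fin ltr01 -EFinB subr0 lee_fin leNgt ltr01.
Qed.

Lemma tst_moll : tst moll.
Proof.
have := tstZ (\int[mu]_y bump y)^-1 tst_bump.
by congr tst; apply/funext => x; rewrite mulrC.
Qed.

Lemma int_moll : \int[mu]_x moll x = 1.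
Proof.
rewrite -[RHS](mulVf (lt0r_neq0 int_bump_gt0)) -intZ; last exact: tst_itg tst_bump.
by apply: eq_int => x; rewrite mulrC.
Qed.

Lemma moll_ge0 x : 0 <= moll x.
Proof. by rewrite divr_ge0 ?bump_ge0 ?(ltW int_bump_gt0). Qed.

Lemma moll_out x : ~~ (0 < x < 1) -> moll x = 0.
Proof. by move=> h; rewrite /moll bump_out// mul0r. Qed.

Lemma itg_restrict f (D : set R) : measurable D -> itg f -> mu.-integrable D (EFin \o f).
Proof. by move=> mD; exact: integrableS. Qed.

(** Take the primitive from the left; beyond the support it equals the total integral, which is
    zero. *)
Lemma tst_primitive g : tst g -> \int[mu]_x g x = 0 ->
  exists2 z, tst z & derive1 z = g.
Proof.
move=> tg g0; have ig := tst_itg tg; have [L L0 hL] := tst_supp tg.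
pose z x := \int[mu]_(t in [set` Interval -oo%O (BRight x)]) g t.
have dz (x : R) : is_derive x 1 z (g x).
  have xx : x < x + 1 by rewrite ltrDl.
  have := @continuous_FTC1 R g -oo%O x (x + 1) xx; case.
  - by apply: itg_restrict ig; exact: measurable_itv.
  - by rewrite ltNyr.
  - exact: tst_continuous tg x.
  by move=> d <-; rewrite derive1E; exact/derivableP.
exists z; last exact: is_deriveE.
split; first by apply: (smoothI dz); case: tg.
exists L => x xL; rewrite /z Rintegral_mkcond.
have [x0|x0] := ltP x 0.
  rewrite -[RHS]int0; apply: eq_int => t; rewrite patchE; case: ifPn => // /set_mem /=.
  rewrite in_itv/= => tx; apply: hL.
  by rewrite ltr0_norm in xL => //; rewrite ltr0_norm; lra.
rewrite -[RHS]g0; apply: eq_int => t; rewrite patchE; case: ifPn => // /negP h.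
apply/esym/hL; rewrite ger0_norm in xL => //.
have xt : x < t by rewrite ltNge; apply/negP => tx; apply: h; rewrite inE/= in_itv.
by rewrite ger0_norm; lra.
Qed.

Definition Dk k th : R -> R := iter k (@derive1 R R) th.

Lemma DkS k th : Dk k.+1 th = Dk k (derive1 th).
Proof. by rewrite /Dk iterSr. Qed.

Lemma tst_Dk k th : tst th -> tst (Dk k th).
Proof. by move=> tt; elim: k => //= k IH; exact: tst_derive. Qed.

Lemma Dk_lin k th rh c : tst th -> tst rh ->
  Dk k (fun x => th x + c * rh x) = (fun x => Dk k th x + c * Dk k rh x).
Proof.
move=> tt tr; elim: k => //= k ->; apply: is_deriveE => x.
by apply: isdD; [exact: tst_is_derive (tst_Dk k tt)|apply: isdZ; exact: tst_is_derive (tst_Dk k tr)].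
Qed.

Lemma int_monomial_Dk k th : tst th ->
  \int[mu]_x (x ^+ k * Dk k th x) = (-1) ^+ k * k`!%:R * \int[mu]_x th x.
Proof.
move=> tt; elim: k => [|k IH].
  by rewrite expr0 fact0 !mul1r; apply: eq_int => x; rewrite expr0 mul1r.
have tk := tst_Dk k tt.
have lX n : loc (fun x : R => x ^+ n) by apply: loc_continuous => x; exact: exprn_continuous.
have i1 := loc_tst (lX k) tk; have i2 := loc_tst (lX k.+1) (tst_derive tk).
have [L L0 hL] := tst_supp tk; have [L' L'0 hL'] := tst_supp (tst_derive tk).
have : \int[mu]_x (k.+1%:R * x ^+ k * Dk k th x + x ^+ k.+1 * derive1 (Dk k th) x) = 0.
  apply: (@int_derivative0 _ (fun x => x ^+ k.+1 * Dk k th x) _ (Num.max L L')).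
  - by move=> x; apply: isdM; [exact: isd_X|exact: tst_is_derive].
  - move=> x; apply: cvgD; apply: cvgM.
    + by apply: cvgMr; exact: exprn_continuous.
    + exact: tst_continuous tk x.
    + exact: exprn_continuous.
    + exact: tst_continuous (tst_derive tk) x.
  - by move=> x; rewrite gt_max => /andP[/hL -> /hL' ->]; rewrite !mulr0 addr0.
have -> : \int[mu]_x (k.+1%:R * x ^+ k * Dk k th x + x ^+ k.+1 * derive1 (Dk k th) x) =
   k.+1%:R * \int[mu]_x (x ^+ k * Dk k th x) + \int[mu]_x (x ^+ k.+1 * derive1 (Dk k th) x).
  rewrite -(intZ k.+1%:R i1) -(intD (itgZ _ i1) i2); apply: eq_int => x.
  by rewrite mulrA.
rewrite IH /= => /eqP; rewrite addrC addr_eq0 => /eqP ->.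
by rewrite factS natrM exprS; ring.
Qed.

(* The [k]-th distributional derivative of [f] vanishes. *)
Definition ann k f := forall th, tst th -> \int[mu]_x (f x * Dk k th x) = 0.

(** [th] minus its integral times [moll] has mean zero, hence is a derivative [z']. Testing with [z]
    shows that the pairing of [f] with the [k]-th derivative of [th] is proportional to the integral
    of [th], as it is for the monomial [x^k]; [c] is the ratio of the two factors. *)
Lemma ann_step k f : loc f -> ann k.+1 f ->
  exists c, ann k (fun x => f x - c * x ^+ k).
Proof.
move=> lf af; pose c1 := \int[mu]_x (f x * Dk k moll x).
pose d : R := (-1) ^+ k * k`!%:R.
have d0 : d != 0 by rewrite mulf_neq0 ?signr_eq0// pnatr_eq0 -lt0n fact_gt0.
exists (c1 / d) => th tt; pose I := \int[mu]_x th x.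
have tr := tst_moll; have it := tst_itg tt; have ir := tst_itg tr.
have tz := tstD tt (tstZ (- I) tr).
have z0 : \int[mu]_x (th x + - I * moll x) = 0.
  by rewrite (intD it (itgZ _ ir)) intZ// int_moll mulr1 subrr.
have [z tz' dz] := tst_primitive tz z0.
have if1 := loc_tst lf (tst_Dk k tt); have if2 := loc_tst lf (tst_Dk k tr).
have e1 : \int[mu]_x (f x * Dk k th x) = I * c1.
  have := af z tz'; rewrite DkS dz (Dk_lin k (- I) tt tr) => h.
  have e : \int[mu]_x (f x * Dk k th x) + (- I) * c1 = 0.
    rewrite -h -(intZ (- I) if2) -(intD if1 (itgZ _ if2)); apply: eq_int => x.
    by rewrite mulrDr mulrCA.
  by apply/eqP; rewrite -subr_eq0 -mulNr e.
have lX : loc (fun x : R => x ^+ k) by apply: loc_continuous => x; exact: exprn_continuous.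
have iX := loc_tst lX (tst_Dk k tt).
transitivity (\int[mu]_x (f x * Dk k th x) - c1 / d * \int[mu]_x (x ^+ k * Dk k th x)).
  rewrite -(intZ (c1 / d) iX) -(intB if1 (itgZ _ iX)); apply: eq_int => x.
  by rewrite mulrBl mulrA.
by rewrite e1 int_monomial_Dk// -/d -/I mulrA divfK// mulrC subrr.
Qed.

Definition molln (n : nat) (x : R) : R := n.+1%:R * moll (n.+1%:R * x + 0).

Lemma tst_molln n : tst (molln n).
Proof. by apply: tstZ; apply: tst_affine; [rewrite pnatr_eq0|exact: tst_moll]. Qed.

Lemma int_molln n : \int[mu]_x molln n x = 1.
Proof.
have n0 : n.+1%:R != 0 :> R by rewrite pnatr_eq0.
rewrite intZ; last exact: itg_affine n0 (tst_itg tst_moll).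
rewrite (int_affine 0 n0 (tst_itg tst_moll)) int_moll mulr1 ger0_norm// mulfV//.
Qed.

Lemma molln_ge0 n x : 0 <= molln n x.
Proof. by rewrite mulr_ge0 ?moll_ge0. Qed.

Lemma molln_out n x : molln n x != 0 -> 0 < x < n.+1%:R^-1.
Proof.
apply: contraNT => h; rewrite /molln moll_out ?mulr0// addr0; apply: contraNN h.
move=> /andP[h1 h2]; rewrite pmulr_rgt0// in h1.
by rewrite h1/= -[X in _ < X]mul1r ltr_pdivlMr// mulrC.
Qed.

(** Test with mollified indicators and pass to the limit: [f] has integral zero over every interval.
    Lebesgue differentiation then gives [f = 0] at almost every point. *)
Lemma ann0_ae f : loc f -> ann 0 f -> {ae mu, forall x, f x = 0}.
Proof.
move=> lf af; have [mf lf'] := lf.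
have key a b : a <= b -> \int[mu]_t (f t * (a < t <= b)%R%:R) = 0.
  move=> ab; pose G (y : R) : R := (a <= y <= b)%R%:R.
  pose L := `|a| + `|b|.
  have L0 : 0 <= L by rewrite addr_ge0.
  have mG : measurable_fun [set: R] G.
    apply: measurable_natb; apply: measurable_and => //; exact: measurable_fun_ler.
  have GL y : L < `|y| -> G y = 0.
    move=> yL; rewrite /G (_ : a <= y <= b = false)//; apply/negP => /andP[ay yb].
    move: yL; apply/negP; rewrite -leNgt /L ler_norml.
    have := ler_norm b; have := ler_norm (- a); rewrite normrN.
    have := normr_ge0 a; have := normr_ge0 b; lra.
  have GB y : `|G y| <= 1 by rewrite /G; case: (_ && _); rewrite ?normr1 ?normr0.
  pose th n := convol G (molln n).
  have tth n : tst (th n) by exact: conv_tst mG L0 ler01 GL GB _ (tst_molln n).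
  have b1 n x : `|th n x| <= 1.
    have i := itg_refl x (tst_itg (tst_molln n)).
    rewrite -(int_molln n) -(int_refl x (tst_itg (tst_molln n))).
    apply: (int_norm_le (conv_itg mG L0 ler01 GL GB x (tst_molln n)) i) => y.
     rewrite normrM [X in _ * X]ger0_norm ?molln_ge0//.
    by rewrite ler_piMl ?molln_ge0.
  have supp n x : L + 1 < `|x| -> th n x = 0.
    move=> xL; rewrite /th /convol -[RHS]int0; apply: eq_int => y.
    have [yL|/GL->] := leP `|y| L; last by rewrite mul0r.
    have [->|/molln_out/andP[h1 h2]] := eqVneq (molln n (x - y)) 0; first by rewrite mulr0.
    have n1 : n.+1%:R^-1 <= 1 :> R by rewrite invf_le1// ler1n.
    have := ler_normD (x - y) y; rewrite subrK (gtr0_norm h1) => h3.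
    by exfalso; have h4 := lt_le_trans h2 n1; lra.
  (* The mollifier lives on []0, 1/(n+1)[], so only points [y] just to the left of [x] count. The
     limit is thus the left limit of [G], at every [x], and the half-open interval is the one met in
     the differentiation theorem. *)
  have lim x : th n x @[n --> \oo] --> ((a < x <= b)%R%:R : R).
    have eq0 n : (forall y, molln n (x - y) != 0 -> G y = 0) -> th n x = 0.
      move=> h; rewrite /th /convol -[RHS]int0; apply: eq_int => y.
      by have [->|/h->] := eqVneq (molln n (x - y)) 0; rewrite ?mulr0 ?mul0r.
    have eq1 n : (forall y, molln n (x - y) != 0 -> G y = 1) -> th n x = 1.
      move=> h; rewrite -(int_molln n) -(int_refl x (tst_itg (tst_molln n))).
      by apply: eq_int => y; have [->|/h->] := eqVneq (molln n (x - y)) 0; rewrite ?mulr0 ?mul1r.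
    have small e : 0 < e -> \forall n \near \oo, n.+1%:R^-1 < e :> R.
      move=> e0; have := @cvg_harmonic R; move/cvgrPdist_lt => /(_ _ e0); apply: filterS => n.
      by rewrite /= sub0r normrN ger0_norm// invr_ge0.
    apply: (@cvg_trans _ ((a < x <= b)%R%:R @[n --> \oo])); last exact: cvg_cst.
    apply: near_eq_cvg; have [xa|ax] := leP x a.
      rewrite /=; apply: nearW => n; apply/esym/eq0 => y /molln_out/andP[h1 h2].
      have ya : y < a by lra.
      by rewrite /G (lt_geF ya).
    have [xb|bx] := leP x b.
      have := small (x - a); rewrite subr_gt0 => /(_ ax); apply: filterS => n h.
      apply/esym/eq1 => y /molln_out/andP[h1 h2].
      have h3 := lt_trans h2 h.
      have ay : a <= y by lra.
      have yb : y <= b by lra.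
      by rewrite /G ay yb.
    have := small (x - b); rewrite subr_gt0 => /(_ bx); apply: filterS => n h.
    apply/esym/eq0 => y /molln_out/andP[h1 h2].
    have h3 := lt_trans h2 h.
    have yb : b < y by lra.
    by rewrite /G (lt_geF yb) andbF.
  have mI : measurable_fun [set: R] (fun t : R => (a < t <= b)%R%:R : R).
    apply: measurable_natb; apply: measurable_and.
      exact: measurable_fun_ltr.
    exact: measurable_fun_ler.
  have C := @int_dominated R (fun n x => f x * th n x) (fun x => f x * (a < x <= b)%R%:R)
    (fun x => `|f x * ind (L + 1) x|).
  have {}C : \int[mu]_x (f x * th n x) @[n --> \oo] --> \int[mu]_x (f x * (a < x <= b)%R%:R).
    apply: C.
    - by move=> n; apply: measurable_funM => //; exact: tst_measurable.
    - exact: measurable_funM.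
    - exact: itg_norm (lf' _).
    - by move=> x; apply: cvgMr; exact: lim.
    - move=> n x; rewrite !normrM ler_wpM2l//.
      rewrite [X in _ <= X]ger0_norm ?ind_ge0// /ind.
      by have [_|/supp->] := leP `|x| (L + 1); [exact: b1|rewrite normr0].
  have C0 : \int[mu]_x (f x * th n x) @[n --> \oo] --> (0 : R).
    rewrite (_ : (fun n => _) = fun=> 0); first exact: cvg_cst.
    by apply/funext => n; exact: (af (th n) (tth n)).
  exact: (cvg_unique _ C C0).
have := lebesgue_differentiation (loc_locally_integrable lf).
apply: ae_mono => x lx.
have xx : x < x + 1 by rewrite ltrDl.
have itv (c d : R) : mu.-integrable `]c, d] (EFin \o f).
  pose L := `|c| + `|d|.
  have := itg_restrict (measurable_itv `]c, d]) (lf' L).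
  apply: eq_integrable => // y; rewrite inE/= in_itv/= => /andP[cy yd].
  rewrite /ind (_ : `|y| <= L) ?mulr1//.
  rewrite /L ler_norml; have := ler_norm d; have := ler_norm (- c); rewrite normrN.
  have := normr_ge0 c; have := normr_ge0 d; lra.
have ax : ((x - 1)%:E < x%:E)%E by rewrite lte_fin ltrBlDr ltrDl.
have [_ <-] := @FTC1_lebesgue_pt R f (BRight (x - 1)) x (x + 1) xx (itv _ _) ax lx.
rewrite (_ : (fun _ => _) = fun=> 0); first by rewrite derive1_cst.
apply/funext => y; have [xy|yx] := leP (x - 1) y.
  rewrite -(key _ _ xy) Rintegral_mkcond; apply: eq_int => t; rewrite patchE.
  case: ifPn => [/set_mem /=|/negP h].
    by rewrite in_itv/= => ->; rewrite mulr1.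
  rewrite (_ : x - 1 < t <= y = false) ?mulr0//; apply/negP => h'; apply: h.
  by rewrite inE/= in_itv.
by rewrite set_itv_ge ?Rintegral_set0// bnd_simp -leNgt ltW.
Qed.

Lemma ann4_cubic f : loc f -> ann 4 f -> exists c0 c1 c2 c3 : R,
  {ae mu, forall x, f x = c0 + c1 * x + c2 * x ^+ 2 + c3 * x ^+ 3}.
Proof.
move=> l4 a4.
have lX c n : loc (fun x : R => c * x ^+ n).
  by apply: loc_continuous => x; apply: cvgMr; exact: exprn_continuous.
have [c3 a3] := ann_step l4 a4; have l3 := locB l4 (lX c3 3%N).
have [c2 a2] := ann_step l3 a3; have l2 := locB l3 (lX c2 2%N).
have [c1 a1] := ann_step l2 a2; have l1 := locB l2 (lX c1 1%N).
have [c0 a0] := ann_step l1 a1; have l0 := locB l1 (lX c0 0%N).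
exists c0, c1, c2, c3; apply: ae_mono (ann0_ae l0 a0) => x.
rewrite expr0 expr1 mulr1 => /eqP; rewrite !subr_eq add0r => /eqP ->; ring.
Qed.

End du_bois_reymond.

(** * From a cubic to an affine function *)

Section liouville.
Context {R : realType}.
Variable p : R.
Hypothesis hp : 0 < p < 1.
Notation mu := (@lebesgue_measure R).

Let p0 : 0 < p. Proof. by case/andP: hp. Qed.

Let p1 : p < 1. Proof. by case/andP: hp. Qed.

(** On []r, 2 r[] one has [1 + |t| <= 4 r], so the integral there is at least a constant times
    [r^(1-p)], which is unbounded since [p < 1]. *)
Lemma not_itg (g : R -> R) k : 0 < k ->
  (forall x, 1 <= x -> k * (1 + `|x|) `^ (- p) <= `|g x|) -> ~ itg g.
Proof.
move=> k0 hg ig; have p0' := p0; have p1' := p1.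
pose I := \int[mu]_x `|g x|.
have I0 : 0 <= I by apply: int_ge0.
have H r : 1 <= r -> k * 4 `^ (- p) <= I * r `^ (- (1 - p)).
  move=> r1; have r0 : 0 < r by lra.
  have r2 : r < 2 * r by lra.
  have [i1 e1] := int_pow_near ltr01 r2.
  have h : k * (4 * r) `^ (- p) * \int[mu]_t ((r < t < 2 * r)%R%:R * (1 * (t - r) `^ (1 - 1))) <= I.
    rewrite -intZ//; apply: int_le; [exact: itgZ|exact: itg_norm|] => t.
    rewrite subrr powRr0 !mulr1; have [/andP[t1 t2]|_] := boolP (r < t < 2 * r); last by rewrite mulr0.
    rewrite mulr1; apply: le_trans (hg t _); last by lra.
    rewrite ler_pM2l//; apply: powR_anti; [lra|by rewrite ltr_pwDl|].
    by rewrite gtr0_norm; lra.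
  rewrite e1 (_ : 2 * r - r = r) in h; last by ring.
  rewrite powRr1 ?(ltW r0)// powRM ?(ltW r0)// in h.
  have E : r `^ (- p) * r = (r `^ (- (1 - p)))^-1.
    rewrite -powRN opprK -[X in _ * X](powRr1 (ltW r0)) -powRD; last by apply/implyP => _; rewrite gt_eqF.
    by congr (_ `^ _); ring.
  rewrite mulrA -mulrA E in h.
  by move: h; rewrite ler_pdivrMr ?powR_gt0.
have X0 : 0 <= k * 4 `^ (- p) by rewrite mulr_ge0 ?powR_ge0 ?ltW.
have b0 : 0 < 1 - p by lra.
have := small_powR b0 X0 I0 H; apply/eqP; rewrite gt_eqF// mulr_gt0// powR_gt0//.
Qed.

Notation W x := ((1 + `|x|) `^ (- (2 + p))).

(** Reflection separates the even from the odd part, and the terms of degree at most one are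
    integrable against the weight. What remains, [x^2] or [x^3] times the weight, decays no faster
    than [|x|^(-p)]. *)
Lemma poly_weight_affine (c0 c1 c2 c3 : R) :
  itg (fun x => (c0 + c1 * x + c2 * x ^+ 2 + c3 * x ^+ 3) * W x) -> c2 = 0 /\ c3 = 0.
Proof.
move=> iP; have iN := itg_refl 0 iP; have p0' := p0.
have iW : itg (fun x : R => W x) by apply: itg_wt; lra.
have mW := itg_meas iW.
have i1 : itg (fun x : R => x * W x).
  have p2 : 1 < 1 + p by lra.
  apply: (itg_le _ (itg_wt p2)).
    exact: measurable_funM.
  move=> x; rewrite normrM [X in _ * X]ger0_norm ?powR_ge0//.
  rewrite (_ : - (1 + p) = 1 + - (2 + p)); last by ring.
  rewrite -wt_mul ler_wpM2r ?powR_ge0// powRr1 ?addr_ge0// lerDr//.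
have lowW (x : R) : 1 <= x -> 4^-1 * (1 + `|x|) `^ (- p) <= x ^+ 2 * W x.
  move=> x1; rewrite (_ : - p = 2%:R + - (2 + p)); last by ring.
  rewrite -wt_mul mulrA ler_wpM2r ?powR_ge0// powR_mulrn ?addr_ge0// ger0_norm; nra.
have e2 : itg (fun x => c2 * (x ^+ 2 * W x)).
  apply: (eq_itg _ (itgZ (1/2) (itgB (itgD iP iN) (itgZ (2 * c0) iW)))) => x.
  by rewrite !sub0r normrN; field.
have e3 : itg (fun x => c3 * (x ^+ 3 * W x)).
  apply: (eq_itg _ (itgZ (1/2) (itgB (itgB iP iN) (itgZ (2 * c1) i1)))) => x.
  by rewrite !sub0r normrN; field.
split; apply/eqP; apply: contraPT isT => cn0 _.
  apply: (not_itg (k := `|c2| * 4^-1) _ _ e2); first by rewrite mulr_gt0 ?normr_gt0.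
  move=> x x1; rewrite normrM -mulrA ler_wpM2l// (le_trans (lowW x x1))//.
  exact: ler_norm.
apply: (not_itg (k := `|c3| * 4^-1) _ _ e3); first by rewrite mulr_gt0 ?normr_gt0.
move=> x x1; rewrite normrM -mulrA ler_wpM2l// (le_trans (lowW x x1))//.
apply: le_trans (ler_norm _); rewrite ler_wpM2r ?powR_ge0//.
by rewrite ler_weXn2l.
Qed.

Theorem liouville (f : R -> R) : loc f -> itg (fun x => f x * W x) ->
  (forall phi, tst phi -> \int[mu]_x (f x * fl p phi x) = 0) ->
  exists c0 c1 : R, {ae mu, forall x, f x = c0 + c1 * x}.
Proof.
move=> lf fw hf; have [mf _] := lf.
have a4 : ann 4 f by move=> th tt; exact: liouville4 hf tt.
have [c0 [c1 [c2 [c3 fP]]]] := ann4_cubic lf a4.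
have iP : itg (fun x => (c0 + c1 * x + c2 * x ^+ 2 + c3 * x ^+ 3) * W x).
  apply: itg_ae fw; last by apply: ae_mono fP => x ->.
  apply: measurable_funM; last exact: measurable_wt.
  apply: continuous_measurable_fun => x.
  apply: cvgD; first apply: cvgD; first apply: cvgD.
  - exact: cvg_cst.
  - by apply: cvgMr; exact: cvg_id.
  - by apply: cvgMr; exact: exprn_continuous.
  - by apply: cvgMr; exact: exprn_continuous.
have [c20 c30] := poly_weight_affine iP.
by exists c0, c1; apply: ae_mono fP => x ->; rewrite c20 c30 !mul0r !addr0.
Qed.

End liouville.

(** * Principal values and constants *)

Section frac_lap_fl.
Context {R : realType}.

Lemma powR_mono (a x y : R) : 0 <= a -> 0 <= x -> x <= y -> x `^ a <= y `^ a.
Proof. by move=> a0 x0 xy; apply: ge0_ler_powR; rewrite ?nnegrE// (le_trans x0). Qed.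

Variable p : R.
Hypothesis hp : 0 < p < 1.
Notation mu := (@lebesgue_measure R).
Implicit Types phi : R -> R.

Let p0 : 0 < p. Proof. by case/andP: hp. Qed.

Let p1 : p < 1. Proof. by case/andP: hp. Qed.

Lemma itg_far (e : R) : 0 < e -> itg (fun h => (e < `|h|)%R%:R * `|h| `^ (- (2 + p))).
Proof.
move=> e0; have p0' := p0; have i : 1 < 2 + p by lra.
apply: (itg_le _ (itgZ ((1 + e^-1) `^ (2 + p)) (itg_wt i))).
  apply: measurable_funM; last exact: measurable_normc.
  by apply: measurable_natb; apply: measurable_fun_ltr => //; exact: normr_measurable.
have ei : 0 < e^-1 by rewrite invr_gt0.
move=> h; have [eh|_] := ltP e `|h|; last by rewrite mul0r normr0 mulr_ge0 ?powR_ge0.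
rewrite mul1r ger0_norm ?powR_ge0//.
have h0 := lt_trans e0 eh.
have E : `|h| `^ (- (2 + p)) = (1 + e^-1) `^ (2 + p) * ((1 + e^-1) * `|h|) `^ (- (2 + p)).
  have k0 : 0 < 1 + e^-1 by rewrite addr_gt0.
  rewrite (powRM _ (ltW k0) (ltW h0)) mulrA (powRN (1 + e^-1)) mulfV ?mul1r//.
  by rewrite gt_eqF// powR_gt0.
rewrite E ler_wpM2l ?powR_ge0//; apply: powR_anti; [lra|by rewrite ltr_pwDl|].
rewrite mulrDl mul1r addrC lerD2l mulrC ler_pdivlMr// mul1r; exact: ltW.
Qed.

Lemma truncated_dd phi (x e : R) : tst phi -> 0 < e ->
  \int[mu]_(y in [set y | e < `|x - y|]) ((phi x - phi y) / `|x - y| `^ (2 + p)) =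
  2^-1 * \int[mu]_h ((e < `|h|)%R%:R * (dd phi x h * `|h| `^ (- (2 + p)))).
Proof.
move=> tp e0; have [B B0 hB] := tst_bound tp.
pose g h := (phi x - phi (x + h)) * ((e < `|h|)%R%:R * `|h| `^ (- (2 + p))).
have ig : itg g.
  apply: itgMl (itg_far e0).
    apply: measurable_funB => //; apply: (measurableT_comp (tst_measurable tp)).
    exact: measurable_funD.
  move=> h; apply: le_trans (ler_normB _ _) _; exact: lerD (hB _) (hB _).
have E : \int[mu]_(y in [set y | e < `|x - y|]) ((phi x - phi y) / `|x - y| `^ (2 + p)) = \int[mu]_h g h.
  rewrite Rintegral_mkcond -(int_shift (- x) ig); apply: eq_int => y.
  rewrite /g patchE (_ : x + (y + - x) = y); last by ring.
  rewrite (distrC y x).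
  have -> : (y \in [set y | e < `|x - y|]) = (e < `|x - y|) by apply/idP/idP; rewrite inE.
  by case: ifP => _; rewrite ?mul0r ?mulr0// mul1r powRN.
rewrite E; have E2 := int_refl 0 ig; have i2 := itg_refl 0 ig.
(* Averaging with the reflected integral turns the first difference into half a second
   difference. *)
have -> : \int[mu]_h g h = 2^-1 * (\int[mu]_h g h + \int[mu]_h g (0 - h)).
  by rewrite E2; move: (Rintegral _ _ _) => v; field.
congr (_ * _); rewrite -(intD ig i2); apply: eq_int => h.
by rewrite /g /dd sub0r normrN; ring.
Qed.

Lemma truncated_error phi x : tst phi -> exists2 M, 0 <= M & forall e : R, 0 < e -> e <= 1 ->
  `|\int[mu]_h ((e < `|h|)%R%:R * (dd phi x h * `|h| `^ (- (2 + p)))) - fl p phi x| <=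
  M * e `^ ((1 - p) / 2).
Proof.
move=> tp; have p0' := p0; have p1' := p1.
have [B B0 hB] := tst_bound (tst_derive (tst_derive tp)).
(* Split [|h|^(-p)] as [|h|^((1-p)/2) * |h|^(-r)]: the second factor is still integrable at [0]
   because [r < 1], and the first is at most [e^((1-p)/2)] for [|h| <= e]. *)
pose r := (1 + p) / 2; have hr : 0 < r < 1 by apply/andP; split; rewrite /r; lra.
have ir := itg_normpow hr.
pose I := \int[mu]_h ((`|h| <= 1)%R%:R * `|h| `^ (- r)).
have I0 : 0 <= I by apply: int_ge0 => h; rewrite mulr_ge0 ?powR_ge0 ?ler0n.
exists (2 * B * I); first by rewrite !mulr_ge0.
move=> e e0 e1; have ifl := fl_itg hp x tp.
have me : measurable_fun [set: R] (fun h : R => (e < `|h|)%R%:R : R).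
  by apply: measurable_natb; apply: measurable_fun_ltr => //; exact: normr_measurable.
have ie : itg (fun h => (e < `|h|)%R%:R * (dd phi x h * `|h| `^ (- (2 + p)))).
  by apply: (itgMl (C := 1) me _ ifl) => h; case: (_ < _); rewrite ?normr1 ?normr0.
rewrite -(intB ie ifl) (_ : 2 * B * I * e `^ ((1 - p) / 2) = (2 * B * e `^ ((1 - p) / 2)) * I); last by ring.
rewrite -(intZ _ ir); apply: int_norm_le; [exact: itgB|exact: itgZ|move=> h].
have [eh|he] := ltP e `|h|.
  by rewrite mul1r subrr normr0 !mulr_ge0 ?powR_ge0 ?ler0n.
rewrite mul0r sub0r normrN normrM [X in _ * X]ger0_norm ?powR_ge0//.
have h1 := le_trans he e1; rewrite h1 mul1r.
apply: le_trans (ler_wpM2r (powR_ge0 _ _) (dd_le x h tp hB)) _.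
rewrite -!mulrA; apply: ler_wpM2l => //; apply: ler_wpM2l => //; rewrite mulrA -expr2.
apply: le_trans (normpow_le1 _ h1) _.
have [->|h0] := eqVneq h 0.
  by rewrite normr0 powR0 ?oppr_eq0 ?gt_eqF// mulr_ge0 ?powR_ge0.
have nh0 : 0 < `|h| by rewrite normr_gt0.
have -> : `|h| `^ (- p) = `|h| `^ ((1 - p) / 2) * `|h| `^ (- r).
  rewrite -powRD; last by apply/implyP => _; rewrite gt_eqF.
  by congr (_ `^ _); rewrite /r; field.
rewrite ler_wpM2r ?powR_ge0//; apply: powR_mono => //; lra.
Qed.

Lemma principal_value phi x : tst phi ->
  (\int[mu]_(y in [set y | e < `|x - y|]) ((phi x - phi y) / `|x - y| `^ (2 + p)))
    @[e --> 0^'+] --> 2^-1 * fl p phi x.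
Proof.
move=> tp; have [M M0 H] := truncated_error x tp; have p1' := p1.
have a0 : 0 < (1 - p) / 2 by lra.
apply/cvgrPdist_le => e e0.
have C : M * `|t| `^ ((1 - p) / 2) @[t --> (0 : R)] --> M * 0.
  apply: cvgMr; have := @continuous_normpowR R _ a0 0.
  by rewrite /continuous_at normr0 powR0// gt_eqF.
have := cvg_at_right_filter C; rewrite mulr0 => /cvgrPdist_le/(_ _ e0) C'.
near=> t.
have t0 : 0 < t by near: t; exact: nbhs_right_gt.
have t1 : t <= 1 by near: t; exact: nbhs_right_le.
rewrite truncated_dd// -mulrBr normrM ger0_norm ?invr_ge0// distrC.
have h := H t t0 t1.
have h2 : M * t `^ ((1 - p) / 2) <= e.
  rewrite -[t](gtr0_norm t0) -[X in X <= _]ger0_norm ?mulr_ge0 ?powR_ge0//.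
  by rewrite -normrN -sub0r; near: t; exact: C'.
have h3 := le_trans h h2; have := normr_ge0 (\int[mu]_h ((t < `|h|)%R%:R * (dd phi x h * `|h| `^ (- (2 + p)))) - fl p phi x).
move: h3; set v := `|_ - _| => h3 v0; lra.
Unshelve. all: by end_near. Qed.

End frac_lap_fl.

(** * Positivity of the normalising constant *)

Section constants.
Context {R : realType}.
Notation mu := (@lebesgue_measure R).

(** Integrability comes first, since a divergent integral would have the default value [0];
    positivity then follows from a lower bound on []1, 2[]. *)
Lemma gamma_int_gt0 (x : R) : 0 < x < 2 -> x != 1 -> 0 < gamma_int x.
Proof.
move=> /andP[x0 x2] x1; pose f (t : R) : R := (0 < t)%R%:R * (t `^ (x - 1) * expR (- t)).
have ipow : itg (fun t : R => (0 < t <= 1)%R%:R * t `^ (x - 1)).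
  have [xl1|xg1] := ltP x 1.
    have h : 0 < 1 - x < 1 by apply/andP; split; lra.
    apply: (itg_le _ (itg_normpow h)).
      apply: measurable_funM; last exact: measurable_powR.
      apply: measurable_natb; apply: measurable_and; [exact: measurable_fun_ltr|exact: measurable_fun_ler].
    move=> t; rewrite (_ : - (1 - x) = x - 1); last by ring.
    have [/andP[t0 t1]|_] := boolP (0 < t <= 1); last by rewrite mul0r normr0 mulr_ge0 ?powR_ge0 ?ler0n.
    by rewrite (gtr0_norm t0) t1 !mul1r ger0_norm// powR_ge0.
  have xg0 : 0 <= x - 1 by lra.
  apply: (itg_le _ (itg_ind 1)).
    apply: measurable_funM; last exact: measurable_powR.
    apply: measurable_natb; apply: measurable_and; [exact: measurable_fun_ltr|exact: measurable_fun_ler].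
  move=> t; have [/andP[t0 t1]|_] := boolP (0 < t <= 1); last by rewrite mul0r normr0 ind_ge0.
  rewrite /ind (gtr0_norm t0) t1 mul1r ger0_norm ?powR_ge0//.
  by have := powR_mono xg0 (ltW t0) t1; rewrite powR1.
have i2 : (1 : R) < 2 by lra.
have mf : measurable_fun [set: R] f.
  apply: measurable_funM; first by apply: measurable_natb; exact: measurable_fun_ltr.
  apply: measurable_funM; first exact: measurable_powR.
  by apply: (measurableT_comp (@measurable_expR R)).
(* From the fourth power of [exp(t/4) >= (1 + t)/4]. *)
pose c : R := 4 ^+ 4; have c0 : 0 < c by rewrite exprn_gt0.
have if' : itg f.
  apply: (itg_le mf (itgD ipow (itgZ c (itg_wt i2)))) => t.
  have A0 : 0 <= c * (1 + `|t|) `^ (-2) := mulr_ge0 (ltW c0) (powR_ge0 _ _).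
  have B0 : 0 <= (0 < t <= 1)%R%:R * t `^ (x - 1) by rewrite mulr_ge0 ?powR_ge0 ?ler0n.
  rewrite /f; have [t0|_] := ltP 0 t; last by rewrite mul0r normr0 addr_ge0// mul0r.
  rewrite mul1r ger0_norm ?mulr_ge0 ?powR_ge0 ?expR_ge0//.
  have [t1|t1] := leP t 1.
    rewrite mul1r -[X in X <= _]addr0 lerD// ler_piMr ?powR_ge0// -[X in _ <= X]expR0 ler_expR; lra.
  rewrite mul0r add0r (gtr0_norm t0).
  have tx : t `^ (x - 1) <= 1 + t.
    apply: (@le_trans _ _ (t `^ 1)); last by rewrite powRr1; lra.
    by apply: ler_powR; lra.
  have T4 : 0 < (1 + t) ^+ 4 by rewrite exprn_gt0; lra.
  have et : expR (- t) <= c * ((1 + t) ^+ 4)^-1.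
    have cT : 0 < c * ((1 + t) ^+ 4)^-1 by rewrite mulr_gt0// invr_gt0.
    rewrite expRN -lef_pV2 ?posrE ?invr_gt0 ?expR_gt0//.
    rewrite invrK invfM invrK.
    have tE : t = 4%:R * (t / 4) by field.
    move: (t / 4) tE t1 => v tE t1; rewrite {2}tE expRM_natl.
    have -> : c^-1 * (1 + t) ^+ 4 = ((1 + t) / 4) ^+ 4 by rewrite /c -exprVn -exprMn mulrC.
    apply: lerXn2r; rewrite ?nnegrE ?expR_ge0; [lra|by []|].
    apply: le_trans (expR_ge1Dx _); lra.
  apply: le_trans (ler_pM (powR_ge0 _ _) (expR_ge0 _) tx et) _.
  rewrite powRN powR_mulrn; last by lra.
  rewrite mulrCA; apply: (ler_wpM2l (ltW c0)); rewrite ler_pdivrMr//.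
  have t2 : (1 + t) ^+ 2 != 0 by rewrite expf_neq0//; apply/eqP; lra.
  rewrite (_ : (1 + t) ^+ 4 = (1 + t) ^+ 2 * (1 + t) ^+ 2) ?mulKf//; last by ring.
  by have := t0; nra.
have -> : gamma_int x = \int[mu]_t f t.
  rewrite /gamma_int Rintegral_mkcond; apply: eq_int => t; rewrite patchE /f.
  have -> : (t \in `]0, +oo[%classic) = (0 < t) by rewrite mem_setE in_itv/= andbT.
  by case: ifP; rewrite ?mul1r ?mul0r.
have l12 : (1 : R) < 2 by lra.
have [i1 e1] := int_pow_near ltr01 l12.
(* On []1, 2[] the integrand is at least [t^(-1) exp(-2)], as [x - 1 >= -1]. *)
pose k := 2^-1 * expR (- 2) : R.
have k0 : 0 < k by rewrite mulr_gt0 ?invr_gt0 ?expR_gt0.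
apply: (@lt_le_trans _ _ (k * \int[mu]_t ((1 < t < 2)%R%:R * (1 * (t - 1) `^ (1 - 1))))).
  by rewrite e1 mulr_gt0// powR_gt0; lra.
rewrite -intZ//; apply: int_le; [exact: itgZ|exact: if'|move=> t].
have f0 : 0 <= f t by rewrite !mulr_ge0 ?powR_ge0 ?ler0n ?expR_ge0.
have [/andP[t1 t2]|_] := boolP (1 < t < 2); last by rewrite mul0r mulr0.
rewrite subrr powRr0 !mulr1 /f (lt_trans ltr01 t1) mul1r.
apply: ler_pM; [by rewrite invr_ge0|exact: expR_ge0| |rewrite ler_expR; lra].
apply: (@le_trans _ _ (t `^ (- 1))); last by apply: ler_powR; lra.
by rewrite powR_inv1; [rewrite lef_pV2 ?posrE; lra|lra].
Qed.

Lemma frac_const_gt0 (s : R) : 2^-1 < s < 1 -> 0 < frac_const s.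
Proof.
move=> /andP[s0 s1].
have G1 : 0 < Gamma (2^-1 + s).
  rewrite /Gamma; have -> : 0 < 2^-1 + s by lra.
  by apply: gamma_int_gt0; [apply/andP; split; lra|apply/eqP; lra].
(* Hence one step of the recursion: [Gamma (- s)] is [gamma_int (1 - s) / (- s)]. *)
have fs : Num.floor (- s) = (- 1)%Z.
  apply: floor_def; have -> : (-1 + 1)%R = 0%Z by [].
  by rewrite mulrN1z mulr0z; apply/andP; split; lra.
have G2 : 0 < gamma_int (- s + 1).
  by apply: gamma_int_gt0; [apply/andP; split; lra|apply/eqP; lra].
have ns : (0 < - s) = false by apply/negbTE; rewrite -leNgt; lra.
have Gs : 0 < `|Gamma (- s)|.
  rewrite /Gamma ns fs /= big_ord1 addr0 normr_gt0 mulf_neq0 ?(gt_eqF G2)//.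
  by rewrite invr_eq0 oppr_eq0; apply/eqP; lra.
by rewrite /frac_const mulr_gt0 ?divr_gt0 ?powR_gt0 ?sqrtr_gt0 ?pi_gt0.
Qed.

End constants.

(** * The weak formulation in terms of [fl] *)

Section weak_form.
Context {R : realType}.
Variable s : R.
Hypothesis hs : 2^-1 < s < 1.
Notation mu := (@lebesgue_measure R).
Notation p := (2 * s - 1).

Lemma order_range : 0 < p < 1.
Proof. by case/andP: hs => s0 s1; apply/andP; split; lra. Qed.

Lemma frac_lapE phi x : tst phi -> frac_lap s phi x = frac_const s / 2 * fl p phi x.
Proof.
move=> tp; rewrite /frac_lap -mulrA; congr (_ * _).
have := principal_value order_range (x := x) tp.
rewrite (_ : 2 + p = 1 + 2 * s); last by ring.
by move/cvg_lim; apply; exact: Rhausdorff.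
Qed.

(** [frac_lap_weak] compares extended integrals; integrability of both integrands turns this into an
    equation between reals, in which the constant can be taken out. *)
Lemma weak_form (f h : R -> R) :
  (forall phi, tst phi -> itg (fun x => f x * fl p phi x)) ->
  (forall phi, tst phi -> itg (fun x => h x * phi x)) ->
  frac_lap_weak s f h <-> forall phi, tst phi ->
    frac_const s / 2 * \int[mu]_x (f x * fl p phi x) = \int[mu]_x (h x * phi x).
Proof.
move=> i1 i2; have E phi : tst phi ->
    (\int[mu]_x (f x * frac_lap s phi x)%:E = (frac_const s / 2 * \int[mu]_x (f x * fl p phi x))%:E)%E.
  move=> tp; rewrite -(intZ _ (i1 _ tp)) -(intE (itgZ _ (i1 _ tp))).
  by apply: eq_integral => x _; rewrite frac_lapE// mulrCA.
split => H phi.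
  move=> tp; have := H phi (proj2 (test_functionP _) tp).
  by rewrite E// (intE (i2 _ tp)) => -[].
by move=> /test_functionP tp; rewrite E// (intE (i2 _ tp)) H.
Qed.

Notation W x := ((1 + `|x|) `^ (- (2 + p))).

Lemma weighted_loc (f : R -> R) : measurable_fun [set: R] f -> itg (fun x => f x * W x) -> loc f.
Proof.
move=> mf iw; have [p0 p1] := andP order_range.
split=> // L; apply: (itg_le _ (itgZ ((1 + `|L|) `^ (2 + p)) (itg_norm iw))).
  by apply: measurable_funM => //; exact: measurable_ind.
move=> x; rewrite !normrM mulrCA ler_wpM2l//.
rewrite [X in X <= _]ger0_norm ?ind_ge0// [X in _ * X]ger0_norm ?powR_ge0// /ind.
have [xL|_] := leP `|x| L; last by rewrite mulr_ge0 ?powR_ge0.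
rewrite powRN ler_pdivlMr ?mul1r ?powR_gt0 ?ltr_pwDl//.
apply: powR_mono; [lra|exact: addr_ge0|rewrite lerD2l].
exact: le_trans (ler_norm _).
Qed.

(** The two weights are comparable because [2 + p = 1 + 2 s], and local integrability is contained
    in weighted integrability ([weighted_loc]). *)
Lemma L_spaceP (f : R -> R) :
  L_space s f <-> measurable_fun [set: R] f /\ itg (fun x => f x * W x).
Proof.
have [p0 p1] := andP order_range; have q0 : 0 <= 1 + 2 * s by lra.
have qE : - (2 + p) = - (1 + 2 * s) by ring.
have w1 (x : R) : W x <= 2 * (1 + `|x| `^ (1 + 2 * s))^-1.
  rewrite qE powRN ler_pdivlMr ?ltr_pwDl ?powR_ge0// ler_pdivrMl ?powR_gt0 ?ltr_pwDl//.
  have h1 : 1 <= (1 + `|x|) `^ (1 + 2 * s).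
    by rewrite -[X in X <= _](powRr0 (1 + `|x|)); exact: wt_le.
  have h2 : `|x| `^ (1 + 2 * s) <= (1 + `|x|) `^ (1 + 2 * s).
    by apply: powR_mono; rewrite // lerDr.
  by rewrite mulr_natr mulr2n; exact: lerD h1 h2.
have w2 (x : R) : (1 + `|x| `^ (1 + 2 * s))^-1 <= 2 `^ (1 + 2 * s) * W x.
  rewrite qE powRN ler_pdivlMr ?powR_gt0 ?ltr_pwDl// ler_pdivrMl ?ltr_pwDl ?powR_ge0//.
  have [x1|x1] := leP `|x| 1.
    apply: (@le_trans _ _ (2 `^ (1 + 2 * s))).
      by apply: powR_mono; rewrite ?addr_ge0//; lra.
    by rewrite ler_peMl ?powR_ge0// lerDl powR_ge0.
  apply: (@le_trans _ _ ((2 * `|x|) `^ (1 + 2 * s))).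
    by apply: powR_mono; rewrite ?addr_ge0//; lra.
  by rewrite powRM// mulrC ler_wpM2r ?powR_ge0// lerDr.
have mw : measurable_fun [set: R] (fun x : R => (1 + `|x| `^ (1 + 2 * s))^-1).
  rewrite (_ : (fun _ => _) = fun x : R => (1 + `|x| `^ (1 + 2 * s)) `^ (- 1)).
    by apply/measurable_powc/measurable_funD => //; exact: measurable_normc.
  by apply/funext => x; rewrite powR_inv1// addr_ge0// powR_ge0.
split=> [[[mf _ _] fin]|[mf iw]].
  split=> //; have i : itg (fun x => f x * (1 + `|x| `^ (1 + 2 * s))^-1).
    apply: itgI; first exact: measurable_funM.
    apply: le_lt_trans fin; rewrite le_eqVlt; apply/orP; left; apply/eqP.
    apply: eq_integral => x _; rewrite normrM [X in _ * X]ger0_norm// invr_ge0 addr_ge0// powR_ge0.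
  apply: (itg_le _ (itgZ 2 (itg_norm i))).
    by apply: measurable_funM => //; exact: measurable_wt.
  move=> x; rewrite !normrM mulrCA ler_wpM2l//.
  rewrite ger0_norm ?powR_ge0// ger0_norm ?invr_ge0 ?addr_ge0 ?powR_ge0//.
have lf : loc f by exact: weighted_loc.
split; first exact: loc_locally_integrable.
have := itg_fin (itgZ (2 `^ (1 + 2 * s)) iw); apply: le_lt_trans.
apply: ge0_le_integral => //.
- by apply/measurable_EFinP; apply: measurable_funM => //; exact: measurableT_comp.
- apply/measurable_EFinP; apply: measurableT_comp => //; apply: measurable_funM => //.
  exact: (itg_meas iw).
- move=> x _; rewrite lee_fin !normrM mulrCA ler_wpM2l//.
  by rewrite ger0_norm ?powR_ge0// ger0_norm ?powR_ge0.
Qed.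

Lemma L_space_fl f phi : L_space s f -> tst phi -> itg (fun x => f x * fl p phi x).
Proof.
move=> Lf tp; have [mf iw] := proj1 (L_spaceP f) Lf.
have [C C0 hC] := fl_decay order_range tp.
apply: (itg_le _ (itgZ C (itg_norm iw))).
  by apply: measurable_funM => //; exact: (fl_measurable order_range tp).
move=> x; rewrite !normrM mulrCA ler_wpM2l//.
by rewrite [X in _ <= _ * X]ger0_norm ?powR_ge0.
Qed.

End weak_form.

(** * Null sets, continuity and integrals over intervals *)

Section calculus.
Context {R : realType}.
Notation mu := (@lebesgue_measure R).
Implicit Types f g F G : R -> R.

Lemma ae_neq (a : R) : {ae mu, forall x, x != a}.
Proof.
exists [set a]; split; [exact: measurable_set1|exact: lebesgue_measure_set1|].
by move=> x /= /negP/negPn/eqP.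
Qed.

(** Intervals have positive measure. This is how almost everywhere relations between continuous
    functions are upgraded to every point. *)
Lemma ae_open_empty (U : set R) : open U -> {ae mu, forall x, ~ U x} -> forall x, ~ U x.
Proof.
move=> oU [N [mN N0 sub]] x Ux.
have [e /= e0 he] : nbhs x U by exact: open_nbhs_nbhs.
have c : (mu `](x - e)%R, (x + e)%R[%classic <= 0)%E.
  rewrite -N0; apply: le_measure; rewrite ?inE//.
  move=> y /=; rewrite in_itv/= => /andP[y1 y2]; apply: sub => /=; apply.
  by apply: he => /=; rewrite ltr_norml; lra.
move: c; rewrite lebesgue_measure_itv/= lte_fin (_ : x - e < x + e); last by lra.
by rewrite -EFinB lee_fin leNgt (_ : 0 < x + e - (x - e))//; lra.
Qed.

Lemma measurable_itv_ind (a b : R) : measurable_fun [set: R] (fun t : R => (a < t < b)%R%:R : R).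
Proof. by apply: measurable_natb; apply: measurable_and; exact: measurable_fun_ltr. Qed.

Lemma measurable_itvcc_ind (a b : R) : measurable_fun [set: R] (fun t : R => (a <= t <= b)%R%:R : R).
Proof. by apply: measurable_natb; apply: measurable_and; exact: measurable_fun_ler. Qed.

Lemma loc_itvcc f (a b : R) : loc f -> itg (fun t => (a <= t <= b)%R%:R * f t).
Proof.
move=> [mf lf]; pose L := `|a| + `|b|.
apply: (itg_le _ (itg_norm (lf L))).
  by apply: measurable_funM => //; exact: measurable_itvcc_ind.
move=> t; rewrite !normrM mulrC ler_wpM2l// [X in _ <= X]ger0_norm ?ind_ge0//.
have [/andP[ta tb]|_] := boolP (a <= t <= b); last by rewrite normr0 ind_ge0.
rewrite normr1 /ind (_ : `|t| <= L)// /L ler_norml.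
have := ler_norm b; have := ler_norm (- a); rewrite normrN.
have := normr_ge0 a; have := normr_ge0 b; lra.
Qed.

Lemma ftc_itvcc F f (a b : R) : a <= b ->
  (forall x, a <= x <= b -> is_derive x 1 F (f x)) ->
  (forall x, a <= x <= b -> {for x, continuous f}) ->
  \int[mu]_t ((a <= t <= b)%R%:R * f t) = F b - F a.
Proof.
move=> ab dF cf; rewrite -[RHS]/(fine (F b - F a)%:E) -(ftc_segment ab dF cf).
transitivity (\int[mu]_(x in `[a, b]) f x) => //.
rewrite [RHS]Rintegral_mkcond; apply: eq_int => t; rewrite patchE.
have -> : (t \in `[a, b]%classic) = (a <= t <= b) by rewrite mem_setE in_itv.
by case: ifP => _; rewrite ?mul1r ?mul0r.
Qed.

Lemma itvcc_oo_ae f (a b : R) : measurable_fun [set: R] f ->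
  \int[mu]_t ((a <= t <= b)%R%:R * f t) = \int[mu]_t ((a < t < b)%R%:R * f t).
Proof.
move=> mf; apply: int_ae.
- by apply: measurable_funM => //; exact: measurable_itvcc_ind.
- by apply: measurable_funM => //; exact: measurable_itv_ind.
apply: ae_mono (ae_and (ae_neq a) (ae_neq b)) => t [ta tb].
by rewrite !le_eqVlt (eq_sym a) (negbTE ta) (negbTE tb).
Qed.

Lemma isd_int F G : continuous G ->
  (forall a b, a < b -> F b - F a = \int[mu]_t ((a < t < b)%R%:R * G t)) ->
  forall x : R, is_derive x 1 F (G x).
Proof.
move=> cG H x; pose a := x - 1; pose u := x + 1.
have ax : a < x by rewrite /a ltrBlDr ltrDl.
have xu : x < u by rewrite /u ltrDl.
have mG := continuous_measurable_fun cG.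
have E (y : R) : \int[mu]_(t in `[a, y]) G t = \int[mu]_t ((a <= t <= y)%R%:R * G t).
  rewrite Rintegral_mkcond; apply: eq_int => t.
  rewrite patchE; have -> : (t \in `[a, y]%classic) = (a <= t <= y) by rewrite mem_setE in_itv.
  by case: ifP => _; rewrite ?mul1r ?mul0r.
have iG : mu.-integrable `[a, u] (EFin \o G).
  have := itg_restrict (measurable_itv `[a, u]) (loc_itvcc a u (loc_continuous cG)).
  apply: eq_integrable; first exact: measurable_itv.
  by move=> t; rewrite inE/= in_itv/= => ->; rewrite mul1r.
have [d1 d2] := continuous_FTC1_closed xu iG ax (cG x).
have D : is_derive x 1 (fun y => F a + \int[mu]_(t in `[a, y]) G t) (G x).
  apply: (isd_eq (isdD (isd_cst (F a) x) _)); last exact: add0r.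
  by rewrite -d2 derive1E; exact/derivableP.
apply: (isd_near _ D); near=> y.
have ay : a < y by near: y; exact: lt_nbhsr.
by rewrite E itvcc_oo_ae// -H// addrC subrK.
Unshelve. all: by end_near. Qed.

(** In contrast with [ftc_exhaustion], [f] may change sign, and integrability is assumed instead. At
    [c] only continuity of [F] is required, so [f] may be singular there. *)
Lemma ftc_tail F f (c L : R) :
  (forall x, c < x -> is_derive x 1 F (f x)) ->
  (forall x, c < x -> {for x, continuous f}) -> {for c, continuous F} ->
  F (c + n.+1%:R) @[n --> \oo] --> L -> itg (fun t => (c < t)%R%:R * f t) ->
  \int[mu]_t ((c < t)%R%:R * f t) = L - F c.
Proof.
move=> dF cf cF FL ig.
pose a (n : nat) := c + n.+1%:R^-1; pose b (n : nat) := c + n.+1%:R.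
have ac n : c < a n by rewrite /a ltrDl invr_gt0.
have ab n : a n <= b n by rewrite /a /b lerD2l (@le_trans _ _ 1)// ?invf_le1// ler1n.
have acv : a n @[n --> \oo] --> c.
  rewrite -[X in _ --> X]addr0; apply: cvgD; first exact: cvg_cst.
  exact: cvg_harmonic.
have E n : \int[mu]_t ((a n <= t <= b n)%R%:R * ((c < t)%R%:R * f t)) = F (b n) - F (a n).
  have H1 x : a n <= x <= b n -> is_derive x 1 F (f x).
    by move=> /andP[ax _]; apply: dF; exact: lt_le_trans (ac n) ax.
  have H2 x : a n <= x <= b n -> {for x, continuous f}.
    by move=> /andP[ax _]; apply: cf; exact: lt_le_trans (ac n) ax.
  rewrite -(ftc_itvcc (ab n) H1 H2).
  apply: eq_int => t; have [/andP[at_ _]|_] := boolP (a n <= t <= b n); last by rewrite !mul0r.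
  by rewrite (lt_le_trans (ac n) at_) !mul1r.
have C1 : \int[mu]_t ((a n <= t <= b n)%R%:R * ((c < t)%R%:R * f t)) @[n --> \oo] -->
    \int[mu]_t ((c < t)%R%:R * f t).
  apply: (int_dominated (g := fun t => `|(c < t)%R%:R * f t|)).
  - by move=> n; apply: measurable_funM; [exact: measurable_itvcc_ind|exact: itg_meas].
  - exact: itg_meas.
  - exact: itg_norm.
  - move=> t; have [ct|_] := ltP c t; last first.
      by rewrite mul0r; under eq_fun do rewrite mulr0; exact: cvg_cst.
    rewrite mul1r; apply: (@cvg_trans _ ((f t : R) @[n --> \oo])); last exact: cvg_cst.
    apply: near_eq_cvg.
    have h1 : \forall n \near \oo, a n < t by move/cvgr_lt: acv; exact.
    have h2 : \forall n \near \oo, t - c < n.+1%:R :> R.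
      have [N hN] : exists N : nat, t - c < N%:R.
        exists (Num.trunc (t - c)).+1; exact: truncnS_gt.
      exists N => // n /= Nn; apply: lt_trans hN _; rewrite ltr_nat ltnS//.
    near=> n; have -> : a n <= t <= b n; last by rewrite mul1r.
    apply/andP; split; first by apply/ltW; near: n.
    by rewrite /b -lerBlDl; apply/ltW; near: n.
  - move=> n t; rewrite normrM ler_piMl//; case: (_ && _); rewrite ?normr1 ?normr0//.
have C2 : F (b n) - F (a n) @[n --> \oo] --> L - F c.
  apply: cvgB; first exact: FL.
  exact: (cvg_comp _ _ acv cF).
have C3 : \int[mu]_t ((a n <= t <= b n)%R%:R * ((c < t)%R%:R * f t)) @[n --> \oo] --> L - F c.
  by under eq_fun do rewrite E.
exact: (cvg_unique _ C1 C3).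
Unshelve. all: by end_near. Qed.

End calculus.

(** * Potentials *)

Section potential.
Context {R : realType}.
Variable p : R.
Hypothesis hp : 0 < p < 1.
Notation mu := (@lebesgue_measure R).
Implicit Types h m : R -> R.

Let p0 : 0 < p. Proof. by case/andP: hp. Qed.

Let p1 : p < 1. Proof. by case/andP: hp. Qed.

(** For [0 <= t <= a + b] the ratio [t/(a + b)] is at most its [p]-th power; add the cases [t = a]
    and [t = b]. *)
Lemma powR_subadd (a b : R) : 0 <= a -> 0 <= b -> (a + b) `^ p <= a `^ p + b `^ p.
Proof.
move=> a0 b0; have p0' := p0; have p1' := p1.
have [s0|s0] := eqVneq (a + b) 0; first by rewrite s0 powR0 ?gt_eqF// addr_ge0 ?powR_ge0.
have s1 : 0 < a + b by rewrite lt_neqAle eq_sym s0 addr_ge0.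
have key t : 0 <= t -> t <= a + b -> t * (a + b) `^ p <= t `^ p * (a + b).
  move=> t0 ts; have [->|tn0] := eqVneq t 0; first by rewrite mul0r mulr_ge0 ?powR_ge0// ltW.
  have t1 : 0 < t by rewrite lt_neqAle eq_sym tn0.
  have h : 0 < t / (a + b) <= 1 by rewrite divr_gt0//= ler_pdivrMr// mul1r.
  have := ger_powR h (ltW p1'); rewrite powRr1 ?(ltW (proj1 (andP h)))//.
  have sp : 0 < (a + b) `^ p by exact: powR_gt0.
  have sV : (a + b)^-1 `^ p = ((a + b) `^ p)^-1.
    apply: (mulIf (lt0r_neq0 sp)); rewrite mulVf ?gt_eqF//.
    by rewrite -powRM ?invr_ge0 ?(ltW s1)// mulVf// powR1.
  rewrite powRM ?(ltW t1) ?invr_ge0 ?(ltW s1)// sV => H.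
  by move: H; rewrite ler_pdivrMr// mulrAC ler_pdivlMr// mulrC.
rewrite -(ler_pM2r s1) [_ * (a + b)]mulrC mulrDl mulrDl; apply: lerD; apply: key => //; lra.
Qed.

Lemma normpow_sub (x y : R) : `| `|x| `^ p - `|y| `^ p | <= `|x - y| `^ p.
Proof.
have key (a b : R) : `|a| `^ p <= `|b| `^ p + `|a - b| `^ p.
  apply: le_trans (powR_subadd (normr_ge0 _) (normr_ge0 _)).
  apply: powR_mono; [exact: ltW|by []|].
  by have := ler_normD b (a - b); rewrite addrC subrK.
rewrite ler_norml; have := key x y; have := key y x; rewrite (distrC y x).
move: (_ `^ p) (_ `^ p) (_ `^ p) => a b c; lra.
Qed.

(* Subtracting [|y|^p] makes the potential converge for every integrable [h]. *)
Definition pot h (x : R) := \int[mu]_y ((`|x - y| `^ p - `|y| `^ p) * h y).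

Lemma measurable_pot_ker (x : R) : measurable_fun [set: R] (fun y : R => `|x - y| `^ p - `|y| `^ p).
Proof.
apply: measurable_funB; last exact: measurable_normc.
by apply: measurable_powc; apply: measurableT_comp => //; exact: measurable_funB.
Qed.

Lemma pot_ker_le (x y : R) : `| `|x - y| `^ p - `|y| `^ p | <= `|x| `^ p.
Proof.
have := normpow_sub (x - y) (- y); rewrite normrN.
by rewrite (_ : x - y - - y = x)//; ring.
Qed.

Lemma pot_itg h x : itg h -> itg (fun y => (`|x - y| `^ p - `|y| `^ p) * h y).
Proof. by apply: itgMl; [exact: measurable_pot_ker|exact: pot_ker_le]. Qed.

Lemma pot_abs h x : itg h ->
  \int[mu]_y `|(`|x - y| `^ p - `|y| `^ p) * h y| <= `|x| `^ p * \int[mu]_y `|h y|.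
Proof.
move=> ih; rewrite -intZ; last exact: itg_norm.
apply: int_le; [exact/itg_norm/pot_itg|exact/itgZ/itg_norm|move=> y].
by rewrite normrM ler_wpM2r// pot_ker_le.
Qed.

Lemma pot_le h x : itg h -> `|pot h x| <= `|x| `^ p * \int[mu]_y `|h y|.
Proof. by move=> ih; apply: le_trans (pot_abs x ih); exact/int_norm/pot_itg. Qed.

Lemma pot_growth h x : itg h -> `|pot h x| <= \int[mu]_y `|h y| * (1 + `|x|) `^ p.
Proof.
move=> ih; apply: le_trans (pot_le x ih) _; rewrite mulrC ler_wpM2l ?int_ge0//.
by apply: powR_mono; [exact: ltW|by []|rewrite lerDr].
Qed.

Lemma pot_holder h x z : itg h -> `|pot h x - pot h z| <= `|x - z| `^ p * \int[mu]_y `|h y|.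
Proof.
move=> ih; have i1 := pot_itg x ih; have i2 := pot_itg z ih.
rewrite /pot -(intB i1 i2) -intZ; last exact: itg_norm.
apply: int_norm_le; [exact: itgB|exact/itgZ/itg_norm|move=> y].
rewrite -mulrBl normrM ler_wpM2r//.
have := normpow_sub (x - y) (z - y); rewrite (_ : x - y - (z - y) = x - z); last by ring.
by move=> H; rewrite (_ : _ - _ - _ = `|x - y| `^ p - `|z - y| `^ p)//; ring.
Qed.

Lemma pot_continuous h : itg h -> continuous (pot h).
Proof.
move=> ih x; apply/cvgrPdist_le => e e0.
have C : `|t| `^ p * \int[mu]_y `|h y| @[t --> (0 : R)] --> 0 * \int[mu]_y `|h y|.
  apply: cvgMl; have := @continuous_normpowR R _ p0 0.
  by rewrite /continuous_at normr0 powR0// gt_eqF.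
have C2 : `|x - z| `^ p * \int[mu]_y `|h y| @[z --> x] --> 0 * \int[mu]_y `|h y|.
  have c0 : x - z @[z --> x] --> (0 : R).
    by rewrite -(subrr x); apply: cvgB; [exact: cvg_cst|exact: cvg_id].
  exact: (cvg_comp _ _ c0 C).
have := C2; rewrite mul0r => /cvgrPdist_le/(_ _ e0); apply: filterS => z.
rewrite sub0r normrN => h1; apply: le_trans (pot_holder x z ih) _.
exact: le_trans (ler_norm _) h1.
Qed.

(** Fubini and [fundamental]. The normalising term [|y|^p] is constant in [x] and drops out since
    [fl phi] has integral zero. *)
Lemma pot_fl h phi : itg h -> tst phi ->
  \int[mu]_x (pot h x * fl p phi x) = - kap p * \int[mu]_x (h x * phi x).
Proof.
move=> ih tp; have p0' := p0; have p1' := p1.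
have [C C0 hC] := fl_decay hp tp; have mh := itg_meas ih.
have mfl := fl_measurable hp tp.
have i2 : (1 : R) < 2 by lra.
have ihp : itg (fun x => h x * phi x).
  have [B B0 hB] := tst_bound tp; have := itgMl (tst_measurable tp) hB ih.
  by apply: eq_itg => x; rewrite mulrC.
pose F x y := fl p phi x * ((`|x - y| `^ p - `|y| `^ p) * h y).
have iF : itg2 F.
  apply: (itg2I (g := fun x => (C * \int[mu]_y `|h y|) * (1 + `|x|) `^ (- 2))).
  - apply: measurable_funM; first exact: (measurableT_comp mfl).
    apply: measurable_funM; last exact: (measurableT_comp mh).
    apply: measurable_funB; last exact: (measurableT_comp (measurable_normc _)).
    apply: (measurableT_comp (measurable_normc _)); exact: measurable_funB.
  - by move=> x; apply: itgZ; exact: pot_itg.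
  - exact/itgZ/itg_wt.
  - move=> x; under eq_Rintegral do rewrite normrM.
    rewrite intZ; last exact/itg_norm/pot_itg.
    rewrite (_ : - 2 = - (2 + p) + p); last by ring.
    rewrite -wt_mul mulrACA; apply: ler_pM => //; first exact: int_ge0.
    apply: le_trans (pot_abs x ih) _; rewrite mulrC ler_wpM2l ?int_ge0//.
    by apply: powR_mono; [exact: ltW|by []|rewrite lerDr].
transitivity (\int[mu]_x \int[mu]_y F x y).
  by apply: eq_int => x; rewrite mulrC -intZ//; exact: pot_itg.
rewrite (real_fubini iF) -intZ//; apply: eq_int => y.
have A0 : 0 <= (1 + `|y|) `^ p by exact: powR_ge0.
have i1 := fl_itgM hp (measurable_normpow_shift p y) A0 (normpow_growth hp y) tp.
have i0 : itg (fl p phi).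
  apply: (itg_le mfl _ hC); apply/itgZ/itg_wt; lra.
transitivity (h y * (\int[mu]_x (`|x - y| `^ p * fl p phi x) - `|y| `^ p * \int[mu]_x fl p phi x)).
  rewrite -(intZ _ i0) -(intB i1 (itgZ _ i0)) -intZ; last exact: itgB i1 (itgZ _ i0).
  by apply: eq_int => x; rewrite /F; ring.
by rewrite fundamental// fl_int0// mulr0 subr0; ring.
Qed.

(* [p * dker] is the derivative of [|t|^p] away from [0]. *)
Definition dker (t : R) : R := ((0 < t)%R%:R - (t < 0)%R%:R) * `|t| `^ (p - 1).

Definition npow (t : R) : R := (`|t| <= 1)%R%:R * `|t| `^ (- (1 - p)).

Lemma itg_npow : itg npow.
Proof. by apply: itg_normpow; apply/andP; have := p0; have := p1; split; lra. Qed.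

Lemma npow_ge0 t : 0 <= npow t.
Proof. by rewrite mulr_ge0 ?powR_ge0 ?ler0n. Qed.

Lemma measurable_dker : measurable_fun [set: R] dker.
Proof.
apply: measurable_funM; last exact: measurable_normc.
by apply: measurable_funB; apply: measurable_natb; exact: measurable_fun_ltr.
Qed.

Lemma dkerN t : dker (- t) = - dker t.
Proof. by rewrite /dker normrN oppr_gt0 oppr_lt0 -mulNr opprB. Qed.

Lemma dker_gt0 t : 0 < t -> dker t = t `^ (p - 1).
Proof. by move=> t0; rewrite /dker t0 (lt_gtF t0) subr0 mul1r gtr0_norm. Qed.

Lemma dker0 : dker 0 = 0.
Proof. by rewrite /dker ltxx subrr mul0r. Qed.

Lemma dker_le t : `|dker t| <= npow t + 1.
Proof.
have p1' := p1; rewrite /dker normrM [X in _ * X]ger0_norm ?powR_ge0//.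
have h1 : `|(0 < t)%R%:R - (t < 0)%R%:R| <= 1 :> R.
  by case: ltgtP; rewrite ?subr0 ?sub0r ?subrr ?normrN ?normr1 ?normr0.
apply: (@le_trans _ _ (`|t| `^ (p - 1))); first by rewrite ler_piMl ?powR_ge0.
rewrite /npow opprB; have [t1|t1] := leP `|t| 1; first by rewrite mul1r lerDl.
rewrite mul0r add0r -[X in _ <= X](powRr0 `|t|); apply: ler_powR; lra.
Qed.

Section decaying.
Variables (h : R -> R) (A : R).
Hypothesis A0 : 0 <= A.
Hypothesis mh : measurable_fun [set: R] h.
Hypothesis hA : forall x, `|h x| <= A * (1 + `|x|) `^ (- 2).

Let l12 : (1 : R) < 2. Proof. by lra. Qed.

Lemma decay_itg : itg h.
Proof. exact: (itg_le mh (itgZ A (itg_wt l12)) hA). Qed.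

Let hb x : `|h x| <= A.
Proof.
apply: le_trans (hA x) _; rewrite -[X in _ <= X]mulr1 ler_wpM2l//.
by rewrite -[X in _ <= X](powRr0 (1 + `|x|)); apply: wt_le; rewrite oppr_le0.
Qed.

Definition dconv (x : R) := \int[mu]_y (dker (x - y) * h y).

Lemma measurable_dker_sub x : measurable_fun [set: R] (fun y => dker (x - y)).
Proof. by apply: (measurableT_comp measurable_dker); exact: measurable_funB. Qed.

Let maj x y : `|dker (x - y) * h y| <= A * npow (x - y) + A * (1 + `|y|) `^ (- 2).
Proof.
rewrite normrM; apply: (@le_trans _ _ ((npow (x - y) + 1) * `|h y|)).
  by rewrite ler_wpM2r// dker_le.
rewrite mulrDl mul1r; apply: lerD => //; rewrite mulrC ler_wpM2r ?npow_ge0//.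
Qed.

Let imaj x : itg (fun y => A * npow (x - y) + A * (1 + `|y|) `^ (- 2)).
Proof. by apply: itgD; apply: itgZ; [exact: itg_refl itg_npow|exact: itg_wt]. Qed.

Lemma dconv_itg x : itg (fun y => dker (x - y) * h y).
Proof.
by apply: (itg_le _ (imaj x) (maj x)); apply: measurable_funM => //; exact: measurable_dker_sub.
Qed.

Lemma dconv_abs : exists2 M, 0 <= M & forall x, \int[mu]_y `|dker (x - y) * h y| <= M.
Proof.
exists (A * \int[mu]_y npow y + A * \int[mu]_y (1 + `|y|) `^ (- 2)).
  by rewrite addr_ge0// mulr_ge0// int_ge0// => y; rewrite ?npow_ge0 ?powR_ge0.
move=> x; rewrite -(int_refl x itg_npow) -(intZ A (itg_refl x itg_npow)) -(intZ A (itg_wt l12)).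
rewrite -intD; [|exact/itgZ/itg_refl/itg_npow|exact/itgZ/itg_wt].
by apply: int_le => //; exact/itg_norm/dconv_itg.
Qed.

Lemma dconv_bound : exists2 M, 0 <= M & forall x, `|dconv x| <= M.
Proof.
have [M M0 H] := dconv_abs; exists M => // x.
by apply: le_trans (H x); apply: int_norm; exact: dconv_itg.
Qed.

Lemma dconv_continuous : continuous h -> continuous dconv.
Proof.
move=> ch a.
(* The parameter is moved from the singular kernel to the continuous function [h], so that the
   integrand depends continuously on it. *)
have E : dconv = (fun x => \int[mu]_(y in setT) (dker y * h (x - y))).
  apply/funext => x; rewrite -[LHS](int_refl x (dconv_itg x)); apply: eq_int => y.
  by rewrite (_ : x - (x - y) = y)//; ring.
(* Makes the majorant uniform for parameters at distance at most [1] from [a]; the [4] is the square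
   of [(1 + |y|)/2 <= 1 + |x|]. *)
have wsh (x y : R) : `|x - y| <= 1 -> (1 + `|x|) `^ (- 2) <= 4 * (1 + `|y|) `^ (- 2).
  move=> xy; have := ler_normB x (x - y); rewrite (_ : x - (x - y) = y); last by ring.
  move=> h1; have h2 : (1 + `|y|) / 2 <= 1 + `|x| by have := normr_ge0 x; lra.
  have h3 : 0 < (1 + `|y|) / 2 by rewrite divr_gt0// ltr_pwDl.
  apply: le_trans (powR_anti _ h3 h2) _ => //.
  rewrite powRM ?invr_ge0 ?addr_ge0// mulrC ler_wpM2r ?powR_ge0//.
  by rewrite powRN powR_mulrn ?invr_ge0// exprVn invrK -natrX.
have n2 : itg (fun y => (1 + `|a - y|) `^ (- 2)) := itg_refl a (itg_wt l12).
rewrite E; pose g y := 4 * A * (npow y + (1 + `|a - y|) `^ (- 2)).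
have ai : a \in `]a - 1, a + 1[%classic by rewrite inE/= in_itv/=; lra.
apply: (@continuity_under_integral R _ _ mu (fun x y => dker y * h (x - y)) setT measurableT
  (a - 1) (a + 1) _ _ g) ai.
- move=> x _; have := itg_refl x (dconv_itg x); apply: eq_itg => y.
  by rewrite (_ : x - (x - y) = y)//; ring.
- apply: ae_all => y _ x _; apply: cvgMr.
  have c : z - y @[z --> x] --> x - y by apply: cvgB; [exact: cvg_id|exact: cvg_cst].
  exact: (cvg_comp _ _ c (ch (x - y))).
- by apply: itgZ; apply: itgD; [exact: itg_npow|exact: n2].
move=> x; rewrite /= in_itv/= => xa; apply: ae_all => y _.
have xa1 : `|x - y - (a - y)| <= 1.
  by rewrite (_ : x - y - (a - y) = x - a) ?ler_norml; [lra|ring].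
have w4 := wsh _ _ xa1.
rewrite normrM /g; apply: (@le_trans _ _ ((npow y + 1) * `|h (x - y)|)).
  by rewrite ler_wpM2r// dker_le.
have n0 := npow_ge0 y; have h1 := hb (x - y); have h2 := hA (x - y).
have h3 : `|h (x - y)| <= A * (4 * (1 + `|a - y|) `^ (- 2)).
  by apply: le_trans h2 _; rewrite ler_wpM2l.
have h4 : npow y * `|h (x - y)| <= npow y * A by rewrite ler_wpM2l.
have h5 : 0 <= npow y * A by rewrite mulr_ge0.
move: h3 h4 h5; move: (`|h _|) (npow y) (_ `^ _) => a1 a2 a3; lra.
Qed.

End decaying.

End potential.

(** * Derivatives of potentials *)

Section potential_derivative.
Context {R : realType}.
Variable p : R.
Hypothesis hp : 0 < p < 1.
Notation mu := (@lebesgue_measure R).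
Notation dker := (dker p).
Implicit Types h m : R -> R.

Let p0 : 0 < p. Proof. by case/andP: hp. Qed.

Let p1 : p < 1. Proof. by case/andP: hp. Qed.

(** Signed indicator, so that integrating against it is integrating from [0] to [z] for either sign
    of [z]. *)
Let sig (z t : R) : R := (0 < t < z)%R%:R - (z < t < 0)%R%:R.

Lemma normpow_int (z : R) : itg (fun t => sig z t * (p * dker t)) /\
  \int[mu]_t (sig z t * (p * dker t)) = `|z| `^ p.
Proof.
wlog z0 : z / 0 <= z.
  move=> H; have [/H//|/ltW z0] := leP 0 z.
  have [i e] : itg (fun t => sig (- z) t * (p * dker t)) /\
    \int[mu]_t (sig (- z) t * (p * dker t)) = `|- z| `^ p by apply: H; rewrite oppr_ge0.
  have E t : sig (- z) (0 - t) * (p * dker (0 - t)) = sig z t * (p * dker t).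
    rewrite sub0r dkerN /sig oppr_gt0 oppr_lt0 !ltrN2 [(t < 0) && _]andbC [(_ < z) && _]andbC.
    by ring.
  split; first exact: eq_itg E (itg_refl 0 i).
  by rewrite -(eq_int E) (int_refl 0 i) e normrN.
move: z0; rewrite le_eqVlt => /predU1P[<-|z0].
  have E t : sig 0 t * (p * dker t) = 0 by rewrite /sig lt_asym subrr mul0r.
  split; first by apply: (eq_itg _ itg0) => t; rewrite E.
  by rewrite (eq_int E) int0 normr0 powR0// gt_eqF.
have [i e] := int_pow_near p0 z0.
have E t : (0 < t < z)%R%:R * (p * (t - 0) `^ (p - 1)) = sig z t * (p * dker t).
  rewrite /sig (_ : z < t < 0 = false); last first.
    by apply/negbTE/negP => /andP[h1 h2]; have := lt_trans z0 (lt_trans h1 h2); rewrite ltxx.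
  rewrite subr0 subr0; have [/andP[t0 _]|_] := boolP (0 < t < z); last by rewrite !mul0r.
  by rewrite dker_gt0.
split; first exact: eq_itg E i.
by rewrite -(eq_int E) e subr0 gtr0_norm.
Qed.

Lemma normpow_diff (a b : R) : a < b -> itg (fun t => (a < t < b)%R%:R * (p * dker t)) /\
  \int[mu]_t ((a < t < b)%R%:R * (p * dker t)) = `|b| `^ p - `|a| `^ p.
Proof.
move=> ab; have [ia ea] := normpow_int a; have [ib eb] := normpow_int b.
have mk : measurable_fun [set: R] (fun t => p * dker t).
  by apply: measurable_funM => //; exact: measurable_dker.
have ae : {ae mu, forall t, sig b t * (p * dker t) - sig a t * (p * dker t) =
    (a < t < b)%R%:R * (p * dker t)}.
  apply: ae_mono (ae_and (ae_neq a) (ae_neq b)) => t [ta tb].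
  rewrite -mulrBl; have [t0|t0|<-] := ltgtP 0 t; last by rewrite dker0 !mulr0.
    congr (_ * _); rewrite /sig (lt_gtF t0) t0 !andbF /= !subr0.
    have [at_|ta'|e] := ltgtP a t; last by rewrite e eqxx in ta.
      by rewrite /= subr0.
    by rewrite /= (lt_trans ta' ab) subrr.
  congr (_ * _); rewrite /sig (lt_gtF t0) t0 !andbT /= !sub0r.
  have [bt|tb'|e] := ltgtP b t; last by rewrite e eqxx in tb.
    by rewrite (lt_trans ab bt) /= opprK addrC subrr.
  by rewrite oppr0 add0r opprK andbT.
have mr : measurable_fun [set: R] (fun t => (a < t < b)%R%:R * (p * dker t)).
  by apply: measurable_funM => //; exact: measurable_itv_ind.
have il := itgB ib ia.
split; first exact: itg_ae mr ae il.
by rewrite -(int_ae (itg_meas il) mr ae) intB// eb ea.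
Qed.

Lemma normpow_diff_shift (a b y : R) : a < b ->
  \int[mu]_t ((a < t < b)%R%:R * (p * dker (t - y))) = `|b - y| `^ p - `|a - y| `^ p.
Proof.
move=> ab; have aby : a - y < b - y by rewrite ltrD2r.
have [i <-] := normpow_diff aby; rewrite -(int_shift (- y) i); apply: eq_int => t.
by rewrite !ltrD2r.
Qed.

Section decaying.
Variables (h : R -> R) (A : R).
Hypothesis A0 : 0 <= A.
Hypothesis mh : measurable_fun [set: R] h.
Hypothesis hA : forall x, `|h x| <= A * (1 + `|x|) `^ (- 2).

(** Because [dker] is singular, the derivative of the potential is reached through this integrated
    form: Fubini applied to [normpow_diff], which holds across the singularity, and then
    [isd_int]. *)
Lemma pot_diff (a b : R) : a < b ->
  pot p h b - pot p h a = \int[mu]_t ((a < t < b)%R%:R * (p * dconv p h t)).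
Proof.
move=> ab; have ih := decay_itg mh hA; have [M M0 hM] := dconv_abs hp A0 mh hA.
have id := dconv_itg hp A0 mh hA.
pose F t y := (a < t < b)%R%:R * (p * (dker (t - y) * h y)).
have iab : itg (fun t => (a < t < b)%R%:R * (1 : R)).
  have [i _] := int_pow_near ltr01 ab; apply: eq_itg i => t.
  by rewrite subrr powRr0 mulr1.
have iF : itg2 F.
  apply: (itg2I (g := fun t => (p * M) * ((a < t < b)%R%:R * 1))).
  - apply: measurable_funM; first by apply: (measurableT_comp (measurable_itv_ind a b)).
    apply: measurable_funM => //; apply: measurable_funM; last exact: (measurableT_comp mh).
    by apply: (measurableT_comp (measurable_dker p)); exact: measurable_funB.
  - by move=> t; apply: itgZ; apply: itgZ; exact: id.
  - exact: itgZ.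
  - move=> t; under eq_Rintegral do rewrite normrM (normrM p).
    rewrite intZ; last exact/itgZ/itg_norm/id.
    rewrite intZ; last exact/itg_norm/id.
    rewrite mulr1 mulrC !ger0_norm ?ler0n ?(ltW p0)// ler_wpM2r ?ler0n//.
    by rewrite ler_wpM2l ?(ltW p0).
transitivity (\int[mu]_t \int[mu]_y F t y); last first.
  apply: eq_int => t; rewrite /F intZ; last exact/itgZ/id.
  by congr (_ * _); rewrite intZ//; exact: id.
rewrite (real_fubini iF) /pot -(intB (pot_itg hp b ih) (pot_itg hp a ih)); apply: eq_int => y.
rewrite -mulrBl (_ : _ - _ - _ = `|b - y| `^ p - `|a - y| `^ p); last by ring.
rewrite -(normpow_diff_shift y ab) mulrC -intZ.
  by apply: eq_int => t; rewrite /F; ring.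
have aby : a - y < b - y by rewrite ltrD2r.
have [i _] := normpow_diff aby; have := itg_shift (- y) i; apply: eq_itg => t.
by rewrite !ltrD2r.
Qed.

Lemma pot_derive (x : R) : continuous h -> is_derive x 1 (pot p h) (p * dconv p h x).
Proof.
move=> ch; apply: (isd_int (G := fun x => p * dconv p h x)).
  by move=> t; apply: cvgMr; exact: (dconv_continuous hp A0 mh hA ch).
exact: pot_diff.
Qed.

End decaying.

Lemma cvg0_le (f g : nat -> R) : (forall n, `|f n| <= g n) ->
  g n @[n --> \oo] --> (0 : R) -> f n @[n --> \oo] --> (0 : R).
Proof.
move=> fg g0; apply/cvgrPdist_le => e e0.
have := g0; move/cvgrPdist_le => /(_ _ e0); apply: filterS => n.
rewrite !sub0r !normrN => h; apply: le_trans (fg n) _; exact: le_trans (ler_norm _) h.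
Qed.

Lemma wt_tail (c : R) : (1 + `|c + n.+1%:R|) `^ (- 1) @[n --> \oo] --> (0 : R).
Proof.
have C : (1 + `|c|) * n.+1%:R^-1 @[n --> \oo] --> (0 : R).
  by rewrite -[X in _ --> X](mulr0 (1 + `|c|)); apply: cvgMr; exact: cvg_harmonic.
apply: (cvg0_le _ C) => n; rewrite ger0_norm ?powR_ge0// powR_inv1 ?addr_ge0//.
rewrite ler_pdivlMr// ler_pdivrMl ?ltr_pwDl//.
have := ler_normB (c + n.+1%:R) c; rewrite (_ : c + n.+1%:R - c = n.+1%:R); last by ring.
rewrite [X in X <= _]ger0_norm//.
have := normr_ge0 c; have := normr_ge0 (c + n.+1%:R).
move: (`|c|) (`|_|) (n.+1%:R) => u v w u0 v0 H; nra.
Qed.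

Section by_parts.
Variable A : R.
Hypothesis A0 : 0 <= A.

Let dec m := forall x, `|m x| <= A * (1 + `|x|) `^ (- 3).

Let dec2 m : dec m -> forall x, `|m x| <= A * (1 + `|x|) `^ (- 2).
Proof. by move=> hm x; apply: le_trans (hm x) _; apply: ler_wpM2l => //; apply: wt_le; lra. Qed.

(** For [y != x], the derivative in [y] of [|x - y|^p * m y]. *)
Let f m m' (x y : R) := `|x - y| `^ p * m' y - p * (dker (x - y) * m y).

Let growth (x y : R) : `| `|x - y| `^ p | <= (1 + `|x|) `^ p * (1 + `|y|) `^ p.
Proof. by rewrite distrC; exact: normpow_growth hp x y. Qed.

Let mnp (x : R) : measurable_fun [set: R] (fun y : R => `|x - y| `^ p).
Proof.
by apply: measurable_powc; apply: measurableT_comp => //; exact: measurable_funB.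
Qed.

Let if1 m' x : measurable_fun [set: R] m' -> dec m' -> itg (fun y => `|x - y| `^ p * m' y).
Proof.
move=> mm hm; have p1' := p1.
by apply: (itg_growth_decay (mnp x) mm _ A0 (growth x) hm); [exact: powR_ge0|lra].
Qed.

Let if_ m m' x : measurable_fun [set: R] m -> measurable_fun [set: R] m' -> dec m -> dec m' ->
  itg (f m m' x).
Proof.
move=> mm mm' hm hm'; apply: itgB; first exact: if1.
by apply: itgZ; exact: (dconv_itg hp A0 mm (dec2 hm) x).
Qed.

Let right_tail m m' (x : R) : (forall x : R, is_derive x 1 m (m' x)) -> continuous m' ->
  dec m -> dec m' -> \int[mu]_y ((x < y)%R%:R * f m m' x y) = 0.
Proof.
move=> dm cm' hm hm'; have p0' := p0; have p1' := p1.
have cm : continuous m by move=> y; exact: (derivable_continuousW (dm y)).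
have mm := continuous_measurable_fun cm; have mm' := continuous_measurable_fun cm'.
pose F y := `|y - x| `^ p * m y.
pose g y := `|y - x| `^ p * m' y + p * (y - x) `^ (p - 1) * m y.
have E y : (x < y)%R%:R * f m m' x y = (x < y)%R%:R * g y.
  have [xy|_] := ltP x y; last by rewrite !mul0r.
  rewrite /f /g -[x - y]opprB dkerN normrN dker_gt0 ?subr_gt0//; ring.
have cn y : {for y, continuous (fun y : R => `|y - x| `^ p)}.
  apply: (@continuous_comp R R R (fun z => z - x) (fun t => `|t| `^ p) y).
    by apply: cvgB; [exact: cvg_id|exact: cvg_cst].
  exact: continuous_normpowR.
rewrite (eq_int E) (_ : 0 = 0 - F x); last by rewrite /F subrr normr0 powR0 ?gt_eqF// mul0r subr0.
apply: ftc_tail.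
- move=> y xy; have yx : 0 < y - x by rewrite subr_gt0.
  have d1 : is_derive y 1 (fun y => y - x) 1.
    by apply: (isd_eq (isdB (isd_id y) (isd_cst x y))); rewrite subr0.
  have d2 := @isd_comp R (fun t => `|t| `^ p) (fun y => y - x) y _ _ (isd_normpow p yx) d1.
  by apply: (isd_eq (isdM d2 (dm y))); rewrite /g mulr1; ring.
- move=> y xy; have yx : 0 < y - x by rewrite subr_gt0.
  apply: cvgD; first by apply: cvgM; [exact: cn|exact: cm'].
  apply: cvgM; last exact: cm.
  apply: cvgMr; apply: (@continuous_comp R R R (fun z => z - x) (fun t => t `^ (p - 1)) y).
    by apply: cvgB; [exact: cvg_id|exact: cvg_cst].
  exact: continuous_powc.
- by apply: cvgM; [exact: cn|exact: cm].
- pose B := (1 + `|x|) `^ p * A.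
  have C : B * (1 + `|x + n.+1%:R|) `^ (- 1) @[n --> \oo] --> (0 : R).
    by rewrite -[X in _ --> X](mulr0 B); apply: cvgMr; exact: wt_tail.
  have hF y : `|F y| <= B * (1 + `|y|) `^ (- 1).
    rewrite /F normrM distrC; apply: le_trans (ler_pM _ _ (growth x y) (hm y)) _ => //.
    rewrite mulrACA -/B wt_mul ler_wpM2l ?mulr_ge0 ?powR_ge0// wt_le//; lra.
  by apply: (cvg0_le _ C) => n; exact: hF.
- apply: (eq_itg E); apply: (itgMl (C := 1) _ _ (if_ x mm mm' hm hm')).
    by apply: measurable_natb; exact: measurable_fun_ltr.
  by move=> y; case: (_ < _); rewrite ?normr1 ?normr0.
Qed.

(** On each side of [x] the boundary term [|x - y|^p * m y] vanishes at [y = x] because [0 < p], and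
    at infinity by decay. The left side is the right side of the reflected functions [n], [n']. *)
Lemma dconv_ibp m m' (x : R) : (forall x : R, is_derive x 1 m (m' x)) -> continuous m' ->
  (forall x, `|m x| <= A * (1 + `|x|) `^ (- 3)) ->
  (forall x, `|m' x| <= A * (1 + `|x|) `^ (- 3)) ->
  \int[mu]_y (`|x - y| `^ p * m' y) = p * dconv p m x.
Proof.
move=> dm cm' hm hm'.
have cm : continuous m by move=> y; exact: (derivable_continuousW (dm y)).
have mm := continuous_measurable_fun cm; have mm' := continuous_measurable_fun cm'.
have ir := right_tail x dm cm' hm hm'.
pose n y := m (- y); pose n' y := - m' (- y).
have dn (y : R) : is_derive y 1 n (n' y).
  have d1 : is_derive y 1 (fun y => - y) (-1) by apply: isdN; exact: isd_id.
  by apply: (isd_eq (isd_comp (dm (- y)) d1)); rewrite mulrN1.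
have cn' : continuous n'.
  move=> y; apply: cvgN; have c : - z @[z --> y] --> - y by apply: cvgN; exact: cvg_id.
  exact: (cvg_comp _ _ c (cm' (- y))).
have hn : dec n by move=> y; have := hm (- y); rewrite normrN.
have hn' : dec n' by move=> y; rewrite normrN; have := hm' (- y); rewrite normrN.
have mlt (c : R) : measurable_fun [set: R] (fun y : R => (c < y)%R%:R : R).
  by apply: measurable_natb; exact: measurable_fun_ltr.
have mgt (c : R) : measurable_fun [set: R] (fun y : R => (y < c)%R%:R : R).
  by apply: measurable_natb; exact: measurable_fun_ltr.
have b1 (b : bool) : `|b%:R : R| <= 1 by case: b; rewrite ?normr1 ?normr0.
have il := right_tail (- x) dn cn' hn hn'.
have iff_ := if_ x mm mm' hm hm'.
have i1 := itgMl (mlt x) (fun y => b1 _) iff_.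
have i2 := itgMl (mgt x) (fun y => b1 _) iff_.
have mn := continuous_measurable_fun (fun y => derivable_continuousW (dn y)).
have in_ := itgMl (mlt (- x)) (fun y => b1 _) (if_ (- x) mn (continuous_measurable_fun cn') hn hn').
have e2 : \int[mu]_y ((y < x)%R%:R * f m m' x y) = 0.
  apply: oppr_inj; rewrite oppr0 -[RHS]il -(int_refl 0 in_) -intN//; apply: eq_int => y.
  rewrite sub0r ltrN2 /f /n /n' !opprK (_ : - x + y = - (x - y)); last by ring.
  by rewrite dkerN normrN; ring.
have : \int[mu]_y f m m' x y = 0.
  transitivity (\int[mu]_y ((x < y)%R%:R * f m m' x y + (y < x)%R%:R * f m m' x y)).
    apply: eq_int => y; rewrite -mulrDl; case: ltgtP => [||<-]; rewrite ?addr0 ?add0r ?mul1r//.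
    by rewrite /f subrr dker0 normr0 powR0 ?gt_eqF// !mul0r mulr0 subr0.
  by rewrite intD// ir e2 addr0.
have id := dconv_itg hp A0 mm (dec2 hm) x.
by rewrite /f (intB (if1 x mm' hm') (itgZ p id)) (intZ p id) => /eqP; rewrite subr_eq0 => /eqP.
Qed.

End by_parts.

End potential_derivative.

(** * Solutions and kernel elements in integral form *)

Section rapid_decay.
Context {R : realType}.
Notation mu := (@lebesgue_measure R).
Implicit Types f g h : R -> R.

Lemma int_gt0 f : itg f -> (forall x, 0 < f x) -> 0 < \int[mu]_x f x.
Proof.
move=> i f0; rewrite lt_neqAle int_ge0 ?andbT; last by move=> x; exact: ltW.
apply/eqP => e.
have z : (\int[mu]_x `|(f x)%:E| = 0)%E.
  transitivity (\int[mu]_x (f x)%:E)%E.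
    by apply: eq_integral => x _; rewrite gee0_abs// lee_fin ltW.
  by rewrite (intE i) -e.
have mf : measurable_fun [set: R] (fun x => (f x)%:E).
  by apply/measurable_EFinP; exact: (itg_meas i).
have ae0 := proj1 (ae_eq_integral_abs mu measurableT mf) z.
apply: (@ae_open_empty R setT openT _ 0 I); apply: ae_mono ae0 => x h _.
by have := h I => -[h0]; have := f0 x; rewrite h0 ltxx.
Qed.

Definition rapid h := forall k : R, exists2 A : R, 0 <= A &
  forall x, `|h x| <= A * (1 + `|x|) `^ (- k).

Lemma rapid_mul h g (M r : R) : rapid h -> 0 <= M ->
  (forall x, `|g x| <= M * (1 + `|x|) `^ r) -> rapid (fun x => h x * g x).
Proof.
move=> rh M0 hg k; have [A A0 hA] := rh (k + r).
exists (A * M); first exact: mulr_ge0.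
move=> x; rewrite normrM (_ : - k = - (k + r) + r); last by ring.
by rewrite -wt_mul mulrACA; apply: ler_pM.
Qed.

Lemma rapidD h g : rapid h -> rapid g -> rapid (fun x => h x + g x).
Proof.
move=> rh rg k; have [A A0 hA] := rh k; have [B B0 hB] := rg k.
exists (A + B); first exact: addr_ge0.
by move=> x; rewrite mulrDl; apply: le_trans (ler_normD _ _) _; exact: lerD.
Qed.

Lemma rapidZ c h : rapid h -> rapid (fun x => c * h x).
Proof.
move=> rh k; have [A A0 hA] := rh k; exists (`|c| * A); first exact: mulr_ge0.
by move=> x; rewrite normrM -mulrA ler_wpM2l.
Qed.

Lemma rapid_itg h : measurable_fun [set: R] h -> rapid h -> itg h.
Proof. by move=> mh rh; have [A A0 hA] := rh 2; exact: decay_itg mh hA. Qed.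

Lemma rapid_itgM h g (M r : R) : measurable_fun [set: R] h -> measurable_fun [set: R] g ->
  rapid h -> 0 <= M -> (forall x, `|g x| <= M * (1 + `|x|) `^ r) -> itg (fun x => g x * h x).
Proof.
move=> mh mg rh M0 hg; have := rapid_itg _ (rapid_mul rh M0 hg).
move=> /(_ (measurable_funM mh mg)); apply: eq_itg => x; exact: mulrC.
Qed.

Lemma rapid2 h g (k : R) : rapid h -> rapid g -> exists A : R, [/\ 0 <= A,
  forall x, `|h x| <= A * (1 + `|x|) `^ (- k) & forall x, `|g x| <= A * (1 + `|x|) `^ (- k)].
Proof.
move=> rh rg; have [A A0 hA] := rh k; have [B B0 hB] := rg k.
exists (A + B); split; first exact: addr_ge0.
  by move=> x; apply: le_trans (hA x) _; rewrite ler_wpM2r ?powR_ge0// lerDl.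
by move=> x; apply: le_trans (hB x) _; rewrite ler_wpM2r ?powR_ge0// lerDr.
Qed.

Lemma rapid_tail m m' (c : R) : (forall x : R, is_derive x 1 m (m' x)) -> continuous m' ->
  rapid m -> rapid m' -> \int[mu]_t ((c < t)%R%:R * m' t) = - m c.
Proof.
move=> dm cm' rm rm'; rewrite -[RHS]sub0r; have [A A0 hA] := rm 1.
apply: ftc_tail.
- by move=> x _; exact: cm'.
- exact: derivable_continuousW (dm c).
- have C : A * (1 + `|c + n.+1%:R|) `^ (- 1) @[n --> \oo] --> (0 : R).
    by rewrite -[X in _ --> X](mulr0 A); apply: cvgMr; exact: wt_tail.
  by apply: (cvg0_le _ C) => n; exact: hA.
- apply: (itgMl (C := 1) _ _ (rapid_itg (continuous_measurable_fun cm') rm')).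
    by apply: measurable_natb; exact: measurable_fun_ltr.
  by move=> x; case: (c < x); rewrite ?normr1 ?normr0.
Qed.

Lemma rapid_int0 m m' : (forall x : R, is_derive x 1 m (m' x)) -> continuous m' ->
  rapid m -> rapid m' -> \int[mu]_t m' t = 0.
Proof.
move=> dm cm' rm rm'; have [A A0 hA] := rm 1.
have im := rapid_itg (continuous_measurable_fun cm') rm'.
have ii (c : R) : itg (fun t => (c < t)%R%:R * m' t).
  apply: (itgMl (C := 1) _ _ im); first by apply: measurable_natb; exact: measurable_fun_ltr.
  by move=> x; case: (c < x); rewrite ?normr1 ?normr0.
pose c (n : nat) : R := - (0 + n.+1%:R).
have C1 : \int[mu]_t ((c n < t)%R%:R * m' t) @[n --> \oo] --> \int[mu]_t m' t.
  apply: (int_dominated (g := fun x => `|m' x|)).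
  - by move=> n; exact: itg_meas (ii _).
  - exact: itg_meas im.
  - exact: itg_norm.
  - move=> x; apply: (@cvg_trans _ ((m' x : R) @[n --> \oo])); last exact: cvg_cst.
    apply: near_eq_cvg.
    exists (Num.trunc `|x|).+1 => // n /= Nn.
    rewrite (_ : c n < x) ?mul1r// /c add0r.
    have h1 : `|x| < n.+1%:R.
      apply/(lt_le_trans (truncnS_gt _)); rewrite ler_nat; exact: leq_trans Nn (leqnSn _).
    by move: h1; rewrite ltr_norml => /andP[].
  - move=> n x; rewrite normrM ler_piMl//; case: (c n < x); rewrite ?normr1 ?normr0//.
have C2 : \int[mu]_t ((c n < t)%R%:R * m' t) @[n --> \oo] --> (0 : R).
  have C : A * (1 + `|0 + n.+1%:R|) `^ (- 1) @[n --> \oo] --> (0 : R).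
    by rewrite -[X in _ --> X](mulr0 A); apply: cvgMr; exact: wt_tail.
  apply: (cvg0_le _ C) => n; rewrite (rapid_tail (c n) dm cm' rm rm') normrN.
  by have := hA (c n); rewrite /c normrN.
exact: (cvg_unique _ C1 C2).
Qed.

End rapid_decay.

(** * Solutions of the integral equation and the elements [slope] and [dilation] *)

Section solution.
Context {R : realType}.
Variable p : R.
Hypothesis hp : 0 < p < 1.
Notation mu := (@lebesgue_measure R).

Let p0 : 0 < p. Proof. by case/andP: hp. Qed.

Let p1 : p < 1. Proof. by case/andP: hp. Qed.

Variables (C a0 : R) (v V : R -> R).
Hypothesis C0 : 0 < C.
Hypothesis VE : forall x, V x = expR (v x).
Hypothesis iV : itg V.
Hypothesis vE : forall x, v x = a0 - C * pot p V x.

Lemma sol_gt0 x : 0 < V x. Proof. by rewrite VE expR_gt0. Qed.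

Lemma sol_continuous_log : continuous v.
Proof.
rewrite (_ : v = fun x => a0 - C * pot p V x); last exact/funext.
move=> x; apply: cvgB; first exact: cvg_cst.
by apply: cvgMr; exact: pot_continuous.
Qed.

Lemma sol_continuous : continuous V.
Proof.
rewrite (_ : V = expR \o v); last exact/funext.
by move=> x; apply: continuous_comp; [exact: sol_continuous_log|exact: continuous_expR].
Qed.

(** Some ball carries a mass [J] of [V] exceeding half of the total [I]. Inside it the kernel is at
    least [|x|^p - 2 M], outside at least [- |x|^p], so the net coefficient of [|x|^p] is
    [J - (I - J) > 0]. *)
Lemma pot_lower : exists c B : R, 0 < c /\ forall x, c * `|x| `^ p - B <= pot p V x.
Proof.
have I0 := int_gt0 iV sol_gt0; set I := \int[mu]_x V x in I0.
have ii n : itg (fun x => ind n.+1%:R x * V x).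
  apply: (itgMl (C := 1) (measurable_ind _) _ iV) => x.
  by rewrite /ind; case: (`|x| <= _); rewrite ?normr1 ?normr0.
have cv : \int[mu]_x (ind n.+1%:R x * V x) @[n --> \oo] --> I.
  apply: (int_dominated (g := fun x => `|V x|)).
  - by move=> n; exact: itg_meas (ii n).
  - exact: itg_meas iV.
  - exact: itg_norm.
  - move=> x; apply: (@cvg_trans _ ((V x : R) @[n --> \oo])); last exact: cvg_cst.
    apply: near_eq_cvg.
    exists (Num.trunc `|x|).+1 => // n /= Nn.
    rewrite /ind (_ : `|x| <= n.+1%:R) ?mul1r//.
    apply/ltW/(lt_le_trans (truncnS_gt _)); rewrite ler_nat.
    exact: leq_trans Nn (leqnSn _).
  - move=> n x; rewrite normrM ler_piMl// /ind; case: (`|x| <= _); rewrite ?normr1 ?normr0//.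
have I2 : I / 2 < I by lra.
have := cv; move/cvgr_gt => /(_ _ I2) [n _ /(_ n (leqnn n)) /= hn].
set J := \int[mu]_x (ind n.+1%:R x * V x) in hn.
pose M := (n.+1%:R : R) `^ p.
have M0 : 0 <= M by exact: powR_ge0.
exists (2 * J - I), (2 * M * J); split; first by lra.
move=> x; pose X := `|x| `^ p.
pose g y := (2 * X - 2 * M) * (ind n.+1%:R y * V y) - X * V y.
have ig : itg g by apply: itgB; apply: itgZ.
have -> : (2 * J - I) * `|x| `^ p - 2 * M * J = \int[mu]_y g y.
  by rewrite /g (intB (itgZ _ (ii n)) (itgZ _ iV)) (intZ _ (ii n)) (intZ _ iV) -/J -/I -/X; ring.
apply: int_le => //; first exact: pot_itg.
move=> y; have Vy := ltW (sol_gt0 y); rewrite /g mulrA -mulrBl ler_wpM2r//.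
have k1 := pot_ker_le hp x y; have k2 := normpow_sub hp x y.
rewrite /ind; have [yM|_] := leP `|y| n.+1%:R; last first.
  by rewrite mulr0 sub0r; move: k1; rewrite ler_norml => /andP[].
have k3 : `|y| `^ p <= M by apply: powR_mono => //; exact: ltW.
rewrite mulr1; move: k2; rewrite ler_norml => /andP[_]; rewrite -/X.
move: k3; move: (`|y| `^ p) (`|x - y| `^ p) => s t; lra.
Qed.

(** By [pot_lower], [V] is at most a constant times [exp(- d (1+|x|)^p)]. A single Taylor term of
    the exponential, of order [n + 1] with [p (n + 1) >= k], gives the required decay. *)
Lemma sol_rapid : rapid V.
Proof.
have p0' := p0; move=> k; have [c [B [c0 hB]]] := pot_lower.
pose d := C * c; have d0 : 0 < d by rewrite mulr_gt0.
pose n := Num.trunc (k / p).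
have nk : k <= p * n.+1%:R by rewrite mulrC -ler_pdivrMr//; apply/ltW/truncnS_gt.
pose F : R := (n.+1)`!%:R; have F0 : 0 < F by rewrite ltr0n fact_gt0.
pose A := expR (a0 + C * B + d) * (F / d ^+ n.+1).
have A0 : 0 <= A by rewrite mulr_ge0 ?expR_ge0// divr_ge0 ?ltW// exprn_gt0.
exists A => // x; rewrite gtr0_norm ?sol_gt0// VE.
pose y := (1 + `|x|) `^ p; have y0 : 0 < y by exact: wt_gt0.
have h1 : y <= 1 + `|x| `^ p.
  by have := powR_subadd hp ler01 (normr_ge0 x); rewrite powR1.
have h2 : v x <= a0 + C * B + d - d * y.
  have := hB x; rewrite vE => h3.
  have h4 : C * (c * `|x| `^ p - B) <= C * pot p V x by rewrite ler_wpM2l// ltW.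
  have h5 : d * y <= d * (1 + `|x| `^ p) by rewrite ler_wpM2l// ltW.
  move: h4 h5; rewrite /d; move: (pot p V x) (_ `^ _) => P Q; lra.
apply: (@le_trans _ _ (expR (a0 + C * B + d) * expR (- (d * y)))).
  by rewrite -expRD ler_expR.
rewrite /A -mulrA ler_wpM2l ?expR_ge0//.
have dy : 0 <= d * y by rewrite mulr_ge0 ?ltW.
have := expR_ge1Dxn n dy => h3.
have h4 : (d * y) ^+ n.+1 / F <= expR (d * y) by apply: le_trans h3; rewrite lerDr.
have dy0 : 0 < (d * y) ^+ n.+1 / F by rewrite divr_gt0// exprn_gt0// mulr_gt0.
rewrite expRN; apply: (@le_trans _ _ ((d * y) ^+ n.+1 / F)^-1).
  by rewrite lef_pV2 ?posrE ?expR_gt0.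
rewrite invf_div exprMn invfM mulrA; apply: ler_wpM2l.
  by rewrite divr_ge0 ?exprn_ge0 ?(ltW F0) ?(ltW d0).
rewrite -powR_mulrn ?(ltW y0)// -powRrM -powRN; apply: wt_le.
by rewrite lerN2.
Qed.

(* The derivative of [v], see [sol_log_derive]. *)
Definition slope (x : R) := - (C * p) * dconv p V x.

Let V2 : exists2 A, 0 <= A & forall x, `|V x| <= A * (1 + `|x|) `^ (- 2) := sol_rapid 2.

Let mV : measurable_fun [set: R] V := itg_meas iV.

Lemma slope_continuous : continuous slope.
Proof.
have [A A0 hA] := V2; move=> x; apply: cvgMr.
exact: (dconv_continuous hp A0 mV hA sol_continuous).
Qed.

Lemma sol_log_derive (x : R) : is_derive x 1 v (slope x).
Proof.
have [A A0 hA] := V2; rewrite (_ : v = fun x => a0 - C * pot p V x); last exact/funext.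
have d := pot_derive hp A0 mV hA x sol_continuous.
by apply: (isd_eq (isdB (isd_cst a0 x) (isdZ C d))); rewrite /slope; ring.
Qed.

Lemma sol_derive (x : R) : is_derive x 1 V (V x * slope x).
Proof.
rewrite [X in is_derive _ _ X _](_ : V = fun x => expR (v x)); last exact/funext.
rewrite VE; exact: isd_comp (is_derive_expR (v x)) (sol_log_derive x).
Qed.

Lemma slope_bound : exists2 M, 0 <= M & forall x, `|slope x| <= M * (1 + `|x|) `^ 0.
Proof.
have [A A0 hA] := V2; have [M M0 hM] := dconv_bound hp A0 mV hA.
exists (`|- (C * p)| * M); first exact: mulr_ge0.
by move=> x; rewrite powRr0 mulr1 normrM ler_wpM2l.
Qed.

(* Solutions of the linearised equation, in integral form. *)
Definition kernel_element (psi : R -> R) := [/\ continuous psi, itg (fun x => V x * psi x) &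
  exists c, forall x, psi x = c - C * pot p (fun y => V y * psi y) x].

Lemma kernel_lin psi chi (a b : R) : kernel_element psi -> kernel_element chi ->
  kernel_element (fun x => a * psi x + b * chi x).
Proof.
move=> [c1 i1 [k1 e1]] [c2 i2 [k2 e2]].
have E x : a * (V x * psi x) + b * (V x * chi x) = V x * (a * psi x + b * chi x) by ring.
have i := itgD (itgZ a i1) (itgZ b i2).
split.
- by move=> x; apply: cvgD; apply: cvgMr; [exact: c1|exact: c2].
- exact: eq_itg E i.
exists (a * k1 + b * k2) => x; rewrite {1}e1 {1}e2.
have -> : pot p (fun y => V y * (a * psi y + b * chi y)) x =
    a * pot p (fun y => V y * psi y) x + b * pot p (fun y => V y * chi y) x.
  have j1 := pot_itg hp x i1; have j2 := pot_itg hp x i2.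
  rewrite /pot -(intZ a j1) -(intZ b j2) -(intD (itgZ a j1) (itgZ b j2)); apply: eq_int => y.
  by ring.
by ring.
Qed.

Lemma kernel_growth psi : kernel_element psi ->
  exists2 M, 0 <= M & forall x, `|psi x| <= M * (1 + `|x|) `^ p.
Proof.
move=> [cp ip [c e]]; pose I := \int[mu]_y `|V y * psi y|.
have I0 : 0 <= I by exact: int_ge0.
exists (`|c| + C * I); first by rewrite addr_ge0// mulr_ge0// ltW.
move=> x; rewrite e mulrDl; apply: le_trans (ler_normB _ _) _; apply: lerD.
  rewrite ler_peMr// -[X in X <= _](powRr0 (1 + `|x|)); apply: wt_le; exact: ltW.
rewrite normrM gtr0_norm// -mulrA ler_wpM2l ?(ltW C0)//; exact: pot_growth.
Qed.

Lemma kernel_rapid psi : kernel_element psi -> rapid (fun x => V x * psi x).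
Proof.
move=> kp; have [M M0 hM] := kernel_growth kp; exact: rapid_mul sol_rapid M0 hM.
Qed.

Lemma kernel_continuousM psi : kernel_element psi -> continuous (fun x => V x * psi x).
Proof. by move=> [cp _ _] x; apply: cvgM; [exact: sol_continuous|exact: cp]. Qed.

Definition kernel_slope psi (x : R) := - (C * p) * dconv p (fun y => V y * psi y) x.

Lemma kernel_derive psi (x : R) : kernel_element psi -> is_derive x 1 psi (kernel_slope psi x).
Proof.
move=> kp; have [A A0 hA] := kernel_rapid kp 2; have ch := kernel_continuousM kp.
have [_ _ [c e]] := kp; set h := fun y => V y * psi y.
have d := pot_derive hp A0 (continuous_measurable_fun ch) hA x ch.
rewrite [X in is_derive _ _ X _](_ : psi = fun x => c - C * pot p h x); last exact/funext.
by apply: (isd_eq (isdB (isd_cst c x) (isdZ C d))); rewrite /kernel_slope /h; ring.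
Qed.

Lemma kernel_slope_continuous psi : kernel_element psi -> continuous (kernel_slope psi).
Proof.
move=> kp; have [A A0 hA] := kernel_rapid kp 2; have ch := kernel_continuousM kp.
move=> x; apply: cvgMr; exact: (dconv_continuous hp A0 (continuous_measurable_fun ch) hA ch).
Qed.

Lemma kernel_slope_bound psi : kernel_element psi ->
  exists2 M, 0 <= M & forall x, `|kernel_slope psi x| <= M * (1 + `|x|) `^ 0.
Proof.
move=> kp; have [A A0 hA] := kernel_rapid kp 2; have ch := kernel_continuousM kp.
have [M M0 hM] := dconv_bound hp A0 (continuous_measurable_fun ch) hA.
exists (`|- (C * p)| * M); first exact: mulr_ge0.
by move=> x; rewrite powRr0 mulr1 normrM ler_wpM2l.
Qed.

Lemma npow_growth x : `| `|x : R| `^ p | <= 1 * (1 + `|x|) `^ p.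
Proof.
by rewrite mul1r ger0_norm ?powR_ge0//; apply: powR_mono; [exact: ltW|by []|rewrite lerDr].
Qed.

Lemma pot_of_derivative m m' (x : R) : (forall x : R, is_derive x 1 m (m' x)) -> continuous m' ->
  rapid m -> rapid m' ->
  pot p m' x = p * dconv p m x - \int[mu]_y (`|y| `^ p * m' y).
Proof.
move=> dm cm' rm rm'; have [A [A0 hm hm']] := rapid2 3 rm rm'.
have mm' := continuous_measurable_fun cm'.
rewrite -(dconv_ibp hp A0 x dm cm' hm hm') /pot -intB.
- by apply: eq_int => y; rewrite mulrBl.
- have g y : `| `|x - y| `^ p | <= (1 + `|x|) `^ p * (1 + `|y|) `^ p.
    by rewrite distrC; exact: normpow_growth hp x y.
  apply: (rapid_itgM mm' _ rm' _ g); last exact: powR_ge0.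
  by apply: measurable_powc; apply: measurableT_comp => //; exact: measurable_funB.
- by apply: (rapid_itgM mm' _ rm' ler01 npow_growth); exact: measurable_normc.
Qed.

(** [V * slope] is [V']; integrating by parts, its potential is [p * dconv p V] up to an additive
    constant, and [slope] is [- C] times [p * dconv p V]. *)
Lemma slope_kernel : kernel_element slope.
Proof.
have [M M0 hM] := slope_bound; have r := rapid_mul sol_rapid M0 hM.
have c : continuous (fun x => V x * slope x).
  by move=> x; apply: cvgM; [exact: sol_continuous|exact: slope_continuous].
split; [exact: slope_continuous|exact: rapid_itg (continuous_measurable_fun c) r|].
exists (- C * \int[mu]_y (`|y| `^ p * (V y * slope y))) => x.
by rewrite (pot_of_derivative x sol_derive c sol_rapid r) {1}/slope; ring.
Qed.

(* [p + 1] is [2 s]. *)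
Definition dilation (x : R) := x * slope x + (p + 1).

Let id_growth (x : R) : `|x| <= 1 * (1 + `|x|) `^ 1.
Proof. by rewrite mul1r powRr1 ?addr_ge0// lerDr. Qed.

Lemma moment_derive (x : R) :
  is_derive x 1 (fun x => V x * x) (V x + V x * slope x * x).
Proof.
by apply: (isd_eq (isdM (sol_derive x) (isd_id x))); rewrite mulr1; ring.
Qed.

Lemma moment_rapid : rapid (fun x => V x * x) /\ rapid (fun x => V x + V x * slope x * x).
Proof.
have [M M0 hM] := slope_bound; have r := rapid_mul sol_rapid M0 hM.
split; first exact: rapid_mul sol_rapid ler01 id_growth.
by apply: rapidD; [exact: sol_rapid|exact: rapid_mul r ler01 id_growth].
Qed.

Lemma moment_continuous : continuous (fun x => V x + V x * slope x * x).
Proof.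
move=> x; apply: cvgD; first exact: sol_continuous.
apply: cvgM; last exact: cvg_id.
by apply: cvgM; [exact: sol_continuous|exact: slope_continuous].
Qed.

(** [V * dilation] is [(x V)' + p V]. The potential of the derivative reduces to the convolution of
    [dker] with [y V]; writing [y = x - (x - y)] and [|t|^p = t * dker t] yields
    [x * dconv p V - pot p V] up to a constant, and the two multiples of [pot p V] cancel. *)
Lemma dilation_kernel : kernel_element dilation.
Proof.
have [r1 r2] := moment_rapid; have cm := moment_continuous.
have i2 := rapid_itg (continuous_measurable_fun cm) r2.
have E x : V x + V x * slope x * x + p * V x = V x * dilation x by rewrite /dilation; ring.
have iD := itgD i2 (itgZ p iV).
have [A A0 hA] := V2.
have inp : itg (fun y => `|y| `^ p * V y).
  by apply: (rapid_itgM mV _ sol_rapid ler01 npow_growth); exact: measurable_normc.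
split.
- move=> x; apply: cvgD; last exact: cvg_cst.
  by apply: cvgM; [exact: cvg_id|exact: slope_continuous].
- exact: eq_itg E iD.
pose k := \int[mu]_y (`|y| `^ p * (V y + V y * slope y * y)); pose l := \int[mu]_y (`|y| `^ p * V y).
exists (p + 1 - C * k - C * p * l) => x.
have -> : pot p (fun y => V y * dilation y) x =
    pot p (fun y => V y + V y * slope y * y) x + p * pot p V x.
  have j1 := pot_itg hp x i2; have j2 := pot_itg hp x iV.
  rewrite /pot -(intZ p j2) -(intD j1 (itgZ p j2)); apply: eq_int => y.
  by rewrite -E; ring.
rewrite (pot_of_derivative x moment_derive cm r1 r2) -/k.
have ed : dconv p (fun y => V y * y) x = x * dconv p V x - pot p V x - l.
  have d1 := dconv_itg hp A0 mV hA x; have j2 := pot_itg hp x iV.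
  have e1 := intZ x d1; have e2 := intB (itgZ x d1) j2.
  have e3 := intB (itgB (itgZ x d1) j2) inp.
  rewrite /dconv /pot /l -e1 -e2 -e3.
  apply: eq_int => y; have np : `|x - y| `^ p = (x - y) * dker p (x - y).
    have [->|t0] := eqVneq (x - y) 0; first by rewrite mul0r normr0 powR0// gt_eqF.
    have -> : (x - y) * dker p (x - y) = `|x - y| * `|x - y| `^ (p - 1).
      rewrite /dker mulrA; congr (_ * _); move: (x - y) t0 => t.
      by case: ltgtP => // t0 _; rewrite ?(gtr0_norm t0) ?(ltr0_norm t0) /= ?subr0 ?sub0r ?mulr1 ?mulrN1.
    rewrite -{2}[`|x - y|]powRr1// -powRD; last by apply/implyP; rewrite normr_eq0.
    by congr (_ `^ _); ring.
  by rewrite np; ring.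
by rewrite ed {1}/dilation /slope; ring.
Qed.

Lemma dilation_mean : 0 < \int[mu]_x (V x * dilation x).
Proof.
have [r1 r2] := moment_rapid; have cm := moment_continuous; have p0' := p0.
have i2 := rapid_itg (continuous_measurable_fun cm) r2.
have z := rapid_int0 moment_derive cm r1 r2.
have -> : \int[mu]_x (V x * dilation x) = p * \int[mu]_x V x.
  rewrite -[RHS]add0r -z -(intZ p iV) -(intD i2 (itgZ p iV)); apply: eq_int => x.
  by rewrite /dilation; ring.
by rewrite mulr_gt0//; exact: int_gt0 iV sol_gt0.
Qed.

End solution.

(** * Nondegeneracy *)

Section double_integrals.
Context {R : realType}.
Notation mu := (@lebesgue_measure R).

Lemma abs_int_le (f : R -> R) : measurable_fun [set: R] f ->
  (`|\int[mu]_x f x|%:E <= \int[mu]_x `|f x|%:E)%E.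
Proof.
move=> mf; have := @le_abse_integral _ _ _ mu setT (fun x => (f x)%:E) measurableT
  (proj2 (measurable_EFinP _ _) mf).
apply: le_trans; rewrite /Rintegral.
case: (\int[mu]_x (f x)%:E)%E => [r| |] //=; by rewrite normr0 leey.
Qed.

Lemma itg2_ind (b : R -> R -> bool) (F : R -> R -> R) :
  measurable_fun [set: R * R] (fun z => b z.1 z.2) -> itg2 F ->
  itg2 (fun x y => (b x y)%:R * F x y).
Proof.
move=> mb iF; have iF' : itg2 (fun x y => `|F x y|).
  by have := integrable_abse iF; apply: eq_integrable.
apply: (itg2_le _ iF').
  by apply: measurable_funM; [exact: measurable_natb|exact: itg2_meas].
by move=> x y; rewrite normrM ler_piMl//; case: (b x y); rewrite ?normr1 ?normr0.
Qed.

Lemma int2E (F : R -> R -> R) : itg2 F ->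
  (\int[mu]_x \int[mu]_y (F x y)%:E = (\int[mu]_x \int[mu]_y F x y)%:E)%E.
Proof. by move=> iF; rewrite -(intE (itg2_left iF)) fine_fubini. Qed.

Lemma measurable_int_right (f : R * R -> \bar R) : measurable_fun [set: R * R] f ->
  (forall z, 0 <= f z)%E -> measurable_fun [set: R] (fun x => \int[mu]_y f (x, y))%E.
Proof. by move=> mf f0; exact: (@measurable_fun_fubini_tonelli_F _ _ _ _ R mu f mf f0). Qed.

Lemma measurable_int_left (f : R * R -> \bar R) : measurable_fun [set: R * R] f ->
  (forall z, 0 <= f z)%E -> measurable_fun [set: R] (fun y => \int[mu]_x f (x, y))%E.
Proof. by move=> mf f0; exact: (@measurable_fun_fubini_tonelli_G _ _ _ _ R mu f mf f0). Qed.

Lemma measurable_int_third (f : (R * R) * R -> \bar R) :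
  measurable_fun [set: (R * R) * R] f -> (forall u, 0 <= f u)%E ->
  measurable_fun [set: R * R] (fun z => \int[mu]_t f (z, t))%E.
Proof. by move=> mf f0; exact: (@measurable_fun_fubini_tonelli_F _ _ _ _ R mu f mf f0). Qed.

Lemma ge0_fubini (f : R -> R -> \bar R) : measurable_fun [set: R * R] (fun z => f z.1 z.2) ->
  (forall x y, 0 <= f x y)%E ->
  (\int[mu]_x \int[mu]_y f x y = \int[mu]_y \int[mu]_x f x y)%E.
Proof.
by move=> mf f0; exact: (@fubini_tonelli _ _ _ _ R mu mu (fun z => f z.1 z.2) mf (fun z => f0 z.1 z.2)).
Qed.

Let ibt (t x y : R) : bool := y < t < x.

(** Tonelli in three variables, in extended reals because the finiteness of the integrals is not
    known beforehand. It is used in both directions: with weight [1] to integrate the bound on [q],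
    then with weight [|g|] to restore an outer integral. *)
Lemma tonelli_between (E : R * R -> \bar R) (w : R -> \bar R) :
  measurable_fun [set: R * R] E -> measurable_fun [set: R] w ->
  (forall z, 0 <= E z)%E -> (forall t, 0 <= w t)%E ->
  measurable_fun [set: R] (fun t => \int[mu]_x \int[mu]_y (((y < t < x)%R%:R)%:E * E (x, y)))%E /\
  (\int[mu]_t (w t * \int[mu]_x \int[mu]_y (((y < t < x)%R%:R)%:E * E (x, y))) =
   \int[mu]_x \int[mu]_y (E (x, y) * \int[mu]_t (((y < t < x)%R%:R)%:E * w t)))%E.
Proof.
move=> mE mw E0 w0.
have i0 t x y : (0 <= ((ibt t x y)%:R : R)%:E)%E by rewrite lee_fin ler0n.
pose i3 (u : (R * R) * R) := (((ibt u.1.1 u.1.2 u.2)%:R : R)%:E * E (u.1.2, u.2))%E.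
have i30 u : (0 <= i3 u)%E by exact: mule_ge0.
have m1 : measurable_fun [set: (R * R) * R] (fun u => u.1.1).
  exact: (measurableT_comp (f := fst)).
have m2 : measurable_fun [set: (R * R) * R] (fun u => u.1.2).
  exact: (measurableT_comp (f := snd)).
have mi3 : measurable_fun [set: (R * R) * R] i3.
  apply: emeasurable_funM.
    apply/measurable_EFinP; apply: measurable_natb.
    by apply: measurable_and; apply: measurable_fun_ltr.
  by apply: (measurableT_comp mE); exact: measurable_fun_pair.
pose G (z : R * R) := (\int[mu]_y i3 (z, y))%E.
have mG : measurable_fun [set: R * R] G by exact: measurable_int_third.
have G0 z : (0 <= G z)%E by exact: integral_ge0.
have mi3t t x : measurable_fun [set: R] (fun y => i3 ((t, x), y)).
  exact: (measurableT_comp mi3 (measurable_pair1 (t, x))).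
have mGt t : measurable_fun [set: R] (fun x => G (t, x)).
  exact: (measurableT_comp mG (measurable_pair1 t)).
split; first exact: (measurable_int_right mG G0).
transitivity (\int[mu]_t \int[mu]_x (w t * G (t, x)))%E.
  apply: eq_integral => t _; apply/esym.
  exact: (ge0_integralZl mu measurableT (mGt t) (fun x _ => G0 (t, x)) (w0 t)).
have mwG : measurable_fun [set: R * R] (fun z => w z.1 * G z)%E.
  by apply: emeasurable_funM => //; exact: (measurableT_comp mw).
have wG0 t x : (0 <= w t * G (t, x))%E by exact: mule_ge0.
rewrite (ge0_fubini mwG wG0).
apply: eq_integral => x _.
pose k (z : R * R) := (w z.1 * i3 ((z.1, x), z.2))%E.
have mk : measurable_fun [set: R * R] k.
  apply: emeasurable_funM; first exact: (measurableT_comp mw).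
  apply: (measurableT_comp mi3); apply: measurable_fun_pair => //.
  exact: measurable_fun_pair.
transitivity (\int[mu]_t \int[mu]_y k (t, y))%E.
  apply: eq_integral => t _; apply/esym.
  exact: (ge0_integralZl mu measurableT (mi3t t x) (fun y _ => i30 ((t, x), y)) (w0 t)).
have k0 t y : (0 <= k (t, y))%E by exact: mule_ge0.
rewrite (@ge0_fubini (fun t y => k (t, y)) mk k0).
apply: eq_integral => y _.
have miw : measurable_fun [set: R] (fun t => (((y < t < x)%R%:R : R)%:E * w t)%E).
  apply: emeasurable_funM => //; apply/measurable_EFinP; apply: measurable_natb.
  by apply: measurable_and; exact: measurable_fun_ltr.
have iw0 t : (0 <= ((y < t < x)%R%:R : R)%:E * w t)%E by exact: mule_ge0.
rewrite -(ge0_integralZl mu measurableT miw (fun t _ => iw0 t) (E0 (x, y))).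
by apply: eq_integral => t _; rewrite /k /i3 /= [RHS]muleC muleA; congr (_ * _)%E; exact: muleC.
Qed.

End double_integrals.

(** * Double integrals over pairs separated by a point *)

Section half_planes.
Context {R : realType}.
Variable p : R.
Hypothesis hp : 0 < p < 1.
Notation mu := (@lebesgue_measure R).
Notation dker := (dker p).

Let p0 : 0 < p. Proof. by case/andP: hp. Qed.

Let p1 : p < 1. Proof. by case/andP: hp. Qed.

Definition cross (h1 h2 : R -> R) (z : R) : R :=
  \int[mu]_x \int[mu]_y ((y < z < x)%R%:R * (dker (x - y) * (h1 x * h2 y))).

Lemma cross_itg2 (h1 h2 : R -> R) : measurable_fun [set: R] h1 -> measurable_fun [set: R] h2 ->
  rapid h1 -> rapid h2 -> itg2 (fun x y => dker (x - y) * (h1 x * h2 y)).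
Proof.
move=> m1 m2 r1 r2; have [A A0 hA] := r2 2; have [M M0 hM] := dconv_abs hp A0 m2 hA.
have i1 := rapid_itg m1 r1; have id := dconv_itg hp A0 m2 hA.
have E x y : h1 x * (dker (x - y) * h2 y) = dker (x - y) * (h1 x * h2 y) by rewrite mulrCA.
apply: (itg2I (g := fun x => M * `|h1 x|)).
- apply: measurable_funM.
    by apply: (measurableT_comp (measurable_dker p)); exact: measurable_funB.
  by apply: measurable_funM; [exact: (measurableT_comp m1)|exact: (measurableT_comp m2)].
- by move=> x; apply: (eq_itg (E x)); exact: itgZ.
- exact/itgZ/itg_norm.
- move=> x; have E2 y : `|h1 x| * `|dker (x - y) * h2 y| = `|dker (x - y) * (h1 x * h2 y)|.
    by rewrite -normrM E.
  rewrite -(eq_int E2) (intZ _ (itg_norm (id x))) [M * _]mulrC.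
  by apply: ler_wpM2l => //; exact: hM.
Qed.

Let mlt1 (z : R) : measurable_fun [set: R * R] (fun w => z < w.1).
Proof. exact: (measurable_fun_ltr (measurable_cst z) measurable_fst). Qed.

Let mlt2 (z : R) : measurable_fun [set: R * R] (fun w => z < w.2).
Proof. exact: (measurable_fun_ltr (measurable_cst z) measurable_snd). Qed.

Let mgt2 (z : R) : measurable_fun [set: R * R] (fun w => w.2 < z).
Proof. exact: (measurable_fun_ltr measurable_snd (measurable_cst z)). Qed.

Lemma measurable_cross_ind (z : R) : measurable_fun [set: R * R] (fun w => w.2 < z < w.1).
Proof. exact: (measurable_and (mgt2 z) (mlt1 z)). Qed.

(* The kernel is odd, so its integral against a symmetric function over the quadrant
   [x > z, y > z] vanishes. *)
Lemma half_plane (h1 h2 : R -> R) (z : R) : measurable_fun [set: R] h1 -> measurable_fun [set: R] h2 ->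
  rapid h1 -> rapid h2 ->
  \int[mu]_x ((z < x)%R%:R * (h1 x * dconv p h2 x + h2 x * dconv p h1 x)) =
  cross h1 h2 z + cross h2 h1 z.
Proof.
move=> m1 m2 r1 r2; have i12 := cross_itg2 m1 m2 r1 r2; have i21 := cross_itg2 m2 m1 r2 r1.
pose S x y := dker (x - y) * (h1 x * h2 y) + dker (x - y) * (h2 x * h1 y).
have iS : itg2 S by exact: itg2D.
have Sa x y : S y x = - S x y by rewrite /S -[y - x]opprB dkerN; ring.
have [A A0 hA] := r1 2; have [B B0 hB] := r2 2.
have d1 := dconv_itg hp A0 m1 hA; have d2 := dconv_itg hp B0 m2 hB.
have s1 x : itg (fun y => dker (x - y) * (h1 x * h2 y)).
  by apply: (eq_itg _ (itgZ (h1 x) (d2 x))) => y; rewrite mulrCA.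
have s2 x : itg (fun y => dker (x - y) * (h2 x * h1 y)).
  by apply: (eq_itg _ (itgZ (h2 x) (d1 x))) => y; rewrite mulrCA.
have iSx x : itg (S x) by exact: itgD.
have E1 x : h1 x * dconv p h2 x + h2 x * dconv p h1 x = \int[mu]_y S x y.
  rewrite /S (intD (s1 x) (s2 x)) /dconv -(intZ _ (d1 x)) -(intZ _ (d2 x)).
  by congr (_ + _); apply: eq_int => y; rewrite mulrCA.
pose U x y := ((z < x) && (z < y))%R%:R * S x y.
pose W x y := ((y < z < x)%R)%:R * S x y.
have iU : itg2 U by apply: itg2_ind => //; exact: measurable_and.
have iW : itg2 W by apply: itg2_ind => //; exact: measurable_cross_ind.
have b1 (b : bool) : `|b%:R : R| <= 1 by case: b; rewrite ?normr1 ?normr0.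
have mU1 (x : R) : measurable_fun [set: R] (fun y : R => ((z < x) && (z < y))%R%:R : R).
  by apply: measurable_natb; apply: measurable_and => //; exact: measurable_fun_ltr.
have mW1 (x : R) : measurable_fun [set: R] (fun y : R => ((y < z < x)%R)%:R : R).
  by apply: measurable_natb; apply: measurable_and => //; exact: measurable_fun_ltr.
have iUx x : itg (U x) by exact: (itgMl (mU1 x) (fun y => b1 _) (iSx x)).
have iWx x : itg (W x) by exact: (itgMl (mW1 x) (fun y => b1 _) (iSx x)).
have E2 x : (z < x)%R%:R * \int[mu]_y S x y = \int[mu]_y U x y + \int[mu]_y W x y.
  rewrite -(intZ _ (iSx x)) -(intD (iUx x) (iWx x)); apply: int_ae.
  - exact: itg_meas (itgZ _ (iSx x)).
  - exact: itg_meas (itgD (iUx x) (iWx x)).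
  - apply: ae_mono (ae_neq z) => y yz; rewrite /U /W -mulrDl; congr (_ * _).
    by case: (z < x); case: ltgtP yz; rewrite ?andbF ?addr0 ?add0r.
have U0 : \int[mu]_x \int[mu]_y U x y = 0.
  have h : \int[mu]_x \int[mu]_y U x y = - \int[mu]_x \int[mu]_y U x y.
    rewrite {1}(real_fubini iU) -(intN (itg2_left iU)); apply: eq_int => y.
    by rewrite -(intN (iUx y)); apply: eq_int => x; rewrite /U Sa andbC mulrN.
  by move: h; move: (Rintegral _ _ _) => r; lra.
transitivity (\int[mu]_x (\int[mu]_y U x y + \int[mu]_y W x y)).
  by apply: eq_int => x; rewrite E1 E2.
rewrite (intD (itg2_left iU) (itg2_left iW)) U0 add0r /cross.
have c12 := @itg2_ind R (fun x y => y < z < x) _ (measurable_cross_ind z) i12.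
have c21 := @itg2_ind R (fun x y => y < z < x) _ (measurable_cross_ind z) i21.
rewrite -(intD (itg2_left c12) (itg2_left c21)); apply: eq_int => x.
rewrite -(intD (itgMl (mW1 x) (fun y => b1 _) (s1 x)) (itgMl (mW1 x) (fun y => b1 _) (s2 x))).
by apply: eq_int => y; rewrite /W /S mulrDr.
Qed.

(** As [y < z], the kernel is regular for [x >= z]; the condition [n z = 0] removes the boundary
    term at [z], and decay removes the one at infinity. *)
Lemma tail_ibp (n n' : R -> R) (y z : R) : y < z ->
  (forall x : R, is_derive x 1 n (n' x)) -> continuous n' -> rapid n -> rapid n' -> n z = 0 ->
  `|\int[mu]_x ((z < x)%R%:R * (dker (x - y) * n' x))| <=
  \int[mu]_x ((z < x)%R%:R * ((1 - p) * ((x - y) `^ (p - 2) * `|n x|))) /\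
  itg (fun x => (z < x)%R%:R * ((1 - p) * ((x - y) `^ (p - 2) * `|n x|))).
Proof.
move=> yz dn cn' rn rn' nz; have p1' := p1; have p0' := p0.
have cn : continuous n by move=> x; exact: (derivable_continuousW (dn x)).
have zy0 : 0 < z - y by rewrite subr_gt0.
have mlt : measurable_fun [set: R] (fun x : R => (z < x)%R%:R : R).
  by apply: measurable_natb; exact: measurable_fun_ltr.
have mpw c : measurable_fun [set: R] (fun x : R => (x - y) `^ c).
  by apply: measurable_powc; exact: measurable_funB.
have b1 (x : R) : `|(z < x)%R%:R : R| <= 1 by case: (z < x); rewrite ?normr1 ?normr0.
have pb c : c <= 0 -> forall x, `|(z < x)%R%:R * (x - y) `^ c| <= (z - y) `^ c.
  move=> c0 x; have [zx|_] := ltP z x; last by rewrite mul0r normr0 powR_ge0.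
  rewrite mul1r ger0_norm ?powR_ge0// -[c]opprK; apply: powR_anti => //; first by lra.
  by rewrite lerD2r ltW.
have pw c (h : R -> R) : c <= 0 -> itg h -> itg (fun x => (z < x)%R%:R * ((x - y) `^ c * h x)).
  move=> c0 ih; have := itgMl (measurable_funM mlt (mpw c)) (pb c c0) ih.
  by apply: eq_itg => x; rewrite mulrA.
have in_ := rapid_itg (continuous_measurable_fun cn) rn.
have in' := rapid_itg (continuous_measurable_fun cn') rn'.
have j1 : itg (fun x => (z < x)%R%:R * ((x - y) `^ (p - 2) * n x)) by apply: pw => //; lra.
have j2 : itg (fun x => (z < x)%R%:R * ((x - y) `^ (p - 1) * n' x)) by apply: pw => //; lra.
have j3 : itg (fun x => (z < x)%R%:R * ((1 - p) * ((x - y) `^ (p - 2) * `|n x|))).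
  have j : itg (fun x => (z < x)%R%:R * ((x - y) `^ (p - 2) * `|n x|)).
    by apply: pw; [lra|exact: itg_norm].
  by apply: (eq_itg _ (itgZ (1 - p) j)) => x; rewrite mulrCA.
split => //.
pose F x := (x - y) `^ (p - 1) * n x.
pose f x := (p - 1) * ((x - y) `^ (p - 2) * n x) + (x - y) `^ (p - 1) * n' x.
have cs x : z < x -> 0 < x - y by move=> zx; rewrite subr_gt0 (lt_trans yz).
have csub (x : R) : {for x, continuous (fun t => t - y)}.
  by apply: cvgB; [exact: cvg_id|exact: cvg_cst].
have cpw c x : 0 < x - y -> {for x, continuous (fun t => (t - y) `^ c)}.
  move=> xy0; apply: (@continuous_comp R R R (fun t => t - y) (fun t => t `^ c) x) => //.
  exact: continuous_powc.
have E x : (z < x)%R%:R * f x = (p - 1) * ((z < x)%R%:R * ((x - y) `^ (p - 2) * n x)) +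
    (z < x)%R%:R * ((x - y) `^ (p - 1) * n' x) by rewrite /f; ring.
have i_f : itg (fun x => (z < x)%R%:R * f x).
  by apply: (eq_itg (fun x => esym (E x))); apply: itgD => //; exact: itgZ.
have Z : \int[mu]_x ((z < x)%R%:R * f x) = 0 - F z.
  have [A A0 hA] := rn 1.
  apply: (ftc_tail _ _ _ _ i_f).
  - move=> x zx; have d1 : is_derive x 1 (fun t => t - y) 1.
      by apply: (isd_eq (isdB (isd_id x) (isd_cst y x))); rewrite subr0.
    have d2 := @isd_comp R (fun t => t `^ (p - 1)) (fun t => t - y) x _ _ (is_derive1_powR (p - 1) (cs x zx)) d1.
    apply: (isd_eq (isdM d2 (dn x))); rewrite /f (_ : p - 1 - 1 = p - 2); last by ring.
    by ring.
  - move=> x zx; apply: cvgD; last by apply: cvgM; [exact: cpw (cs x zx)|exact: cn'].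
    by apply: cvgMr; apply: cvgM; [exact: cpw (cs x zx)|exact: cn].
  - by apply: cvgM; [exact: cpw|exact: cn].
  - pose B := (z - y) `^ (p - 1) * A.
    have C : B * (1 + `|z + k.+1%:R|) `^ (- 1) @[k --> \oo] --> (0 : R).
      by rewrite -[X in _ --> X](mulr0 B); apply: cvgMr; exact: wt_tail.
    apply: (cvg0_le _ C) => k; rewrite /F normrM /B -mulrA; apply: ler_pM => //.
    have zk : z < z + k.+1%:R by rewrite ltrDl.
    have pm : p - 1 <= 0 by lra.
    by have := pb _ pm (z + k.+1%:R); rewrite zk mul1r.
have e : \int[mu]_x ((z < x)%R%:R * (dker (x - y) * n' x)) =
    (1 - p) * \int[mu]_x ((z < x)%R%:R * ((x - y) `^ (p - 2) * n x)).
  have -> : \int[mu]_x ((z < x)%R%:R * (dker (x - y) * n' x)) =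
      \int[mu]_x ((z < x)%R%:R * ((x - y) `^ (p - 1) * n' x)).
    by apply: eq_int => x; have [zx|_] := ltP z x; rewrite ?mul0r// dker_gt0// cs.
  move: Z; rewrite (eq_int E) (intD (itgZ _ j1) j2) (intZ _ j1) /F nz mulr0 subr0.
  move: (Rintegral _ _ _) (Rintegral _ _ _) => r1 r2; lra.
rewrite e -intZ//; apply: int_norm_le => //; first exact: itgZ.
move=> x; rewrite normrM ger0_norm; last by lra.
rewrite !normrM [X in _ * (X * _) <= _]ger0_norm ?ler0n//.
by rewrite [X in _ * (_ * (X * _)) <= _]ger0_norm ?powR_ge0// mulrCA.
Qed.

Lemma tail_ibp_left (n n' : R -> R) (x z : R) : z < x ->
  (forall x : R, is_derive x 1 n (n' x)) -> continuous n' -> rapid n -> rapid n' -> n z = 0 ->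
  `|\int[mu]_y ((y < z)%R%:R * (dker (x - y) * n' y))| <=
  \int[mu]_y ((y < z)%R%:R * ((1 - p) * ((x - y) `^ (p - 2) * `|n y|))) /\
  itg (fun y => (y < z)%R%:R * ((1 - p) * ((x - y) `^ (p - 2) * `|n y|))).
Proof.
move=> zx dn cn' rn rn' nz.
pose k y := n (- y); pose k' y := - n' (- y).
have dk (y : R) : is_derive y 1 k (k' y).
  have d1 : is_derive y 1 (fun y => - y) (-1) by apply: isdN; exact: isd_id.
  by apply: (isd_eq (isd_comp (dn (- y)) d1)); rewrite mulrN1.
have ck' : continuous k'.
  move=> y; apply: cvgN; have c : - z @[z --> y] --> - y by apply: cvgN; exact: cvg_id.
  exact: (cvg_comp _ _ c (cn' (- y))).
have rk : rapid k.
  by move=> c; have [A A0 hA] := rn c; exists A => // y; have := hA (- y); rewrite normrN.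
have rk' : rapid k'.
  by move=> c; have [A A0 hA] := rn' c; exists A => // y; rewrite normrN; have := hA (- y); rewrite normrN.
have kz : k (- z) = 0 by rewrite /k opprK.
have xz : - x < - z by rewrite ltrN2.
have [h i] := tail_ibp xz dk ck' rk rk' kz.
have E y : (- z < 0 - y)%R%:R * ((1 - p) * ((0 - y - - x) `^ (p - 2) * `|k (0 - y)|)) =
    (y < z)%R%:R * ((1 - p) * ((x - y) `^ (p - 2) * `|n y|)).
  by rewrite sub0r ltrN2 /k !opprK [- y + x]addrC.
have j := itg_refl 0 i.
split; last exact: (eq_itg E j).
rewrite -(eq_int E) (int_refl 0 i); apply: le_trans h.
have id : itg (fun y => (- z < y)%R%:R * (dker (y - - x) * k' y)).
  have [A A0 hA] := rk' 2; have mk' := continuous_measurable_fun ck'.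
  have id := dconv_itg hp A0 mk' hA (- x).
  have ml : measurable_fun [set: R] (fun y : R => (- z < y)%R%:R : R).
    by apply: measurable_natb; exact: measurable_fun_ltr.
  have bl (y : R) : `|(- z < y)%R%:R : R| <= 1 by case: (- z < y); rewrite ?normr1 ?normr0.
  apply: (eq_itg _ (itgN (itgMl ml bl id))) => y.
  by rewrite -[y - - x]opprB (_ : - (- x - y) = - (- x - y))// dkerN; ring.
have il : itg (fun y => (y < z)%R%:R * (dker (x - y) * n' y)).
  have [A A0 hA] := rn' 2; have mn' := continuous_measurable_fun cn'.
  have ml : measurable_fun [set: R] (fun y : R => (y < z)%R%:R : R).
    by apply: measurable_natb; exact: measurable_fun_ltr.
  have bl (y : R) : `|(y < z)%R%:R : R| <= 1 by case: (y < z); rewrite ?normr1 ?normr0.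
  exact: itgMl ml bl (dconv_itg hp A0 mn' hA x).
rewrite -(int_refl 0 id) -normrN -(intN il).
rewrite le_eqVlt; apply/orP; left; apply/eqP; congr (`|_|); apply: eq_int => y.
by rewrite sub0r ltrN2 /k' !opprK [- y + x]addrC; ring.
Qed.

End half_planes.

(** * Decaying antiderivatives and nonnegative double integrals *)

Section tails.
Context {R : realType}.
Notation mu := (@lebesgue_measure R).

Lemma continuous_int0 (f : R -> R) : continuous f -> itg f -> (forall x, 0 <= f x) ->
  \int[mu]_x f x = 0 -> forall x, f x = 0.
Proof.
move=> cf i f0 e.
have z : (\int[mu]_x `|(f x)%:E| = 0)%E.
  transitivity (\int[mu]_x (f x)%:E)%E.
    by apply: eq_integral => x _; rewrite gee0_abs// lee_fin.
  by rewrite (intE i) e.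
have mf : measurable_fun [set: R] (fun x => (f x)%:E).
  by apply/measurable_EFinP; exact: (itg_meas i).
have ae0 := proj1 (ae_eq_integral_abs mu measurableT mf) z.
have oU : open (f @^-1` [set x | x != 0]).
  apply: open_comp; first by move=> x _; exact: cf.
  exact: open_neq.
move=> x; apply/eqP/negPn/negP => fx.
apply: (ae_open_empty oU _ fx); apply: ae_mono ae0 => y h /= fy.
by have := h I => -[h0]; rewrite h0 eqxx in fy.
Qed.

(** For [x < 0] the vanishing mean replaces the integral over [t > x] by minus the one over
    [t <= x]. Either way [|x| <= |t|] on the domain, and part of the decay in [t] can be traded for
    decay in [x]. *)
Lemma tail_rapid (h : R -> R) : continuous h -> rapid h -> \int[mu]_t h t = 0 ->
  rapid (fun x => \int[mu]_t ((x < t)%R%:R * h t)).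
Proof.
move=> ch rh h0 k; have [A A0 hA] := rh (`|k| + 2).
have l12 : (1 : R) < 2 by lra.
have ih := rapid_itg (continuous_measurable_fun ch) rh.
have iw := @itg_wt R _ l12; pose W := \int[mu]_t (1 + `|t|) `^ (- 2 : R).
have W0 : 0 <= W by apply: int_ge0 => t; exact: powR_ge0.
have mlt (x : R) : measurable_fun [set: R] (fun t : R => (x < t)%R%:R : R).
  by apply: measurable_natb; exact: measurable_fun_ltr.
have mle (x : R) : measurable_fun [set: R] (fun t : R => (t <= x)%R%:R : R).
  by apply: measurable_natb; exact: measurable_fun_ler.
have b1 (b : bool) : `|b%:R : R| <= 1 by case: b; rewrite ?normr1 ?normr0.
have bd (b : bool) (x t : R) : (b -> `|x| <= `|t|) ->
    `|b%:R * h t| <= A * (1 + `|x|) `^ (- k) * (1 + `|t|) `^ (- 2).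
  move=> bxt; have w0 := ltW (wt_gt0 (- k) x); have w1 := ltW (wt_gt0 (- 2) t).
  case: b bxt => [/(_ isT) xt|_]; last by rewrite mul0r normr0 !mulr_ge0.
  rewrite mul1r; apply: le_trans (hA t) _; rewrite opprD -wt_mul -mulrA.
  apply: ler_wpM2l => //; apply: ler_wpM2r => //.
  apply: (@le_trans _ _ ((1 + `|x|) `^ (- `|k|))).
    by apply: powR_anti; [by []|by rewrite ltr_pwDl|by rewrite lerD2l].
  by apply: wt_le; rewrite lerN2 ler_norm.
exists (A * W); first exact: mulr_ge0.
move=> x; rewrite mulrAC -(intZ _ iw).
have [x0|x0] := leP 0 x.
  apply: int_norm_le; [exact: (itgMl (mlt x) (fun t => b1 _) ih)|exact: itgZ|move=> t].
  apply: bd => xt; rewrite !ger0_norm//; [exact: ltW|exact: le_trans (ltW xt)].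
have E : \int[mu]_t ((x < t)%R%:R * h t) = - \int[mu]_t ((t <= x)%R%:R * h t).
  have i1 := itgMl (mlt x) (fun t => b1 _) ih; have i2 := itgMl (mle x) (fun t => b1 _) ih.
  apply/eqP; rewrite -addr_eq0 -(intD i1 i2) -h0; apply/eqP; apply: eq_int => t.
  by rewrite -mulrDl; case: ltP => _; rewrite ?addr0 ?add0r mul1r.
rewrite E normrN; apply: int_norm_le; [exact: (itgMl (mle x) (fun t => b1 _) ih)|exact: itgZ|move=> t].
apply: bd => tx; rewrite !ltr0_norm//; [by rewrite lerN2|exact: le_lt_trans tx x0].
Qed.

Lemma tail_derive (h : R -> R) (x : R) : continuous h -> itg h ->
  is_derive x 1 (fun x => \int[mu]_t ((x < t)%R%:R * h t)) (- h x).
Proof.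
move=> ch ih; apply: (isd_int (G := fun x => - h x)).
  by move=> y; apply: cvgN; exact: ch.
move=> a b ab.
have mlt (c : R) : measurable_fun [set: R] (fun t : R => (c < t)%R%:R : R).
  by apply: measurable_natb; exact: measurable_fun_ltr.
have b1 (c : bool) : `|c%:R : R| <= 1 by case: c; rewrite ?normr1 ?normr0.
have ia := itgMl (mlt a) (fun t => b1 _) ih; have ib := itgMl (mlt b) (fun t => b1 _) ih.
rewrite -(intB ib ia); apply: int_ae.
- exact: itg_meas (itgB ib ia).
- apply: measurable_funM; first exact: measurable_itv_ind.
  by apply: measurableT_comp => //; exact: itg_meas ih.
apply: ae_mono (ae_neq b) => t tb; rewrite -mulrBl mulrN -mulNr; congr (_ * _).
have [at_|ta] := ltP a t.
  by case: ltgtP tb => // _ _; rewrite ?subrr ?oppr0 ?sub0r.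
by rewrite (lt_gtF (le_lt_trans ta ab)) /= subrr oppr0.
Qed.

Lemma ge0_int2D (f g : R -> R -> \bar R) :
  measurable_fun [set: R * R] (fun z => f z.1 z.2) ->
  measurable_fun [set: R * R] (fun z => g z.1 z.2) ->
  (forall x y, 0 <= f x y)%E -> (forall x y, 0 <= g x y)%E ->
  (\int[mu]_x \int[mu]_y f x y + \int[mu]_x \int[mu]_y g x y =
   \int[mu]_x \int[mu]_y (f x y + g x y))%E.
Proof.
move=> mf mg f0 g0.
have m1 := measurable_int_right mf (fun z => f0 z.1 z.2).
have m2 := measurable_int_right mg (fun z => g0 z.1 z.2).
have i1 x : (0 <= \int[mu]_y f x y)%E by exact: integral_ge0.
have i2 x : (0 <= \int[mu]_y g x y)%E by exact: integral_ge0.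
rewrite -(ge0_integralD mu measurableT (fun x _ => i1 x) m1 (fun x _ => i2 x) m2).
apply: eq_integral => x _.
have n1 : measurable_fun [set: R] (fun y => f x y) := measurableT_comp mf (measurable_pair1 x).
have n2 : measurable_fun [set: R] (fun y => g x y) := measurableT_comp mg (measurable_pair1 x).
by rewrite -(ge0_integralD mu measurableT (fun y _ => f0 x y) n1 (fun y _ => g0 x y) n2).
Qed.

Lemma ge0_int2_le (f g : R -> R -> \bar R) :
  measurable_fun [set: R * R] (fun z => f z.1 z.2) ->
  measurable_fun [set: R * R] (fun z => g z.1 z.2) ->
  (forall x y, 0 <= f x y)%E -> (forall x y, f x y <= g x y)%E ->
  (\int[mu]_x \int[mu]_y f x y <= \int[mu]_x \int[mu]_y g x y)%E.
Proof.
move=> mf mg f0 fg.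
have g0 x y : (0 <= g x y)%E by exact: le_trans (f0 x y) (fg x y).
have m1 := measurable_int_right mf (fun z => f0 z.1 z.2).
have m2 := measurable_int_right mg (fun z => g0 z.1 z.2).
have i1 x : (0 <= \int[mu]_y f x y)%E by exact: integral_ge0.
apply: (ge0_le_integral mu measurableT (fun x _ => i1 x) m1 m2) => x _.
have n1 : measurable_fun [set: R] (fun y => f x y) := measurableT_comp mf (measurable_pair1 x).
have n2 : measurable_fun [set: R] (fun y => g x y) := measurableT_comp mg (measurable_pair1 x).
exact: (ge0_le_integral mu measurableT (fun y _ => f0 x y) n1 n2 (fun y _ => fg x y)).
Qed.

End tails.

(** * The contraction argument *)

Section nondegeneracy.
Context {R : realType}.
Variable p : R.
Hypothesis hp : 0 < p < 1.
Notation mu := (@lebesgue_measure R).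
Notation dker := (dker p).

Let p0 : 0 < p. Proof. by case/andP: hp. Qed.

Let p1 : p < 1. Proof. by case/andP: hp. Qed.

Variables (C a0 : R) (v V : R -> R).
Hypothesis C0 : 0 < C.
Hypothesis VE : forall x, V x = expR (v x).
Hypothesis iV : itg V.
Hypothesis vE : forall x, v x = a0 - C * pot p V x.

Notation T := (slope p C V).
Notation kernel := (kernel_element p C V).

Let V0 x : 0 < V x. Proof. exact: (sol_gt0 VE x). Qed.

Let rV : rapid V. Proof. exact: (sol_rapid hp C0 VE iV vE). Qed.

Let cV : continuous V. Proof. exact: (sol_continuous hp VE iV vE). Qed.

Let cT : continuous T. Proof. exact: (slope_continuous hp C0 VE iV vE). Qed.

Let dV (x : R) : is_derive x 1 V (V x * T x). Proof. exact: (sol_derive hp C0 VE iV vE x). Qed.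

Let mV : measurable_fun [set: R] V. Proof. exact: itg_meas iV. Qed.

Let a := C * p.

Let a_gt0 : 0 < a. Proof. exact: mulr_gt0. Qed.

Lemma kernel_cross chi (z : R) : kernel chi ->
  V z * chi z = a * (cross p (fun x => V x * chi x) V z + cross p V (fun x => V x * chi x) z).
Proof.
move=> kc; pose h x := V x * chi x.
have rh : rapid h := kernel_rapid hp C0 VE iV vE kc.
have ch : continuous h := kernel_continuousM hp VE iV vE kc.
have [M M0 hM] := slope_bound hp C0 VE iV vE.
have [N N0 hN] := kernel_slope_bound hp C0 VE iV vE kc.
pose h' x := h x * T x + V x * kernel_slope p C V chi x.
have dh (x : R) : is_derive x 1 h (h' x).
  have d := kernel_derive hp C0 VE iV vE x kc.
  by apply: (isd_eq (isdM (dV x) d)); rewrite /h' /h; ring.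
have ch' : continuous h'.
  move=> x; apply: cvgD; apply: cvgM; [exact: ch|exact: cT|exact: cV|].
  exact: (kernel_slope_continuous hp C0 VE iV vE kc).
have rh' : rapid h'.
  by apply: rapidD; [exact: (rapid_mul rh M0 hM)|exact: (rapid_mul rV N0 hN)].
have t := rapid_tail z dh ch' rh rh'.
rewrite -(half_plane hp z (continuous_measurable_fun ch) mV rh rV).
have ii : itg (fun x => (z < x)%R%:R * h' x).
  apply: (itgMl (C := 1) _ _ (rapid_itg (continuous_measurable_fun ch') rh')).
    by apply: measurable_natb; exact: measurable_fun_ltr.
  by move=> x; case: (z < x); rewrite ?normr1 ?normr0.
have hz : h z = \int[mu]_x (-1 * ((z < x)%R%:R * h' x)) by rewrite (intZ _ ii) t; ring.
have ip : itg (fun x => (z < x)%R%:R * (h x * dconv p V x + V x * dconv p h x)).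
  have E x : - a^-1 * h' x = h x * dconv p V x + V x * dconv p h x.
    by rewrite /h' /slope /kernel_slope -/a -/h; field; rewrite gt_eqF.
  apply: (itgMl (C := 1)).
  - by apply: measurable_natb; exact: measurable_fun_ltr.
  - by move=> x; case: (z < x); rewrite ?normr1 ?normr0.
  - exact: (eq_itg E (itgZ _ (rapid_itg (continuous_measurable_fun ch') rh'))).
rewrite -/(h z) hz -(intZ a ip); apply: eq_int => x.
by rewrite /h' /slope /kernel_slope -/a -/h; ring.
Qed.

Lemma sol_cross (z : R) : V z = a * cross p V V z.
Proof.
have [M M0 hM] := slope_bound hp C0 VE iV vE.
have rh' : rapid (fun x => V x * T x) by exact: (rapid_mul rV M0 hM).
have ch' : continuous (fun x => V x * T x).
  by move=> x; apply: cvgM; [exact: cV|exact: cT].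
have t := rapid_tail z dV ch' rV rh'.
have hpl := half_plane hp z mV mV rV rV.
have ih' := rapid_itg (continuous_measurable_fun ch') rh'.
have ii : itg (fun x => (z < x)%R%:R * (V x * T x)).
  apply: (itgMl (C := 1) _ _ ih').
    by apply: measurable_natb; exact: measurable_fun_ltr.
  by move=> x; case: (z < x); rewrite ?normr1 ?normr0.
(* With both functions equal to [V], the symmetric expression in [half_plane] is twice
   [V * dconv p V]. *)
have E : - (2 * a^-1) * \int[mu]_x ((z < x)%R%:R * (V x * T x)) = cross p V V z + cross p V V z.
  rewrite -hpl -intZ//; apply: eq_int => x.
  by rewrite /slope -/a; field; rewrite gt_eqF.
move: E; rewrite t; move: (cross _ _ _ _) => c E.
have -> : c = a^-1 * V z by move: E; move: (a^-1) => b E; lra.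
by rewrite mulrA mulfV ?mul1r// gt_eqF.
Qed.

(* [psi] is a multiple of [T] iff [eta = m / V] is constant, where [m' = - V psi]; the function
   to be shown zero is [q = V eta']. *)
Section mean_zero.
Variable psi : R -> R.
Hypothesis kpsi : kernel psi.
Hypothesis psi0 : \int[mu]_x (V x * psi x) = 0.

Let h x := V x * psi x.

Let rh : rapid h. Proof. exact: (kernel_rapid hp C0 VE iV vE kpsi). Qed.

Let ch : continuous h. Proof. exact: (kernel_continuousM hp VE iV vE kpsi). Qed.

Let m (x : R) := \int[mu]_t ((x < t)%R%:R * h t).

Let rm : rapid m. Proof. exact: (tail_rapid ch rh psi0). Qed.

Let dm (x : R) : is_derive x 1 m (- h x).
Proof. exact: (tail_derive x ch (rapid_itg (continuous_measurable_fun ch) rh)). Qed.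

Let cm : continuous m. Proof. by move=> x; exact: (derivable_continuousW (dm x)). Qed.

Let eta x := m x / V x.

Let g x := - psi x - eta x * T x.

Let q x := V x * g x.

Let etaV x : V x * eta x = m x.
Proof. by rewrite /eta mulrCA mulfV ?mulr1// gt_eqF. Qed.

Let d_eta (x : R) : is_derive x 1 eta (g x).
Proof.
have Vn0 : V x != 0 by rewrite gt_eqF.
apply: (isd_eq (isdM (dm x) (isdV Vn0 (dV x)))).
by rewrite /g /eta /h; field.
Qed.

Let c_eta : continuous eta. Proof. by move=> x; exact: (derivable_continuousW (d_eta x)). Qed.

Let cg : continuous g.
Proof.
have [cp _ _] := kpsi.
move=> x; apply: cvgB; first by apply: cvgN; exact: cp.
by apply: cvgM; [exact: c_eta|exact: cT].
Qed.

Let qE x : q x = - h x - m x * T x.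
Proof. by rewrite /q /g -etaV /h; ring. Qed.

Let cq : continuous q.
Proof. by move=> x; apply: cvgM; [exact: cV|exact: cg]. Qed.

Let rq : rapid q.
Proof.
have [M M0 hM] := slope_bound hp C0 VE iV vE.
have r := rapidD (rapidZ (-1) rh) (rapidZ (-1) (rapid_mul rm M0 hM)).
move=> k; have [A A0 hA] := r k; exists A => // x.
by have := hA x; rewrite qE !mulN1r.
Qed.

Let iq : itg q. Proof. exact: (rapid_itg (continuous_measurable_fun cq) rq). Qed.

Let Gam y x : R := \int[mu]_t ((y < t < x)%R%:R * `|g t|).

Let c_ng : continuous (fun t => `|g t|).
Proof. by move=> x; exact: (cvg_norm (@cg x)). Qed.

Let iGam y x : itg (fun t => (y < t < x)%R%:R * `|g t|).
Proof.
have i := loc_itvcc y x (loc_continuous c_ng).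
apply: (itg_le _ i).
  by apply: measurable_funM; [exact: measurable_itv_ind|exact: continuous_measurable_fun].
move=> t; rewrite normrM normr_id; apply: ler_wpM2r => //.
have [/andP[h1 h2]|_] := boolP (y < t < x); last by rewrite normr0 ler0n.
by rewrite normr1 (ltW h1) (ltW h2).
Qed.

Let Gam_ge0 y x : 0 <= Gam y x.
Proof. by apply: int_ge0 => t; rewrite mulr_ge0 ?ler0n. Qed.

Let eta_diff y x : y <= x -> `|eta x - eta y| <= Gam y x.
Proof.
move=> yx; rewrite -(ftc_itvcc yx (fun t _ => d_eta t) (fun t _ => @cg t)).
rewrite itvcc_oo_ae; last exact: continuous_measurable_fun.
have i : itg (fun t => (y < t < x)%R%:R * g t).
  apply: (itg_le _ (iGam y x)).
    by apply: measurable_funM; [exact: measurable_itv_ind|exact: continuous_measurable_fun].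
  by move=> t; rewrite normrM ger0_norm ?ler0n.
apply: int_norm_le => // t; by rewrite normrM ger0_norm ?ler0n.
Qed.

Let Gam_split y z x : y < z -> z < x -> Gam z x + Gam y z <= Gam y x.
Proof.
move=> yz zx; rewrite /Gam -intD//; apply: int_le => //; first exact: itgD.
move=> t; rewrite -mulrDl; apply: ler_wpM2r => //.
have [h1|h1] := ltP t z; have [h2|h2] := ltP z t; rewrite /= ?andbT ?andbF.
- by have := lt_trans h1 h2; rewrite ltxx.
- by rewrite add0r (lt_trans h1 zx) andbT.
- by rewrite addr0 (lt_trans yz h2).
- by rewrite addr0 ler0n.
Qed.

Let mpw (c : R) : measurable_fun [set: R * R] (fun z : R * R => (z.1 - z.2) `^ c).
Proof. by apply: measurable_powc; exact: measurable_funB. Qed.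

Let mind (z : R) : measurable_fun [set: R * R] (fun w : R * R => (w.2 < z < w.1)%R%:R : R).
Proof. by apply: measurable_natb; exact: measurable_cross_ind. Qed.

Let q1 : 0 <= 1 - p. Proof. by rewrite subr_ge0 ltW. Qed.

Let k1 (x y : R) : R := a * (1 - p) * (x - y) `^ (p - 2).

Let k1_ge0 x y : 0 <= k1 x y.
Proof. exact: (mulr_ge0 (mulr_ge0 (ltW a_gt0) q1) (powR_ge0 _ _)). Qed.

(** The density in the bound for [q]. The variation of [eta] is kept as an extended integral in [t],
    in the form in which [tonelli_between] handles it. *)
Let D (w : R * R) : \bar R :=
  ((k1 w.1 w.2 * (V w.1 * V w.2))%:E * \int[mu]_t (((w.2 < t < w.1)%R%:R)%:E * (`|g t|)%:E))%E.

Let DE x y : D (x, y) = (k1 x y * (V x * V y) * Gam y x)%:E.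
Proof.
rewrite /D /=; have -> : (\int[mu]_t (((y < t < x)%R%:R)%:E * (`|g t|)%:E) = (Gam y x)%:E)%E.
  by rewrite /Gam -(intE (iGam y x)); apply: eq_integral => t _; rewrite EFinM.
by rewrite -EFinM.
Qed.

Let D_ge0 w : (0 <= D w)%E.
Proof.
case: w => x y; rewrite DE lee_fin.
exact: (mulr_ge0 (mulr_ge0 (k1_ge0 _ _) (mulr_ge0 (ltW (V0 x)) (ltW (V0 y)))) (Gam_ge0 _ _)).
Qed.

Let mV1 : measurable_fun [set: R * R] (fun w : R * R => V w.1).
Proof. exact: (measurableT_comp mV). Qed.

Let mV2 : measurable_fun [set: R * R] (fun w : R * R => V w.2).
Proof. exact: (measurableT_comp mV). Qed.

Let mD : measurable_fun [set: R * R] D.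
Proof.
apply: emeasurable_funM.
  by apply/measurable_EFinP; apply: measurable_funM => //; exact: measurable_funM.
pose f (u : (R * R) * R) := (((u.1.2 < u.2 < u.1.1)%R%:R : R)%:E * (`|g u.2|)%:E)%E.
have mf : measurable_fun [set: (R * R) * R] f.
  apply: emeasurable_funM; apply/measurable_EFinP.
    apply: measurable_natb; apply: measurable_and; apply: measurable_fun_ltr => //.
      exact: (measurableT_comp (f := snd)).
    exact: (measurableT_comp (f := fst)).
  exact: (measurableT_comp (continuous_measurable_fun c_ng)).
have f0 u : (0 <= f u)%E by rewrite mule_ge0// lee_fin.
exact: (measurable_int_third mf f0).
Qed.

Let n z x := eta z * V x - m x.

(** Since [m = V eta], [n z x] is [V x * (eta z - eta x)], and the variations of [eta] on []y, z[]
    and []z, x[] add up to at most the one on []y, x[]. *)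
Let pointwise (z x y : R) : y < z -> z < x ->
  V y * `|n z x| + V x * `|n z y| <= V x * V y * Gam y x.
Proof.
move=> yz zx; have Vx := ltW (V0 x); have Vy := ltW (V0 y).
have E1 : `|n z x| = V x * `|eta x - eta z|.
  by rewrite /n -etaV mulrC -mulrBr normrM distrC ger0_norm.
have E2 : `|n z y| = V y * `|eta z - eta y|.
  by rewrite /n -etaV mulrC -mulrBr normrM ger0_norm.
rewrite E1 E2 [V y * (V x * _)]mulrCA [V x * (V y * _)]mulrA mulrA -mulrDr.
apply: ler_wpM2l; first exact: mulr_ge0.
apply: le_trans (Gam_split yz zx); apply: lerD; apply: eta_diff; exact: ltW.
Qed.

Let chi z x := 1 * psi x + eta z * T x.

Let kchi z : kernel (chi z).
Proof. exact: (kernel_lin hp _ _ kpsi (slope_kernel hp C0 VE iV vE)). Qed.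

Let w z x := V x * chi z x.

Let dn z (x : R) : is_derive x 1 (n z) (w z x).
Proof.
by apply: (isd_eq (isdB (isdZ (eta z) (dV x)) (dm x))); rewrite /w /chi /h; ring.
Qed.

Let rw z : rapid (w z). Proof. exact: (kernel_rapid hp C0 VE iV vE (kchi z)). Qed.

Let cw z : continuous (w z). Proof. exact: (kernel_continuousM hp VE iV vE (kchi z)). Qed.

Let mw z : measurable_fun [set: R] (w z). Proof. exact: (continuous_measurable_fun (@cw z)). Qed.

Let rn z : rapid (n z).
Proof.
have r := rapidD (rapidZ (eta z) rV) (rapidZ (-1) rm).
move=> k; have [A A0 hA] := r k; exists A => // x.
by have := hA x; rewrite /n !mulN1r.
Qed.

Let mn z : measurable_fun [set: R] (n z).
Proof. by apply: continuous_measurable_fun => x; exact: (derivable_continuousW (dn z x)). Qed.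

Let nz z : n z z = 0. Proof. by rewrite /n -etaV mulrC subrr. Qed.

(** The majorant after integration by parts in [x]; [e2] below is its counterpart for integration by
    parts in [y]. *)
Let e1 z x y : R := (y < z < x)%R%:R * ((1 - p) * ((x - y) `^ (p - 2) * (V y * `|n z x|))).

Let e2 z x y : R := (y < z < x)%R%:R * ((1 - p) * ((x - y) `^ (p - 2) * (V x * `|n z y|))).

Let e1_ge0 z x y : 0 <= e1 z x y.
Proof. by rewrite /e1 !mulr_ge0 ?ler0n ?q1 ?powR_ge0 ?(ltW (V0 _)). Qed.

Let e2_ge0 z x y : 0 <= e2 z x y.
Proof. by rewrite /e2 !mulr_ge0 ?ler0n ?q1 ?powR_ge0 ?(ltW (V0 _)). Qed.

Let e1E z x y : (0 <= (e1 z x y)%:E)%E. Proof. by rewrite lee_fin. Qed.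

Let e2E z x y : (0 <= (e2 z x y)%:E)%E. Proof. by rewrite lee_fin. Qed.

Let me1 z : measurable_fun [set: R * R] (fun u => (e1 z u.1 u.2)%:E).
Proof.
apply/measurable_EFinP; apply: measurable_funM; first exact: mind.
apply: measurable_funM => //; apply: measurable_funM; first exact: mpw.
apply: measurable_funM; first exact: mV2.
by apply: measurableT_comp => //; exact: (measurableT_comp (mn z)).
Qed.

Let me2 z : measurable_fun [set: R * R] (fun u => (e2 z u.1 u.2)%:E).
Proof.
apply/measurable_EFinP; apply: measurable_funM; first exact: mind.
apply: measurable_funM => //; apply: measurable_funM; first exact: mpw.
apply: measurable_funM; first exact: mV1.
by apply: measurableT_comp => //; exact: (measurableT_comp (mn z)).
Qed.

Let cross1 z : ((`|cross p (w z) V z|)%:E <= \int[mu]_x \int[mu]_y (e1 z x y)%:E)%E.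
Proof.
have i2 := @itg2_ind R (fun x y => y < z < x) _ (measurable_cross_ind z)
  (cross_itg2 hp (mw z) mV (rw z) rV).
(* The order is exchanged so that [x] is integrated first, at fixed [y < z], where [tail_ibp]
   applies. *)
rewrite /cross (real_fubini i2) (@ge0_fubini R (fun x y => (e1 z x y)%:E) (me1 z) (e1E z)).
apply: le_trans (abs_int_le (itg_meas (itg2_right i2))) _.
have me1' : measurable_fun [set: R] (fun y => \int[mu]_x (e1 z x y)%:E)%E.
  exact: (measurable_int_left (me1 z) (fun u => e1E z u.1 u.2)).
apply: (ge0_le_integral mu measurableT) => //.
  by apply/measurable_EFinP; apply: measurableT_comp => //; exact: (itg_meas (itg2_right i2)).
move=> y _; have [yz|zy] := ltP y z; last first.
  rewrite (eq_int (g := fun _ => 0)) ?int0 ?normr0; last by move=> x; rewrite mul0r.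
  by apply: integral_ge0 => x _; exact: e1_ge0.
have [ib ii] := tail_ibp hp yz (dn z) (@cw z) (@rn z) (rw z) (nz z).
have E1 x : V y * ((z < x)%R%:R * (dker (x - y) * w z x)) =
    (true && (z < x))%R%:R * (dker (x - y) * (w z x * V y)) by rewrite /=; ring.
have E2 x : V y * ((z < x)%R%:R * ((1 - p) * ((x - y) `^ (p - 2) * `|n z x|))) = e1 z x y.
  by rewrite /e1 yz /=; ring.
have -> : (\int[mu]_x (e1 z x y)%:E = (V y * \int[mu]_x ((z < x)%R%:R * ((1 - p) * ((x - y) `^ (p - 2) * `|n z x|))))%:E)%E.
  rewrite -(intZ _ ii) -(intE (itgZ _ ii)); apply: eq_integral => x _.
  by rewrite E2.
have iw : itg (fun x => (z < x)%R%:R * (dker (x - y) * w z x)).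
  have [A A0 hA] := rw z 2.
  apply: (itgMl (C := 1)).
  - by apply: measurable_natb; exact: measurable_fun_ltr.
  - by move=> x; case: (z < x); rewrite ?normr1 ?normr0.
  - have := itgN (dconv_itg hp A0 (mw z) hA y); apply: eq_itg => x.
    by rewrite -[y - x]opprB dkerN; ring.
rewrite -(eq_int E1) (intZ _ iw) normrM (gtr0_norm (V0 y)) lee_fin.
by apply: ler_wpM2l => //; exact: ltW.
Qed.

Let cross2 z : ((`|cross p V (w z) z|)%:E <= \int[mu]_x \int[mu]_y (e2 z x y)%:E)%E.
Proof.
have i2 := @itg2_ind R (fun x y => y < z < x) _ (measurable_cross_ind z)
  (cross_itg2 hp mV (mw z) rV (rw z)).
rewrite /cross; apply: le_trans (abs_int_le (itg_meas (itg2_left i2))) _.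
have me2' : measurable_fun [set: R] (fun x => \int[mu]_y (e2 z x y)%:E)%E.
  exact: (measurable_int_right (me2 z) (fun u => e2E z u.1 u.2)).
apply: (ge0_le_integral mu measurableT) => //.
  by apply/measurable_EFinP; apply: measurableT_comp => //; exact: (itg_meas (itg2_left i2)).
move=> x _; have [zx|xz] := ltP z x; last first.
  rewrite (eq_int (g := fun _ => 0)) ?int0 ?normr0; last by move=> y; rewrite andbF mul0r.
  by apply: integral_ge0 => y _; exact: e2_ge0.
have [ib ii] := tail_ibp_left hp zx (dn z) (@cw z) (@rn z) (rw z) (nz z).
have E1 y : V x * ((y < z)%R%:R * (dker (x - y) * w z y)) =
    ((y < z) && true)%R%:R * (dker (x - y) * (V x * w z y)) by rewrite andbT; ring.
have E2 y : V x * ((y < z)%R%:R * ((1 - p) * ((x - y) `^ (p - 2) * `|n z y|))) = e2 z x y.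
  by rewrite /e2 zx andbT; ring.
have -> : (\int[mu]_y (e2 z x y)%:E = (V x * \int[mu]_y ((y < z)%R%:R * ((1 - p) * ((x - y) `^ (p - 2) * `|n z y|))))%:E)%E.
  rewrite -(intZ _ ii) -(intE (itgZ _ ii)); apply: eq_integral => y _.
  by rewrite E2.
have iw : itg (fun y => (y < z)%R%:R * (dker (x - y) * w z y)).
  have [A A0 hA] := rw z 2.
  apply: (itgMl (C := 1)).
  - by apply: measurable_natb; exact: measurable_fun_ltr.
  - by move=> y; case: (y < z); rewrite ?normr1 ?normr0.
  - exact: (dconv_itg hp A0 (mw z) hA x).
rewrite -(eq_int E1) (intZ _ iw) normrM (gtr0_norm (V0 x)) lee_fin.
by apply: ler_wpM2l => //; exact: ltW.
Qed.

(* At [z], [q] only sees the kernel element [psi + eta z T], for which [V chi] is the derivative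
   of [n z], a function vanishing at [z]: integrating by parts in [kernel_cross] then trades
   [dker (x - y)] for [(1 - p) (x - y)^(p - 2)]. *)
Let q_bound z : ((`|q z|)%:E <= \int[mu]_x \int[mu]_y (((y < z < x)%R%:R)%:E * D (x, y)))%E.
Proof.
have E : q z = - (V z * chi z z) by rewrite /q /g /chi; ring.
rewrite E normrN (kernel_cross z (kchi z)) normrM (gtr0_norm a_gt0).
apply: (@le_trans _ _ (a%:E * (\int[mu]_x \int[mu]_y (e1 z x y)%:E + \int[mu]_x \int[mu]_y (e2 z x y)%:E))%E).
  rewrite EFinM; apply: lee_wpmul2l; first by rewrite lee_fin ltW.
  apply: (@le_trans _ _ ((`|cross p (w z) V z|)%:E + (`|cross p V (w z) z|)%:E)%E).
    by rewrite -EFinD lee_fin; exact: ler_normD.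
  exact: leeD (cross1 z) (cross2 z).
rewrite (@ge0_int2D R (fun x y => (e1 z x y)%:E) (fun x y => (e2 z x y)%:E) (me1 z) (me2 z) (e1E z) (e2E z)).
have m12 : measurable_fun [set: R * R] (fun u => (e1 z u.1 u.2)%:E + (e2 z u.1 u.2)%:E)%E.
  exact: emeasurable_funD.
have e12 x y : (0 <= (e1 z x y)%:E + (e2 z x y)%:E)%E.
  by rewrite adde_ge0// lee_fin ?e1_ge0 ?e2_ge0.
have mI := measurable_int_right m12 (fun u => e12 u.1 u.2).
have aE : (0 <= a%:E)%E by rewrite lee_fin ltW.
have I0 x : (0 <= \int[mu]_y ((e1 z x y)%:E + (e2 z x y)%:E))%E by exact: integral_ge0.
rewrite -(ge0_integralZl mu measurableT mI (fun x _ => I0 x) aE).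
have -> : (\int[mu]_x (a%:E * \int[mu]_y ((e1 z x y)%:E + (e2 z x y)%:E)) =
    \int[mu]_x \int[mu]_y (a%:E * ((e1 z x y)%:E + (e2 z x y)%:E)))%E.
  apply: eq_integral => x _.
  have nx : measurable_fun [set: R] (fun y => (e1 z x y)%:E + (e2 z x y)%:E)%E :=
    measurableT_comp m12 (measurable_pair1 x).
  by rewrite (ge0_integralZl mu measurableT nx (fun y _ => e12 x y) aE).
apply: ge0_int2_le.
- by apply: emeasurable_funM.
- apply: emeasurable_funM; first by apply/measurable_EFinP; exact: mind.
  by rewrite [X in measurable_fun _ X](_ : _ = D)//; apply/funext => -[].
- by move=> x y; exact: mule_ge0.
move=> x y; rewrite DE -EFinD -!EFinM lee_fin /e1 /e2.
have [/andP[yz zx]|_] := boolP (y < z < x); last by rewrite !mul0r addr0 mulr0.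
have := pointwise yz zx; rewrite !mul1r -mulrDr -mulrDr => H.
have K := ler_wpM2l (k1_ge0 x y) H; move: K; rewrite /k1.
by rewrite [X in _ <= X -> _]mulrA -[X in X <= _ -> _]mulrA -[X in X <= _ -> _]mulrA.
Qed.

(* Integrating [q_bound] in [z] gains a factor [x - y], and [sol_cross] turns the remaining
   double integral into [V]. *)
Let int_q_le : \int[mu]_t `|q t| <= (1 - p) * \int[mu]_t `|q t|.
Proof.
have inq := itg_norm iq.
have mg : measurable_fun [set: R] (fun t => (`|g t|)%:E).
  by apply/measurable_EFinP; exact: continuous_measurable_fun.
have g0 t : (0 <= (`|g t|)%:E)%E by rewrite lee_fin.
have m1 : measurable_fun [set: R] (fun _ : R => 1%E : \bar R) by exact: measurable_cst.
have [mI T1] := tonelli_between mD m1 D_ge0 (fun _ => lee01).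
(* [dker] is negative at negative arguments, so the indicator is what makes [E0] nonnegative; the
   integrals only see [y < x]. *)
pose E0 (u : R * R) : \bar R := ((u.2 < u.1)%R%:R * (a * (1 - p) * (dker (u.1 - u.2) * (V u.1 * V u.2))))%:E.
have mE0 : measurable_fun [set: R * R] E0.
  apply/measurable_EFinP; apply: measurable_funM.
    by apply: measurable_natb; exact: (measurable_fun_ltr measurable_snd measurable_fst).
  apply: measurable_funM => //; apply: measurable_funM; last exact: measurable_funM.
  by apply: (measurableT_comp (measurable_dker p)); exact: measurable_funB.
have E00 u : (0 <= E0 u)%E.
  rewrite lee_fin; have [yx|_] := ltP u.2 u.1; last by rewrite mul0r.
  rewrite mul1r dker_gt0 ?subr_gt0//.
  exact: (mulr_ge0 (mulr_ge0 (ltW a_gt0) q1) (mulr_ge0 (powR_ge0 _ _) (mulr_ge0 (ltW (V0 _)) (ltW (V0 _))))).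
have [_ T2] := tonelli_between mE0 mg E00 g0.
rewrite -lee_fin EFinM -!(intE inq).
apply: (@le_trans _ _ (\int[mu]_t (1 * \int[mu]_x \int[mu]_y (((y < t < x)%R%:R)%:E * D (x, y))))%E).
  apply: (ge0_le_integral mu measurableT) => //.
  - exact: (measurable_int mu inq).
  - by apply: emeasurable_funM.
  - by move=> t _; rewrite mul1e; exact: q_bound.
rewrite T1.
have -> : (\int[mu]_x \int[mu]_y (D (x, y) * \int[mu]_t (((y < t < x)%R%:R)%:E * 1)) =
    \int[mu]_x \int[mu]_y (E0 (x, y) * \int[mu]_t (((y < t < x)%R%:R)%:E * (`|g t|)%:E)))%E.
  apply: eq_integral => x _; apply: eq_integral => y _.
  have [yx|xy] := ltP y x; last first.
    rewrite /E0 /= ltNge xy mul0r mul0e integral0_eq ?mule0// => t _.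
    by rewrite (_ : y < t < x = false) ?mul0e//; apply/negbTE/negP => /andP[h1 h2];
      have := lt_le_trans (lt_trans h1 h2) xy; rewrite ltxx.
  have [i1 ei1] := int_pow_near ltr01 yx.
  have -> : (\int[mu]_t (((y < t < x)%R%:R)%:E * 1) = (x - y)%:E)%E.
    rewrite -[x - y](@powRr1 R) ?subr_ge0 ?ltW// -ei1 -(intE i1); apply: eq_integral => t _.
    by rewrite subrr powRr0 !mulr1 mule1.
  rewrite /D /= muleAC -EFinM; congr (_ * _)%E; rewrite /E0 /= yx mul1r dker_gt0 ?subr_gt0//.
  congr EFin; rewrite /k1 (_ : (x - y) `^ (p - 1) = (x - y) `^ (p - 2) * (x - y)); first by ring.
  rewrite -[in X in _ * X](@powRr1 R (x - y)) ?subr_ge0 ?ltW// -powRD.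
    by congr (_ `^ _); ring.
  by apply/implyP => _; rewrite gt_eqF// subr_gt0.
rewrite -T2.
have -> : (\int[mu]_t ((`|g t|)%:E * \int[mu]_x \int[mu]_y (((y < t < x)%R%:R)%:E * E0 (x, y))) =
    \int[mu]_t ((1 - p) * `|q t|)%:E)%E.
  apply: eq_integral => t _.
  have i2 := @itg2_ind R (fun x y => y < t < x) _ (measurable_cross_ind t)
    (cross_itg2 hp mV mV rV rV).
  have -> : (\int[mu]_x \int[mu]_y (((y < t < x)%R%:R)%:E * E0 (x, y)) =
      \int[mu]_x \int[mu]_y (a * (1 - p) * ((y < t < x)%R%:R * (dker (x - y) * (V x * V y))))%:E)%E.
    apply: eq_integral => x _; apply: eq_integral => y _; rewrite /E0 -EFinM /=; congr EFin.
    have [/andP[h1 h2]|_] := boolP (y < t < x); last by rewrite !mul0r mulr0.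
    by rewrite (lt_trans h1 h2) !mul1r.
  rewrite (int2E (itg2Z (a * (1 - p)) i2)) -EFinM; congr EFin.
  rewrite (_ : \int[mu]_x _ = (1 - p) * V t).
    by rewrite /q normrM (gtr0_norm (V0 t)); ring.
  have [A A0 hA] := rV 2.
  have s x : itg (fun y => (y < t < x)%R%:R * (dker (x - y) * (V x * V y))).
    apply: (itgMl (C := 1)).
    - apply: measurable_natb; apply: measurable_and; last exact: measurable_cst.
      exact: measurable_fun_ltr.
    - by move=> y; case: (y < t < x); rewrite ?normr1 ?normr0.
    - by apply: (eq_itg _ (itgZ (V x) (dconv_itg hp A0 mV hA x))) => y; rewrite mulrCA.
  rewrite (sol_cross t) mulrCA mulrA /cross -(intZ _ (itg2_left i2)).
  by apply: eq_int => x; rewrite (intZ _ (s x)).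
by rewrite (intE (itgZ (1 - p) inq)) (intZ _ inq) EFinM (intE inq).
Qed.

Lemma mean_zero_slope : exists c, forall x, psi x = c * T x.
Proof.
have inq := itg_norm iq; have p0' := p0.
have I0 : \int[mu]_t `|q t| = 0.
  have := int_q_le; have : 0 <= \int[mu]_t `|q t| by apply: int_ge0.
  move: (Rintegral _ _ _) => I I0 h1; apply/eqP; rewrite eq_le I0 andbT.
  by rewrite -(pmulr_rle0 _ p0); lra.
have q0 x : g x = 0.
  have cnq : continuous (fun t => `|q t|) by move=> y; exact: (cvg_norm (@cq y)).
  have /eqP := continuous_int0 cnq inq (fun t => normr_ge0 _) I0 x.
  by rewrite normr_eq0 /q mulf_eq0 gt_eqF//= => /eqP.
have etac x : eta x = eta 0.
  have h1 y : `|g y| <= 0 by rewrite q0 normr0.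
  have := mvt_lip d_eta h1 x 0; rewrite mul0r normr_le0 subr_eq0.
  by move=> /eqP.
exists (- eta 0) => x; rewrite -(etac x).
have := q0 x; rewrite /g => /eqP; rewrite subr_eq0 => /eqP e.
by rewrite mulNr -e opprK.
Qed.

End mean_zero.

Theorem kernel_span psi : kernel psi ->
  exists c d, forall x, psi x = c * T x + d * dilation p C V x.
Proof.
move=> kp; have kR := dilation_kernel hp C0 VE iV vE.
have R0 := dilation_mean hp C0 VE iV vE.
pose d := (\int[mu]_x (V x * psi x)) / \int[mu]_x (V x * dilation p C V x).
have k1 := kernel_lin hp 1 (- d) kp kR.
have [_ i1 _] := kp; have [_ i2 _] := kR.
have z : \int[mu]_x (V x * (1 * psi x + - d * dilation p C V x)) = 0.
  transitivity (\int[mu]_x (V x * psi x) + (- d) * \int[mu]_x (V x * dilation p C V x)).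
    by rewrite -(intZ (- d) i2) -(intD i1 (itgZ (- d) i2)); apply: eq_int => x; ring.
  by rewrite mulNr /d divfK ?subrr// gt_eqF.
have [c hc] := mean_zero_slope k1 z.
by exists c, d => x; rewrite -hc; ring.
Qed.

End nondegeneracy.

(** * From weak solutions to the integral equation *)

Section growth.
Context {R : realType}.
Variable p : R.
Hypothesis hp : 0 < p < 1.
Notation mu := (@lebesgue_measure R).

Let p0 : 0 < p. Proof. by case/andP: hp. Qed.

Let p1 : p < 1. Proof. by case/andP: hp. Qed.

Lemma sublinear_pow (b K : R) : 0 < b -> 0 <= K ->
  exists B : R, forall x, 0 <= x -> K * x `^ p <= b * x + B.
Proof.
move=> b0 K0; have p0' := p0; have q0 : 0 < 1 - p by have := p1; lra.
(* The crossing point [K X^p = b X], beyond which the linear term dominates. *)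
pose X := (K / b) `^ (1 - p)^-1; have X0 : 0 <= X by exact: powR_ge0.
exists (K * X `^ p) => x x0; have Kp : 0 <= K * X `^ p by rewrite mulr_ge0 ?powR_ge0.
have bx : 0 <= b * x by rewrite mulr_ge0 ?(ltW b0).
have [xX|Xx] := leP x X.
  have : K * x `^ p <= K * X `^ p by rewrite ler_wpM2l// powR_mono// ltW.
  by move=> h; apply: le_trans h _; rewrite lerDr.
have x1 : 0 < x by exact: le_lt_trans Xx.
have h : K / b <= x `^ (1 - p).
  have -> : K / b = X `^ (1 - p).
    by rewrite /X -powRrM mulVf ?gt_eqF// powRr1// divr_ge0 ?(ltW b0).
  by apply: powR_mono => //; exact: ltW.
have : K * x `^ p <= b * x; last by move=> h1; apply: le_trans h1 _; rewrite lerDl.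
have E : x = x `^ (1 - p) * x `^ p :> R.
  rewrite -powRD; last by apply/implyP => _; rewrite gt_eqF.
  by rewrite subrK powRr1.
rewrite [in X in _ <= b * X]E mulrA ler_wpM2r ?powR_ge0//.
by rewrite mulrC -ler_pdivrMr.
Qed.

(** The linear term beats [K |x|^p], so the exponential stays above a positive constant on
    [x >= 1]. *)
Lemma exp_slope_gt0 (c0 c1 K : R) (g : R -> R) : 0 <= K -> (forall x, `|g x| <= K * `|x| `^ p) ->
  0 < c1 -> ~ itg (fun x => expR (c0 + c1 * x - g x)).
Proof.
move=> K0 hg c10; have [B hB] := sublinear_pow c10 K0.
apply: (not_itg hp (k := expR (c0 - B))); first exact: expR_gt0.
move=> x x1; have x0 : 0 <= x by lra.
rewrite (ger0_norm (expR_ge0 _)).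
apply: (@le_trans _ _ (expR (c0 - B))).
  rewrite ler_piMr ?expR_ge0// -[X in _ <= X](powRr0 (1 + `|x|)).
  by apply: wt_le; rewrite oppr_le0 ltW.
rewrite ler_expR; have := hB x x0; have := hg x; rewrite (ger0_norm x0).
move=> h1 h2; have := ler_norm (g x); move: (x `^ p) h1 h2 => P h1 h2; lra.
Qed.

Lemma exp_slope0 (c0 c1 K : R) (g : R -> R) : 0 <= K -> (forall x, `|g x| <= K * `|x| `^ p) ->
  itg (fun x => expR (c0 + c1 * x - g x)) -> c1 = 0.
Proof.
move=> K0 hg i; have [c1n|c1p|//] := ltgtP c1 0; last by have := exp_slope_gt0 K0 hg c1p i.
have hg' x : `|g (0 - x)| <= K * `|x| `^ p by have := hg (0 - x); rewrite sub0r normrN.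
have c1n' : 0 < - c1 by rewrite oppr_gt0.
have := @exp_slope_gt0 c0 (- c1) K (fun x => g (0 - x)) K0 hg' c1n'.
case; apply: (eq_itg _ (itg_refl 0 i)) => x; congr expR; ring.
Qed.

(** By continuity the bound holds at every [x > M]; since [p < 1], a term [c1 * x] of order [|x|^p]
    must vanish. *)
Lemma growth_slope0 (c0 c1 K K' M : R) (g : R -> R) : continuous g -> 0 <= K ->
  (forall x, `|g x| <= K * `|x| `^ p) ->
  {ae mu, forall x, M < `|x| -> `|c0 + c1 * x - g x| <= K' * `|x| `^ p} -> c1 = 0.
Proof.
move=> cg K0 hg ae; have p0' := p0.
pose F x := `|c0 + c1 * x - g x| - K' * `|x| `^ p.
have cF : continuous F.
  move=> x; apply: cvgB; last by apply: cvgMr; exact: continuous_normpowR.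
  apply: cvg_norm; apply: cvgB; last exact: cg.
  by apply: cvgD; [exact: cvg_cst|apply: cvgMr; exact: cvg_id].
have oU : open ([set x | M < x] `&` F @^-1` [set y | 0 < y]).
  apply: openI; first exact: open_gt.
  by apply: open_comp; [move=> x _; exact: cF|exact: open_gt].
have aeU : {ae mu, forall x, ~ ([set x | M < x] `&` F @^-1` [set y | 0 < y]) x}.
  apply: ae_mono ae => x h [/= Mx]; rewrite /F subr_gt0 ltNge.
  by rewrite h// (lt_le_trans Mx)// ler_norm.
have hF x : M < x -> `|c0 + c1 * x - g x| <= K' * `|x| `^ p.
  move=> Mx; rewrite leNgt; apply/negP => h; apply: (ae_open_empty oU aeU (x := x)).
  by split => //=; rewrite /F subr_gt0.
(* The points [x = N r] with [r >= 1] satisfy both [x > M] and [x >= 1]. *)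
pose N := `|M| + 1; have N1 : 1 <= N by rewrite /N lerDr.
pose L := `|c0| + K + `|K'|; have L0 : 0 <= L by rewrite !addr_ge0.
apply/eqP; rewrite -normr_eq0; apply/eqP.
have q0 : 0 < 1 - p by have := p1; lra.
apply: (small_powR (C := L * N `^ p) q0) => //; first by rewrite mulr_ge0 ?powR_ge0.
move=> r r1; have r0 : 0 < r by lra.
pose x := N * r; have x1 : 1 <= x by rewrite -[1]mulr1 ler_pM.
have x0 : 0 < x by lra.
have Mx : M < x.
  apply: (@lt_le_trans _ _ N); first by rewrite /N; have := ler_norm M; lra.
  by rewrite /x ler_peMr//; lra.
have xp : 1 <= x `^ p by have := powR_mono (ltW p0) ler01 x1; rewrite powR1.
have h1 : `|c1| * x <= L * x `^ p.
  have := hF x Mx; have := hg x; rewrite (gtr0_norm x0) => hg' hF'.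
  have : `|c1 * x| <= `|c0 + c1 * x - g x| + `|g x| + `|c0|.
    have := ler_normD (c0 + c1 * x - g x) (g x - c0).
    rewrite (_ : c0 + c1 * x - g x + (g x - c0) = c1 * x); last by ring.
    have := ler_normB (g x) c0; move: (`|_|) (`|_|) (`|_|) (`|_|) (`|_|) => *; lra.
  rewrite normrM (gtr0_norm x0) => h; apply: le_trans h _.
  have k1 : K' * x `^ p <= `|K'| * x `^ p by rewrite ler_wpM2r ?powR_ge0// ler_norm.
  have k2 : `|c0| <= `|c0| * x `^ p by rewrite ler_peMr.
  rewrite /L !mulrDl; lra.
have E : x `^ p = N `^ p * (r `^ (- (1 - p)) * r).
  rewrite /x powRM; [|lra|exact: ltW]; congr (_ * _).
  rewrite -[in X in _ = _ * X](powRr1 (ltW r0)) -powRD; last by apply/implyP => _; rewrite gt_eqF.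
  by congr (_ `^ _); ring.
rewrite -(ler_pM2r r0) -!mulrA -E; apply: le_trans h1.
by rewrite ler_wpM2l// /x ler_peMl//; lra.
Qed.

End growth.

(** * Representation formulas and proof of the theorem *)

Section assembly.
Context {R : realType}.
Variable s : R.
Hypothesis hs : 2^-1 < s < 1.
Notation mu := (@lebesgue_measure R).
Notation p := (2 * s - 1).
Notation W x := ((1 + `|x|) `^ (- (2 + p))).

Let hp : 0 < p < 1. Proof. exact: order_range. Qed.

Let p0 : 0 < p. Proof. by case/andP: hp. Qed.

Let p1 : p < 1. Proof. by case/andP: hp. Qed.

(** Normalised so that [- pot_const * pot p h] solves the equation with right-hand side [h], as
    [frac_lap] is [frac_const s / 2] times [fl] and [fl] sends [pot p h] weakly to [- kap p * h]. *)
Definition pot_const := (frac_const s / 2 * kap p)^-1.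

Lemma pot_const_gt0 : 0 < pot_const.
Proof. by rewrite invr_gt0 mulr_gt0 ?kap_gt0// divr_gt0// frac_const_gt0. Qed.

Notation C := pot_const.

Let Cs_gt0 : 0 < frac_const s / 2. Proof. by rewrite divr_gt0// frac_const_gt0. Qed.

Let CE : frac_const s / 2 * (C * kap p) = 1.
Proof.
rewrite mulrCA mulVf// gt_eqF// mulr_gt0// kap_gt0//.
Qed.

Lemma growth_weight (f : R -> R) (M : R) : measurable_fun [set: R] f ->
  (forall x, `|f x| <= M * (1 + `|x|) `^ p) -> itg (fun x => f x * W x).
Proof.
move=> mf hf; have l12 : (1 : R) < 2 by lra.
apply: (itg_le _ (itgZ M (itg_wt l12))).
  by apply: measurable_funM => //; exact: measurable_wt.
move=> x; rewrite normrM [X in _ * X]ger0_norm ?powR_ge0//.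
rewrite (_ : - 2 = p - (2 + p)); last by ring.
by rewrite -wt_mul mulrA ler_wpM2r// powR_ge0.
Qed.

(** [psi + C * pot p h] is integrable against the weight and annihilated by [fl], hence affine by
    [liouville]. *)
Lemma representation (psi h : R -> R) : L_space s psi -> itg h ->
  (forall phi, tst phi ->
    frac_const s / 2 * \int[mu]_x (psi x * fl p phi x) = \int[mu]_x (h x * phi x)) ->
  exists c0 c1 : R, {ae mu, forall x, psi x = c0 + c1 * x - C * pot p h x}.
Proof.
move=> Lp ih weak; have [mp ip] := proj1 (L_spaceP hs psi) Lp.
have cpot := pot_continuous hp ih; have mpot := continuous_measurable_fun cpot.
pose I := \int[mu]_x `|h x|; have I0 : 0 <= I by exact: int_ge0.
have ipot : itg (fun x => pot p h x * W x).
  by apply: (growth_weight mpot (M := I)) => x; exact: pot_growth.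
pose f x := psi x + C * pot p h x.
have mf : measurable_fun [set: R] f by apply: measurable_funD => //; exact: measurable_funM.
have fw : itg (fun x => f x * W x).
  by apply: (eq_itg _ (itgD ip (itgZ C ipot))) => x; rewrite /f; ring.
have harm phi : tst phi -> \int[mu]_x (f x * fl p phi x) = 0.
  move=> tp; have i1 := L_space_fl hs Lp tp.
  have i2 : itg (fun x => pot p h x * fl p phi x).
    by apply: (fl_itgM hp mpot I0 _ tp) => x; exact: pot_growth.
  have -> : \int[mu]_x (f x * fl p phi x) =
      \int[mu]_x (psi x * fl p phi x) + C * \int[mu]_x (pot p h x * fl p phi x).
    by rewrite -(intZ C i2) -(intD i1 (itgZ C i2)); apply: eq_int => x; rewrite mulrDl mulrA.
  rewrite (pot_fl hp ih tp) -(weak phi tp).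
  move: (Rintegral _ _ _) => I1; rewrite mulrA mulrN mulNr mulrCA mulrA.
  by rewrite CE mul1r subrr.
have [c0 [c1 e]] := liouville hp (weighted_loc hs mf fw) fw harm.
exists c0, c1; apply: ae_mono e => x <-; rewrite /f; ring.
Qed.

Variable u : R -> R.
Hypothesis hu : liouville_solution s u.
Hypothesis hint : (\int[mu]_x (expR (u x))%:E < +oo)%E.

Let Lu : L_space s u. Proof. by case: hu. Qed.

Let mu_ : measurable_fun [set: R] u. Proof. by have [] := proj1 (L_spaceP hs u) Lu. Qed.

Let ieu : itg (fun x => expR (u x)).
Proof.
apply: itgI; first exact: (measurableT_comp (@measurable_expR R)).
by under eq_integral do rewrite ger0_norm ?expR_ge0//.
Qed.

Let tst_int (h phi : R -> R) : itg h -> tst phi -> itg (fun x => h x * phi x).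
Proof.
move=> ih tp; have [B B0 hB] := tst_bound tp.
by apply: (eq_itg _ (itgMl (tst_measurable tp) hB ih)) => x; rewrite mulrC.
Qed.

Lemma solution_representation : exists (a0 : R) (v V : R -> R),
  [/\ forall x, V x = expR (v x), itg V, forall x, v x = a0 - C * pot p V x &
      {ae mu, forall x, u x = v x}].
Proof.
have weak := proj1 (weak_form hs (fun phi tp => L_space_fl hs Lu tp)
  (fun phi tp => tst_int ieu tp)) (let: And3 _ _ h := hu in h).
have [c0 [c1 e]] := representation Lu ieu weak.
pose h x := expR (u x); pose v x := c0 + c1 * x - C * pot p h x.
pose I := \int[mu]_x `|h x|; have I0 : 0 <= I by exact: int_ge0.
have cpot := pot_continuous hp ieu.
have cv : continuous v.
  move=> x; apply: cvgB; last by apply: cvgMr; exact: cpot.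
  by apply: cvgD; [exact: cvg_cst|apply: cvgMr; exact: cvg_id].
have mV : measurable_fun [set: R] (fun x => expR (v x)).
  exact: (measurableT_comp (@measurable_expR R) (continuous_measurable_fun cv)).
have aeV : {ae mu, forall x, h x = expR (v x)} by apply: ae_mono e => x; rewrite /h => ->.
have iV : itg (fun x => expR (v x)) := itg_ae mV aeV ieu.
have c10 : c1 = 0.
  apply: (exp_slope0 hp (c0 := c0) (K := C * I) (g := fun x => C * pot p h x)) iV.
    by rewrite mulr_ge0// ltW// pot_const_gt0.
  move=> x; rewrite normrM (gtr0_norm pot_const_gt0) -mulrA ler_wpM2l ?(ltW pot_const_gt0)//.
  by rewrite [I * _]mulrC; exact: (pot_le hp x ieu).
exists c0, v, (fun x => expR (v x)); split; [by []|exact: iV| |]; last first.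
  by apply: ae_mono e => x ->.
move=> x; rewrite {1}/v c10 mul0r addr0; congr (_ - _ * _); apply: int_ae.
- exact: itg_meas (pot_itg hp x ieu).
- exact: itg_meas (pot_itg hp x iV).
- by apply: ae_mono aeV => y ->.
Qed.

Section with_representation.
Variables (a0 : R) (v V : R -> R).
Hypothesis VE : forall x, V x = expR (v x).
Hypothesis iV : itg V.
Hypothesis vE : forall x, v x = a0 - C * pot p V x.
Hypothesis uv : {ae mu, forall x, u x = v x}.

Let C0 : 0 < C := pot_const_gt0.

Let rV : rapid V. Proof. exact: (sol_rapid hp C0 VE iV vE). Qed.

Let aeV : {ae mu, forall x, expR (u x) = V x}.
Proof. by apply: ae_mono uv => x ->; rewrite VE. Qed.

Lemma cont_repE : cont_rep u = v.
Proof.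
have cv : continuous v := sol_continuous_log hp iV vE.
apply: xget_unique => /=.
  by split; [exact: cv|apply: ae_mono uv => x ->].
move=> w [cw wu]; apply/funext => x; apply/eqP/negPn/negP => wv.
have oU : open ((fun x => w x - v x) @^-1` [set y | y != 0]).
  apply: open_comp; last exact: open_neq.
  by move=> y _; apply: cvgB; [exact: cw|exact: cv].
apply: (ae_open_empty oU _ (x := x)); last by rewrite /= subr_eq0.
by apply: ae_mono (ae_and wu uv) => y [e1 e2]; rewrite /preimage /= e1 e2 subrr eqxx.
Qed.

Lemma T_funE : T_fun u = slope p C V.
Proof. by rewrite /T_fun cont_repE; exact: (is_deriveE (sol_log_derive hp C0 VE iV vE)). Qed.

Lemma R_funE : R_fun s u = dilation p C V.
Proof.
rewrite /R_fun cont_repE (is_deriveE (sol_log_derive hp C0 VE iV vE)).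
by apply/funext => x; rewrite /dilation subrK.
Qed.

Lemma kernel_representation psi : ker_lin s u psi ->
  exists2 psi', kernel_element p C V psi' & {ae mu, forall x, psi x = psi' x}.
Proof.
move=> [[Lp [K' [M growth]]] weak]; have [mp ip] := proj1 (L_spaceP hs psi) Lp.
have ih : itg (fun x => expR (u x) * psi x).
  have mh : measurable_fun [set: R] (fun x => expR (u x) * psi x).
    exact: (measurable_funM (itg_meas ieu) mp).
  (* [psi] is integrable against [(1+|x|)^(-2-p)], and the rapid decay of [V] absorbs the inverse of
     this weight. *)
  have [A A0 hA] := rV (2 + p).
  have hb x : `|V x * (1 + `|x|) `^ (2 + p)| <= A.
    rewrite normrM [X in _ * X]ger0_norm ?powR_ge0// -ler_pdivlMr ?wt_gt0//.
    by rewrite -powRN; exact: hA.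
  have mb : measurable_fun [set: R] (fun x => V x * (1 + `|x|) `^ (2 + p)).
    by apply: measurable_funM; [exact: itg_meas iV|exact: measurable_wt].
  apply: (itg_ae mh _ (itgMl mb hb ip)); apply: ae_mono aeV => x ->.
  have w0 : (1 + `|x|) `^ (2 + p) != 0 by rewrite gt_eqF// wt_gt0.
  by rewrite powRN; field.
have {}weak := proj1 (weak_form hs (fun phi tp => L_space_fl hs Lp tp)
  (fun phi tp => tst_int ih tp)) weak.
have [c0 [c1 e]] := representation Lp ih weak.
set h := fun x => expR (u x) * psi x.
pose I := \int[mu]_x `|h x|; have I0 : 0 <= I by exact: int_ge0.
have cpot := pot_continuous hp ih.
have cg : continuous (fun x => C * pot p h x) by move=> x; apply: cvgMr; exact: cpot.
have c10 : c1 = 0.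
  apply: (growth_slope0 hp (c0 := c0) (K := C * I) (K' := K') (M := M) cg).
  - by rewrite mulr_ge0// ltW.
  - move=> x; rewrite normrM (gtr0_norm C0) -mulrA ler_wpM2l ?(ltW C0)//.
    by rewrite [I * _]mulrC; exact: (pot_le hp x ih).
  - by apply: ae_mono (ae_and growth e) => x [+ <-].
pose psi' x := c0 - C * pot p h x.
have cpsi : continuous psi' by move=> x; apply: cvgB; [exact: cvg_cst|exact: cg].
have ae' : {ae mu, forall x, psi x = psi' x}.
  by apply: ae_mono e => x ->; rewrite c10 mul0r addr0.
have mV' : measurable_fun [set: R] (fun x => V x * psi' x).
  by apply: measurable_funM; [exact: itg_meas iV|exact: continuous_measurable_fun].
have aeh : {ae mu, forall x, h x = V x * psi' x}.
  by apply: ae_mono (ae_and aeV ae') => x [e1 e2]; rewrite /h e1 e2.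
have iV' : itg (fun x => V x * psi' x) := itg_ae mV' aeh ih.
exists psi' => //; split => //; exists c0 => x; rewrite {1}/psi'; congr (_ - _ * _).
apply: int_ae.
- exact: itg_meas (pot_itg hp x ih).
- exact: itg_meas (pot_itg hp x iV').
- by apply: ae_mono aeh => y ->.
Qed.

Lemma kernel_ker_lin psi psi' : measurable_fun [set: R] psi -> kernel_element p C V psi' ->
  {ae mu, forall x, psi x = psi' x} -> ker_lin s u psi.
Proof.
move=> mp kp ae; have [cp ip [c e]] := kp.
have [M M0 hM] := kernel_growth hp C0 kp.
have mp' := continuous_measurable_fun cp.
have Lp : L_space s psi.
  apply/(L_spaceP hs); split => //.
  apply: itg_ae (growth_weight mp' hM); last by apply: ae_mono ae => x ->.
  by apply: measurable_funM => //; exact: measurable_wt.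
pose h x := V x * psi' x.
have mh : measurable_fun [set: R] (fun x => expR (u x) * psi x).
  exact: (measurable_funM (itg_meas ieu) mp).
have aeh : {ae mu, forall x, h x = expR (u x) * psi x}.
  by apply: ae_mono (ae_and aeV ae) => x [-> ->].
have ih := itg_ae mh aeh ip.
split; first split => //.
  exists (M * 2 `^ p), 1; apply: ae_mono ae => x -> x1; apply: le_trans (hM x) _.
  rewrite -mulrA ler_wpM2l// -powRM//; apply: powR_mono; [exact: ltW|exact: addr_ge0|lra].
apply/(weak_form hs (fun phi tp => L_space_fl hs Lp tp) (fun phi tp => tst_int ih tp)) => phi tp.
have mfl := fl_measurable hp tp; have mphi := tst_measurable tp.
have [K K0 hK] := fl_decay hp tp.
have i0 : itg (fl p phi).
  by apply: (itg_le mfl _ hK); apply/itgZ/itg_wt; have := p0; lra.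
pose I := \int[mu]_x `|h x|; have I0 : 0 <= I by exact: int_ge0.
have mpot := continuous_measurable_fun (pot_continuous hp ip).
have i2 : itg (fun x => pot p h x * fl p phi x).
  by apply: (fl_itgM hp mpot I0 _ tp) => x; exact: pot_growth.
have -> : \int[mu]_x (psi x * fl p phi x) = C * kap p * \int[mu]_x (h x * phi x).
  transitivity (\int[mu]_x (c * fl p phi x - C * (pot p h x * fl p phi x))).
    apply: int_ae.
    - exact: measurable_funM.
    - exact: itg_meas (itgB (itgZ c i0) (itgZ C i2)).
    - by apply: ae_mono ae => x ->; rewrite {1}e mulrBl mulrA.
  rewrite (intB (itgZ c i0) (itgZ C i2)) (intZ c i0) (intZ C i2) (fl_int0 hp tp) (pot_fl hp ip tp).
  by move: (Rintegral _ _ _) => J; ring.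
rewrite mulrA CE mul1r; apply: int_ae.
- exact: (measurable_funM (itg_meas ip) mphi).
- exact: (measurable_funM mh mphi).
- by apply: ae_mono aeh => x ->.
Qed.

End with_representation.

End assembly.

Theorem theorem1p5 (R : realType) (s : R) (u : R -> R)
    (hs : 2^-1 < s < 1)
    (hu : liouville_solution s u)
    (hint : (\int[lebesgue_measure]_x (expR (u x))%:E < +oo)%E) :
  ker_lin s u = ae_span2 (T_fun u) (R_fun s u).
Proof.
have [a0 [v [V [VE iV vE uv]]]] := solution_representation hs hu hint.
have hp := order_range hs; have C0 := pot_const_gt0 hs.
apply/seteqP; split=> psi.
- move=> kp; have [psi' kp' ae] := kernel_representation hs hu hint VE iV vE uv kp.
  have [[Lp _] _] := kp.
  split; first by have [] := proj1 (L_spaceP hs psi) Lp.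
  have [c [d e]] := kernel_span hp C0 VE iV vE kp'.
  exists c, d; apply: ae_mono ae => x ->.
  by rewrite (T_funE hs VE iV vE uv) (R_funE hs VE iV vE uv) e.
move=> [mp [c [d ae]]].
have kp := kernel_lin hp c d (slope_kernel hp C0 VE iV vE) (dilation_kernel hp C0 VE iV vE).
apply: (kernel_ker_lin hs hu hint VE uv mp kp); apply: ae_mono ae => x ->.
by rewrite (T_funE hs VE iV vE uv) (R_funE hs VE iV vE uv).
Qed.
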